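(* Let $N$ be a type $\mathrm{II}_1$ factor with its unique faithful normal tracial state $\tau$, and let $\sigma : \Gamma \curvearrowright N$ be an action of a discrete group $\Gamma$. Suppose that for every bounded net $(x_i)_{i \in I}$ in $N$ which satisfies $\lim_i \|x_i a - a x_i\|_2 = 0$ for all $a \in N$ and $\lim_i \|\sigma_g(x_i) - x_i\|_2 = 0$ for all $g \in \Gamma$, we have $\lim_i \|x_i - \tau(x_i)\|_2 = 0$. Then there exist a finite set of unitaries $S \subset \mathcal{U}(N)$, a finite set $K \subset \Gamma$, and a constant $\kappa > 0$ such that for all $x \in N$ we have $$\|x - \tau(x)\|_2 \leq \kappa \left( \sum_{u \in S} \|ux - xu\|_2 + \sum_{g \in K} \|\sigma_g(x) - x\|_2 \right).$$
   Context: $\|x\|_2 = \tau(x^*x)^{1/2}$; $\mathcal{U}(N)$ is the unitary group of $N$. An action $\sigma : \Gamma \curvearrowright N$ is a group homomorphism $g \mapsto \sigma_g$ from $\Gamma$ to the group of $*$-automorphisms of $N$. A bounded net means bounded in operator norm. Scalars are identified with multiples of the unit. *)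

(* Defs.v *)
From HB Require Import structures.
From mathcomp Require Import all_boot all_order all_algebra.
From mathcomp Require Import finmap.
From mathcomp Require Import all_classical all_reals all_analysis.
From mathcomp Require Import complex.

Set Implicit Arguments.
Unset Strict Implicit.
Unset Printing Implicit Defensive.

Import Order.TTheory GRing.Theory Num.Theory.
Import numFieldNormedType.Exports.

Local Open Scope classical_set_scope.
Local Open Scope ring_scope.

(* Bounded operators on H are the continuous elements of {linear H -> H}. *)
Definition commutant (R : realType) (H : normedModType R[i])
    (A : set {linear H -> H}) : set {linear H -> H} :=
  [set T | continuous T /\ forall S, A S -> T \o S =1 S \o T].

(* A von Neumann algebra is an abstract complex *-algebra together with a
   faithful unital *-representation on a Hilbert space whose image is its own
   bicommutant.  The norm of H is valued in R[i] (its values are nonnegative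
   reals), and the inner product is linear in its first variable.  As an
   algType is a nonzero ring, the zero algebra is left out. *)
Record vonNeumannAlgebra (R : realType) := VonNeumannAlgebra {
  vn_alg :> algType R[i];
  star : vn_alg -> vn_alg;
  vn_space : completeNormedModType R[i];
  vn_dot : {dot vn_space for Num.conj};
  vn_rep : vn_alg -> {linear vn_space -> vn_space};
  starK : involutive star;
  starD : forall x y, star (x + y) = star x + star y;
  starZ : forall (c : R[i]) x, star (c *: x) = Num.conj c *: star x;
  starM : forall x y, star (x * y) = star y * star x;
  vn_dot_norm : forall v, `|v| ^+ 2 = vn_dot v v;
  vn_repD : forall x y v, vn_rep (x + y) v = vn_rep x v + vn_rep y v;
  vn_repZ : forall (c : R[i]) x v, vn_rep (c *: x) v = c *: vn_rep x v;
  vn_rep1 : forall v, vn_rep 1 v = v;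
  vn_repM : forall x y v, vn_rep (x * y) v = vn_rep x (vn_rep y v);
  vn_rep_star : forall x v w,
    vn_dot (vn_rep (star x) v) w = vn_dot v (vn_rep x w);
  vn_rep_faithful : forall x y, vn_rep x =1 vn_rep y -> x = y;
  vn_rep_continuous : forall x, continuous (vn_rep x);
  vn_bicommutant : forall T : {linear vn_space -> vn_space},
    commutant (commutant (range vn_rep)) T -> exists x, T =1 vn_rep x }.

Section VonNeumannAlgebra.
Variables (R : realType) (N : vonNeumannAlgebra R).
Implicit Types (x y p u v z s : N) (D : set N).

Definition opnorm_le x (M : R) : Prop :=
  forall w : vn_space N, `|vn_rep x w| <= M%:C%C * `|w|.

Definition vn_unitary u : Prop := star u * u = 1 /\ u * star u = 1.

Definition vn_projection p : Prop := p * p = p /\ star p = p.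

Definition vn_abelian_projection p : Prop :=
  vn_projection p /\
  forall x y, (p * x * p) * (p * y * p) = (p * y * p) * (p * x * p).

Definition vn_factor : Prop :=
  forall z, (forall x, z * x = x * z) -> exists c : R[i], z = c%:A.

Definition vn_finite : Prop := forall v, star v * v = 1 -> v * star v = 1.

Definition vn_type_II1 : Prop :=
  vn_finite /\ forall p, vn_abelian_projection p -> p = 0.

Definition vn_positive x : Prop := exists y, x = star y * y.

Definition vn_le x y : Prop := vn_positive (y - x).

Definition vn_lub D s : Prop :=
  (forall x, D x -> vn_le x s) /\
  (forall t, (forall x, D x -> vn_le x t) -> vn_le s t).

Definition vn_directed D : Prop :=
  D !=set0 /\
  forall x y, D x -> D y -> exists z, [/\ D z, vn_le x z & vn_le y z].

(* The supremum of tau @` D is taken for the order of R[i], which on reals is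
   the usual one. *)
Definition vn_normal (tau : N -> R[i]) : Prop :=
  forall D s, vn_directed D -> (forall x, D x -> vn_positive x) ->
    vn_lub D s -> supremums [set tau x | x in D] (tau s).

Record faithful_normal_tracial_state (tau : {scalar N}) : Prop := {
  state_ge0 : forall x, 0 <= tau (star x * x);
  state1 : tau 1 = 1;
  state_trace : forall x y, tau (x * y) = tau (y * x);
  state_faithful : forall x, tau (star x * x) = 0 -> x = 0;
  state_normal : vn_normal tau }.

Definition norm2 (tau : N -> R[i]) x : R :=
  Num.sqrt (complex.Re (tau (star x * x))).

(* The remaining automorphism laws are carried by {lrmorphism N -> N}, and
   sigma 1 = id follows from multiplicativity and bijectivity. *)
Record vn_action (Gamma : groupType) (sigma : Gamma -> {lrmorphism N -> N}) :
    Prop := {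
  action_bij : forall g, bijective (sigma g);
  action_star : forall g x, sigma g (star x) = star (sigma g x);
  actionM : forall (g h : Gamma) x, sigma (g * h)%g x = sigma g (sigma h x) }.

End VonNeumannAlgebra.

Record directed_preorder (I : Type) (le : I -> I -> Prop) : Prop := {
  directed_inhabited : inhabited I;
  directed_refl : forall i, le i i;
  directed_trans : forall i j k, le i j -> le j k -> le i k;
  directed_ub : forall i j, exists k, le i k /\ le j k }.

Definition net_filter (I : Type) (le : I -> I -> Prop) : set_system I :=
  filter_from [set: I] (fun i => [set j | le i j]).

Lemma net_filter_proper (I : Type) (le : I -> I -> Prop) :
  directed_preorder le -> ProperFilter (net_filter le).
Proof.
move=> [[i0] le_refl le_trans le_ub]; apply: filter_from_proper.
  apply: filter_from_filter; first by exists i0.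
  move=> i j _ _; have [k [ik jk]] := le_ub i j.
  by exists k => // l kl; split; [exact: le_trans kl|exact: le_trans kl].
by move=> i _; exists i; exact: le_refl.
Qed.

Lemma net_cvg0P (R : realType) (I : Type) (le : I -> I -> Prop) (f : I -> R) :
  f i @[i --> net_filter le] --> (0 : R) <->
  forall e : R, 0 < e -> exists i0, forall i, le i0 i -> `|f i| < e.
Proof.
split=> [f0 e e0|f0 A].
  have [i0 _ i0P] := f0 _ (nbhsx_ballx (0 : R) e e0).
  by exists i0 => i /i0P; rewrite /ball /= sub0r normrN.
case/nbhs_ballP => e e0 eA; have [i0 i0P] := f0 e e0.
by exists i0 => // i /i0P; rewrite -normrN -sub0r => ?; apply: eA.
Qed.

(* Main.v *)
Require Import Defs.
From HB Require Import structures.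
From mathcomp Require Import all_boot all_order all_algebra.
From mathcomp Require Import finmap.
From mathcomp Require Import all_classical all_reals all_analysis.
From mathcomp Require Import complex.
From mathcomp Require Import ring lra.
From Stdlib Require Ncring Ncring_tac.

Import Order.TTheory GRing.Theory Num.Theory.
Import numFieldNormedType.Exports.

Local Open Scope classical_set_scope.
Local Open Scope ring_scope.

Set Implicit Arguments.
Unset Strict Implicit.
Unset Printing Implicit Defensive.

(** The inequality is a second order condition for a variational problem.

    Write |x| for the 2-norm, and let D be the energy, that is, the sum of the
    squares of the |a x - x a| and |sigma_g(x) - x| over finitely many a and g.
    The hypothesis on nets is equivalent to a uniform statement
    ([bounded_gap]): some D controls the distance to the scalars on the unit
    ball for the operator norm. If there is no spectral gap, then there
    are self-adjoint vectors x of trace zero with |x| = 1 that are almost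
    central and almost invariant ([no_gap_vector]), but nothing bounds their
    operator norms, so the hypothesis does not apply to them directly. Nor can
    they be truncated: their mass may sit on projections of very small trace.

    Instead, maximize L(y) = |y|^2 - A D(y) over the self-adjoint y of trace zero
    in the unit ball for the operator norm, with a large constant A. As
    L(y) >= L(0) = 0, the energy of a maximizer is at most |y|^2 / A, so
    [bounded_gap] makes |y| small. On the other hand y can be moved inside the
    ball in the directions s k x k, where k = 1 - y y and x is one of the vectors
    above: however large the norm of x is, s may be chosen small, and
    the sign of s may be chosen freely, so maximality forces
    |k x k|^2 <= A D(k x k). As x is almost central, the functional
    a |-> tau(x a x) is almost a trace, and it converges to tau because a
    II_1 factor has only one tracial state. In the limit |k k|^2 <= A D(k k), and
    D(k k) <= 16 D(y) <= 16 |y|^2 / A ([second_variation]). But k k is close to 1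
    and |y| is small, a contradiction.

    Two facts carry this argument. First, the unit ball is complete for the
    2-norm ([ball_complete]); a perturbation of L by small multiples of squared
    distances then has a maximum ([quadratic_maximum]), which is enough.
    Secondly, tracial states are unique, without any normality assumption
    ([unique_trace]); the automorphisms sigma_g therefore preserve tau as well.
    Uniqueness rests on the comparison of projections, which is again the second
    order condition of a maximum: if y maximizes the 2-norm in the unit ball of
    the corner q N p, then q - y y' or p - y' y vanishes, where y' is the adjoint
    of y ([comparison]). Comparison bounds any tracial state on projections of
    small trace, hence makes it continuous for the 2-norm on the ball
    ([trace_continuous]), and the unitarily invariant minimization of
    [scalar_minimum] finishes.

    The functional calculus used along the way is obtained from monotone
    limits of polynomials: square roots, inverses, absolute values and support
    projections. *)

(** * Real parts of complex scalars *)

Section RealPart.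
Variable R : realType.
Implicit Types (z w : R[i]) (r : R).

Lemma ReD z w : complex.Re (z + w) = complex.Re z + complex.Re w.
Proof. by case: z w => [a b] [c d]. Qed.

Lemma ReN z : complex.Re (- z) = - complex.Re z.
Proof. by case: z. Qed.

Lemma ReZ r z : complex.Re (r%:C%C * z) = r * complex.Re z.
Proof. by case: z => a b; rewrite /= mul0r subr0. Qed.

Lemma Re_conj z : complex.Re (Num.conj z) = complex.Re z.
Proof. by case: z. Qed.

Lemma discriminant_le0 (a b c : R) :
  (forall t, 0 <= a * t ^+ 2 + 2 * b * t + c) -> b ^+ 2 <= a * c.
Proof.
move=> H; have c0 : 0 <= c by have := H 0; rewrite expr0n /= !mulr0 !add0r.
have [a0|a0|a0] := ltgtP a 0.
- (* At this t >= 1 the factor a * t outweighs 2 * b + c. *)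
  have := H (1 + (1 + c + 2 * `|b|) / (- a)); set t := (1 + _) => Ht.
  have b0 : 0 <= `|b| by [].
  have bb : b <= `|b| by exact: ler_norm.
  have ta : a * t = a - (1 + c + 2 * `|b|) by rewrite /t; field; lra.
  have t1 : 1 <= t by rewrite lerDl divr_ge0 ?oppr_ge0 ?(ltW a0) //; lra.
  have e : a * t ^+ 2 + 2 * b * t + c = t * (a * t + 2 * b) + c by ring.
  by rewrite e ta in Ht; nra.
- have := H (- b / a); have -> : a * (- b / a) ^+ 2 + 2 * b * (- b / a) + c = (a * c - b ^+ 2) / a.
    by field; lra.
  by rewrite pmulr_lge0 ?invr_gt0 // subr_ge0.
- rewrite a0 mul0r; have [->|bn0] := eqVneq b 0; first by rewrite expr0n.
  have := H (- (c + 1) / (2 * b)); rewrite a0.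
  have -> : 0 * (- (c + 1) / (2 * b)) ^+ 2 + 2 * b * (- (c + 1) / (2 * b)) + c = -1.
    by field; apply/eqP; move/eqP: bn0; lra.
  by lra.
Qed.

End RealPart.

Local Notation "r '*r' x" := (r%:C%C *: x) (at level 40, left associativity).

(** * Identities in the algebra *)

(** Registering the algebra for the decision procedure of noncommutative
    rings. *)
#[export] Instance alg_ops (R : realType) (N : vonNeumannAlgebra R) :
  @Ncring.Ring_ops N 0 1 +%R *%R (fun x y => x - y) -%R eq := {}.

#[export] Instance alg_ring (R : realType) (N : vonNeumannAlgebra R) :
  @Ncring.Ring N 0 1 +%R *%R (fun x y => x - y) -%R eq (alg_ops N).
Proof.
split; try exact _; try by move=> x ? <- y ? <-.
- exact: add0r.
- exact: addrC.
- exact: addrA.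
- exact: mul1r.
- exact: mulr1.
- exact: mulrA.
- exact: mulrDl.
- by move=> x y z; exact: mulrDr.
- by [].
- exact: subrr.
Qed.

Ltac ncring := Ncring_tac.non_commutative_ring.

(** * The quadratic forms of the elements of the algebra *)

Section Forms.
Variables (R : realType) (N : vonNeumannAlgebra R).
Local Notation H := (vn_space N).
Implicit Types (x y z a b : N) (v w : H) (r : R).

Definition hnorm v : R := complex.Re `|v|.
Definition rdot v w : R := complex.Re (vn_dot N v w).

Lemma normE v : `|v| = (hnorm v)%:C%C.
Proof. by rewrite /hnorm RRe_real // normr_real. Qed.

Lemma hnorm_ge0 v : 0 <= hnorm v.
Proof. by rewrite -ler0c -normE. Qed.

Lemma hnormD v w : hnorm (v + w) <= hnorm v + hnorm w.
Proof. by rewrite -lecR -normE rmorphD /= -!normE ler_normD. Qed.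

Lemma hnormN v : hnorm (- v) = hnorm v.
Proof. by rewrite /hnorm normrN. Qed.

Lemma hnorm0 : hnorm 0 = 0.
Proof. by rewrite /hnorm normr0. Qed.

Lemma hnorm_eq0 v : hnorm v = 0 -> v = 0.
Proof. by move=> h; apply/normr0_eq0; rewrite normE h. Qed.

Lemma rdot_norm v : rdot v v = hnorm v ^+ 2.
Proof. by rewrite /rdot -vn_dot_norm normE -rmorphXn /=. Qed.

Lemma rdotC v w : rdot v w = rdot w v.
Proof.
rewrite /rdot (hermC (vn_dot N) v w) /=.
by rewrite expr0 mul1r Re_conj.
Qed.

Lemma rdotDl u v w : rdot (u + v) w = rdot u w + rdot v w.
Proof. by rewrite /rdot linearDl ReD. Qed.

Lemma rdotNl v w : rdot (- v) w = - rdot v w.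
Proof. by rewrite /rdot linearNl ReN. Qed.

Lemma rdotZl r v w : rdot (r *r v) w = r * rdot v w.
Proof. by rewrite /rdot linearZl_LR /= ReZ. Qed.

Lemma rdotDr u v w : rdot u (v + w) = rdot u v + rdot u w.
Proof. by rewrite !(rdotC u) rdotDl. Qed.

Lemma rdotZr r v w : rdot v (r *r w) = r * rdot v w.
Proof. by rewrite !(rdotC v) rdotZl. Qed.

Lemma rdot_star x v w : rdot (vn_rep (star x) v) w = rdot v (vn_rep x w).
Proof. by rewrite /rdot vn_rep_star. Qed.

Lemma CS_hnorm v w : `|rdot v w| <= hnorm v * hnorm w.
Proof.
rewrite -ler_sqr ?nnegrE ?mulr_ge0 ?hnorm_ge0 // real_normK ?num_real //.
rewrite exprMn -!rdot_norm.
apply: discriminant_le0 => t.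
have := sqr_ge0 (hnorm (t *r v + w)).
rewrite -rdot_norm rdotDl !rdotDr !rdotZl !rdotZr (rdotC w v).
by congr (_ <= _); ring.
Qed.

Lemma repN x v : vn_rep (- x) v = - vn_rep x v.
Proof. by rewrite -scaleN1r vn_repZ scaleN1r. Qed.

Lemma repB x y v : vn_rep (x - y) v = vn_rep x v - vn_rep y v.
Proof. by rewrite vn_repD repN. Qed.

Lemma rep0 v : vn_rep (0 : N) v = 0.
Proof. by apply: (addrI (vn_rep (0 : N) v)); rewrite -vn_repD !addr0. Qed.

Lemma star0 : star (0 : N) = 0.
Proof. by apply: (addrI (star (0 : N))); rewrite -starD !addr0. Qed.

Lemma starN x : star (- x) = - star x.
Proof. by rewrite -scaleN1r starZ rmorphN rmorph1 scaleN1r. Qed.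

Lemma starB x y : star (x - y) = star x - star y.
Proof. by rewrite starD starN. Qed.

Lemma star1 : star (1 : N) = 1.
Proof. by rewrite -[LHS]mulr1 -{2}(starK (1 : N)) -starM mulr1 starK. Qed.

Lemma starZr r x : star (r *r x) = r *r star x.
Proof. by rewrite starZ; congr (_ *: _); exact: conjc_real. Qed.

Definition starE := (star0, star1, starN, starD, starM, starK, starZr).

Definition qf x v : R := rdot (vn_rep x v) v.

Lemma qfD x y v : qf (x + y) v = qf x v + qf y v.
Proof. by rewrite /qf vn_repD rdotDl. Qed.

Lemma qfN x v : qf (- x) v = - qf x v.
Proof. by rewrite /qf repN rdotNl. Qed.

Lemma qfB x y v : qf (x - y) v = qf x v - qf y v.
Proof. by rewrite qfD qfN. Qed.

Lemma qfZ r x v : qf (r *r x) v = r * qf x v.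
Proof. by rewrite /qf vn_repZ rdotZl. Qed.

Lemma qf0 v : qf 0 v = 0.
Proof. by rewrite -(subrr (0 : N)) qfB subrr. Qed.

Lemma qf1 v : qf 1 v = hnorm v ^+ 2.
Proof. by rewrite /qf vn_rep1 rdot_norm. Qed.

Lemma qf_conj x a v : qf (star x * a * x) v = qf a (vn_rep x v).
Proof. by rewrite /qf -mulrA vn_repM rdot_star vn_repM. Qed.

Lemma qf_sq x v : qf (star x * x) v = hnorm (vn_rep x v) ^+ 2.
Proof. by rewrite /qf vn_repM rdot_star rdot_norm. Qed.

Definition qfE := (qf0, qf1, qfD, qfN, qfZ).

(** * The operator order *)

(** As [qf] only keeps the real part of the quadratic form, self-adjointness is
    required separately. By [pos_vn_positive] below, this is the order in which
    normality is defined. *)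
Definition pos x : Prop := star x = x /\ forall v, 0 <= qf x v.

Definition nle x y := pos (y - x).

(** Being a contraction, stated in the order of the algebra so that algebraic
    identities can prove it. *)
Definition contr x := nle (star x * x) 1.

Lemma pos_sa x : pos x -> star x = x. Proof. by case. Qed.

Lemma pos_sq x : pos (star x * x).
Proof. by split; [rewrite !starE|move=> v; rewrite qf_sq sqr_ge0]. Qed.

Lemma pos_sqr x : star x = x -> pos (x * x).
Proof. by move=> sx; rewrite -{1}sx; exact: pos_sq. Qed.

Lemma pos0 : pos 0.
Proof. by split; [exact: star0|move=> v; rewrite qf0]. Qed.

Lemma pos1 : pos 1.
Proof. by split; [exact: star1|move=> v; rewrite qf1 sqr_ge0]. Qed.

Lemma posD x y : pos x -> pos y -> pos (x + y).
Proof.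
move=> [sx px] [sy py]; split; first by rewrite starD sx sy.
by move=> v; rewrite qfD addr_ge0.
Qed.

Lemma posZ r x : 0 <= r -> pos x -> pos (r *r x).
Proof.
move=> r0 [sx px]; split; first by rewrite starZr sx.
by move=> v; rewrite qfZ mulr_ge0.
Qed.

Lemma pos_conj x a : pos a -> pos (star x * a * x).
Proof.
move=> [sa pa]; split; first by rewrite !starE sa mulrA.
by move=> v; rewrite qf_conj.
Qed.

Lemma pos_conjsa x a : star x = x -> pos a -> pos (x * a * x).
Proof. by move=> sx pa; rewrite -{1}sx; exact: pos_conj. Qed.

Lemma nleP x y : star x = x -> star y = y ->
  (forall v, qf x v <= qf y v) -> nle x y.
Proof.
move=> sx sy h; split; first by rewrite starB sx sy.
by move=> v; rewrite qfB subr_ge0.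
Qed.

Lemma nle_qf x y v : nle x y -> qf x v <= qf y v.
Proof. by move=> [_ /(_ v)]; rewrite qfB subr_ge0. Qed.

Lemma nle_trans y x z : nle x y -> nle y z -> nle x z.
Proof.
rewrite /nle => h k; have -> : z - x = (z - y) + (y - x) by rewrite addrA subrK.
exact: posD.
Qed.

Lemma nlexx x : nle x x.
Proof. by rewrite /nle subrr; exact: pos0. Qed.

Lemma nleD x y z t : nle x y -> nle z t -> nle (x + z) (y + t).
Proof.
rewrite /nle => h k; have -> : y + t - (x + z) = (y - x) + (t - z).
  by rewrite opprD addrACA.
exact: posD.
Qed.

Lemma nle0 x : nle 0 x <-> pos x. Proof. by rewrite /nle subr0. Qed.

Lemma CS_pos a v w : pos a -> rdot (vn_rep a v) w ^+ 2 <= qf a v * qf a w.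
Proof.
move=> [sa pa]; apply: discriminant_le0 => t.
have e : rdot (vn_rep a w) v = rdot (vn_rep a v) w.
  by rewrite -{1}sa rdot_star rdotC.
have := pa (t *r v + w); rewrite /qf !linearD !linearZ /= !rdotDl !rdotDr.
by rewrite !rdotZl !rdotZr e; congr (_ <= _); ring.
Qed.

Lemma contrP x : contr x <-> forall v, hnorm (vn_rep x v) <= hnorm v.
Proof.
split=> [h v|h].
  rewrite -ler_sqr ?nnegrE ?hnorm_ge0 // -qf_sq -qf1; exact: nle_qf.
apply: nleP; rewrite ?starE // => v.
by rewrite qf_sq qf1 ler_sqr ?nnegrE ?hnorm_ge0.
Qed.

Lemma opnorm_exists x :
  exists2 M : R, 0 <= M & forall v, hnorm (vn_rep x v) <= M * hnorm v.
Proof.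
have := @vn_rep_continuous _ N x => /linear_bounded_continuous /linear_boundedP.
case=> M [Mr h]; have [K K0 MK] : exists2 K : R[i], 0 <= K & M < K.
  exists (`|M| + 1); first by rewrite addr_ge0.
  by rewrite (le_lt_trans (real_ler_norm Mr)) // ltrDl.
exists (complex.Re K); first by move: K0; rewrite lecE => /andP[].
move=> v; rewrite -lecR rmorphM /= -!normE.
by rewrite (RRe_real (ger0_real K0)); exact: h.
Qed.

Lemma sq_bound x : exists2 M : R, 0 < M & nle (star x * x) (M *r 1).
Proof.
have [M M0 h] := opnorm_exists x; exists (M ^+ 2 + 1).
  by rewrite ltr_wpDl // sqr_ge0.
apply: nleP; rewrite ?starE // => v; rewrite qf_sq qfZ qf1 mulrDl mul1r.
apply: ler_wpDr; first exact: sqr_ge0.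
by rewrite -exprMn ler_sqr ?nnegrE ?mulr_ge0 ?hnorm_ge0.
Qed.

End Forms.
Arguments nle_trans {R N} y {x z}.

(** * Strong limits *)

Section StrongLimits.
Variables (R : realType) (N : vonNeumannAlgebra R).
Local Notation H := (vn_space N).
Implicit Types (x y z a b : N) (v w : H) (r : R).

Lemma hcauchy_cvg (u : nat -> H) :
  (forall e : R, 0 < e -> exists n0, forall n m, (n0 <= n)%N -> (n0 <= m)%N ->
    hnorm (u n - u m) < e) -> cvgn u.
Proof.
move=> h; apply: cauchy_cvg; apply/cauchyP => e e0.
have er : e = (complex.Re e)%:C%C by rewrite RRe_real // gtr0_real.
have [] := h (complex.Re e); first by rewrite -ltcR -er.
move=> n0 hn0; exists (u n0); exists n0 => // n /= nn0.
by rewrite -ball_normE /= normE er ltcR; apply: hn0.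
Qed.

Lemma hcvg_hnorm (u : nat -> H) v : u @ \oo --> v ->
  (fun n => hnorm (u n - v)) @ \oo --> (0 : R).
Proof.
move=> uv; apply/cvgrPdist_lt => e e0.
have /cvgrPdist_lt/(_ e%:C%C) := uv; rewrite ltcR => /(_ e0).
apply: filterS => n; rewrite sub0r normrN ger0_norm ?hnorm_ge0 //.
by rewrite normE ltcR -hnormN opprB.
Qed.

(** Convergence in the strong operator topology. *)
Definition scvg (x : nat -> N) (y : N) :=
  forall v, (fun n => hnorm (vn_rep (x n - y) v)) @ \oo --> (0 : R).

(** The pointwise limit is linear and bounded, and it commutes with the
    commutant of the algebra, so the bicommutant property applies to it. *)
Lemma strong_limit (x : nat -> N) (M : R) :
  (forall n v, hnorm (vn_rep (x n) v) <= M * hnorm v) ->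
  (forall v (e : R), 0 < e -> exists n0, forall n m, (n0 <= n)%N -> (n0 <= m)%N ->
    hnorm (vn_rep (x n - x m) v) < e) ->
  exists2 y, scvg x y & forall v, hnorm (vn_rep y v) <= M * hnorm v.
Proof.
move=> xM xC.
have xcvg v : cvgn (fun n => vn_rep (x n) v).
  apply: hcauchy_cvg => e /(xC v)[n0 hn0]; exists n0 => n m nn mm.
  by rewrite -repB; exact: hn0.
pose T v := limn (fun n => vn_rep (x n) v).
have TP v : vn_rep (x n) v @[n --> \oo] --> T v by exact: xcvg.
have Tlin : linear T.
  move=> c v w; apply: cvg_lim => //.
  rewrite (_ : (fun n => _) = (fun n => c *: vn_rep (x n) v + vn_rep (x n) w)).
    by apply: cvgD; [apply: cvgZr; exact: TP|exact: TP].
  by apply/funext => n; rewrite linearP.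
pose TL : {linear H -> H} := HB.pack T (GRing.isLinear.Build _ _ _ _ T Tlin).
have TM v : hnorm (T v) <= M * hnorm v.
  apply/ler_addgt0Pr => e e0.
  have /cvgrPdist_lt/(_ _ e0) := hcvg_hnorm (TP v).
  move=> [n0 _ /(_ n0 (leqnn n0))] /=; rewrite sub0r normrN ger0_norm ?hnorm_ge0 // => h.
  rewrite -[T v](subrK (vn_rep (x n0) v)) -(opprB (vn_rep _ _)).
  rewrite (le_trans (hnormD _ _)) // hnormN addrC lerD //; exact: ltW.
have Tc : continuous TL.
  apply/linear_bounded_continuous/linear_boundedP.
  exists `|M|%:C%C; split; first by rewrite complex_real.
  move=> K MK v; rewrite !normE.
  have KR : K = (complex.Re K)%:C%C.
    by rewrite RRe_real // gtr0_real // (le_lt_trans _ MK) // ler0c.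
  rewrite KR -rmorphM /= lecR (le_trans (TM v)) // ler_wpM2r ?hnorm_ge0 //.
  by rewrite (le_trans (ler_norm _)) // -lecR -KR ltW.
have [y yT] : exists y, TL =1 vn_rep y.
  apply: vn_bicommutant; split=> // S [Sc Scom] v /=.
  apply: cvg_lim => //.
  rewrite (_ : (fun n => _) = (fun n => S (vn_rep (x n) v))).
    by apply: (continuous_cvg _ (Sc _)); exact: TP.
  by apply/funext => n; rewrite [RHS](Scom (vn_rep (x n))) //; exists (x n).
exists y; last by move=> v; rewrite -yT; exact: TM.
move=> v; under eq_fun do rewrite repB -yT.
exact: hcvg_hnorm (TP v).
Qed.

End StrongLimits.

(** * Limits of real functions *)

Section RealLimits.
Variables (R : realType) (T : Type) (F : set_system T).

Lemma cvg0_le {FF : Filter F} (u e : T -> R) : (forall n, 0 <= u n <= e n) ->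
  e @ F --> (0 : R) -> u @ F --> (0 : R).
Proof.
move=> h e0; apply: (squeeze_cvgr _ (cvg_cst _) e0); exact: nearW.
Qed.

Lemma cvg_dist0 {FF : Filter F} (u : T -> R) l :
  (fun n => `|u n - l|) @ F --> (0 : R) -> u @ F --> l.
Proof.
move=> h; apply: (@cvg_sub0 _ _ _ _ _ u (fun=> l)); last exact: cvg_cst.
by apply: norm_cvg0.
Qed.

Lemma dist0_cvg {FF : Filter F} (u : T -> R) l :
  u @ F --> l -> (fun n => `|u n - l|) @ F --> (0 : R).
Proof.
move=> h; apply/norm_cvg0P; rewrite -[X in _ --> X](subrr l).
by apply: cvgB => //; exact: cvg_cst.
Qed.

Lemma cvg0Z {FF : Filter F} (c : R) (u : T -> R) : u @ F --> (0 : R) ->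
  (fun n => c * u n) @ F --> (0 : R).
Proof. by move=> u0; rewrite -[X in _ --> X](mulr0 c); exact: cvgMl_tmp. Qed.

Lemma cvg0D {FF : Filter F} (u v : T -> R) : u @ F --> (0 : R) ->
  v @ F --> (0 : R) -> (fun n => u n + v n) @ F --> (0 : R).
Proof. by move=> u0 v0; rewrite -[X in _ --> X](addr0 0); exact: cvgD. Qed.

Lemma cvg_ext (u v : T -> R) (l : R) : (forall n, u n = v n) ->
  u @ F --> l -> v @ F --> l.
Proof. by move=> /funext ->. Qed.

Lemma rcvg_unique {FF : ProperFilter F} (u : T -> R) (l l' : R) :
  u @ F --> l -> u @ F --> l' -> l = l'.
Proof. by move=> /(cvg_lim (@Rhausdorff R)) <- /(cvg_lim (@Rhausdorff R)) <-. Qed.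

Lemma rcvg_le {FF : ProperFilter F} (u v : T -> R) (l l' : R) :
  u @ F --> l -> v @ F --> l' -> (forall n, u n <= v n) -> l <= l'.
Proof.
move=> ul vl uv; have h : (fun n => v n - u n) @ F --> l' - l by exact: (cvgB vl ul).
rewrite -subr_ge0 -(cvg_lim (@Rhausdorff R) h); apply: limr_ge.
  by apply/cvg_ex; exists (l' - l).
by apply: nearW => n; rewrite subr_ge0.
Qed.

Lemma le_lim {FF : ProperFilter F} (d : T -> R) (a b : R) :
  d @ F --> (0 : R) -> (forall n, a <= b + d n) -> a <= b.
Proof.
move=> d0 h; have ha : (fun=> a) @ F --> a by exact: cvg_cst.
have hb : (fun n => b + d n) @ F --> b.
  by rewrite -[X in _ --> X]addr0; apply: cvgD => //; exact: cvg_cst.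
exact: (rcvg_le ha hb).
Qed.

End RealLimits.

(** * Monotone sequences converge strongly *)

Section MonotoneLimits.
Variables (R : realType) (N : vonNeumannAlgebra R).
Local Notation H := (vn_space N).
Implicit Types (x y z a b : N) (v w : H) (r : R).

Lemma rep_ext x y :
  (forall v w, rdot (vn_rep x v) w = rdot (vn_rep y v) w) -> x = y.
Proof.
move=> h; apply/eqP; rewrite -subr_eq0; apply/eqP; apply: vn_rep_faithful => v.
rewrite rep0; apply: hnorm_eq0; apply/eqP; rewrite -sqrf_eq0 -rdot_norm repB.
by rewrite rdotDl rdotNl h subrr.
Qed.

Lemma scvg_rdot (x : nat -> N) y v w : scvg x y ->
  (fun n => rdot (vn_rep (x n) v) w) @ \oo --> rdot (vn_rep y v) w.
Proof.
move=> /(_ v) xy; apply: cvg_dist0.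
  apply: (@cvg0_le _ _ _ _ _ (fun n => hnorm (vn_rep (x n - y) v) * hnorm w)).
    move=> n; rewrite normr_ge0 /= -rdotNl -rdotDl -repB.
    exact: CS_hnorm.
by rewrite -[X in _ --> X](mul0r (hnorm w)); apply: cvgMr_tmp.
Qed.

Arguments scvg_rdot {x y} v w _.

Lemma scvg_qf (x : nat -> N) y v : scvg x y ->
  (fun n => qf (x n) v) @ \oo --> qf y v.
Proof. exact: scvg_rdot. Qed.

Arguments scvg_qf {x y} v _.

Lemma scvg_unique (x : nat -> N) y z : scvg x y -> scvg x z -> y = z.
Proof.
move=> xy xz; apply: rep_ext => v w.
exact: rcvg_unique (scvg_rdot v w xy) (scvg_rdot v w xz).
Qed.

Lemma scvg_sa (x : nat -> N) y : scvg x y -> (forall n, star (x n) = x n) ->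
  star y = y.
Proof.
move=> xy sx; apply: rep_ext => v w; rewrite rdot_star rdotC.
have := scvg_rdot w v xy; under eq_fun do rewrite rdotC -rdot_star sx.
move=> h; exact: rcvg_unique h (scvg_rdot v w xy).
Qed.

Lemma scvg_le (x : nat -> N) y z n0 : scvg x y -> (forall n, star (x n) = x n) ->
  (forall n, (n0 <= n)%N -> nle (x n) z) -> star z = z -> nle y z.
Proof.
move=> xy sx h sz; apply: nleP => //; first exact: scvg_sa xy sx.
move=> v; apply: (ler_cvg_to (scvg_qf v xy) (cvg_cst (qf z v))).
by exists n0 => // n /h; exact: nle_qf.
Qed.

Lemma scvg_ge (x : nat -> N) y z n0 : scvg x y -> (forall n, star (x n) = x n) ->
  (forall n, (n0 <= n)%N -> nle z (x n)) -> star z = z -> nle z y.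
Proof.
move=> xy sx h sz; apply: nleP => //; first exact: scvg_sa xy sx.
move=> v; apply: (ler_cvg_to (cvg_cst (qf z v)) (scvg_qf v xy)).
by exists n0 => // n /h; exact: nle_qf.
Qed.

Lemma scvg_cst x : scvg (fun=> x) x.
Proof.
by move=> v; under eq_fun do rewrite subrr rep0 hnorm0; exact: cvg_cst.
Qed.

Lemma scvgD (x x' : nat -> N) y y' : scvg x y -> scvg x' y' ->
  scvg (fun n => x n + x' n) (y + y').
Proof.
move=> xy xy' v.
have h : hnorm (vn_rep (x n - y) v) + hnorm (vn_rep (x' n - y') v)
    @[n --> \oo] --> (0 : R).
  exact: cvg0D (xy v) (xy' v).
apply: (cvg0_le _ h) => n; rewrite hnorm_ge0 /= opprD addrACA (vn_repD (x n - y)); exact: hnormD.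
Qed.

Lemma scvgN (x : nat -> N) y : scvg x y -> scvg (fun n => - x n) (- y).
Proof.
by move=> xy v; have := xy v; under eq_fun do rewrite -hnormN -repN opprD.
Qed.

Lemma scvgB (x x' : nat -> N) y y' : scvg x y -> scvg x' y' ->
  scvg (fun n => x n - x' n) (y - y').
Proof. by move=> h /scvgN; exact: scvgD. Qed.

Lemma scvgMr (x : nat -> N) y z : scvg x y -> scvg (fun n => x n * z) (y * z).
Proof.
by move=> xy v; have := xy (vn_rep z v); under eq_fun do rewrite -vn_repM mulrBl.
Qed.

Lemma scvgMl (x : nat -> N) y z : scvg x y -> scvg (fun n => z * x n) (z * y).
Proof.
move=> xy v; have [M M0 zM] := opnorm_exists z.
have h : M * hnorm (vn_rep (x n - y) v) @[n --> \oo] --> (0 : R).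
  by apply: cvg0Z; exact: xy.
by apply: (cvg0_le _ h) => n; rewrite hnorm_ge0 /= -mulrBr vn_repM.
Qed.

Lemma scvgM (M : R) (x x' : nat -> N) y y' :
  (forall n v, hnorm (vn_rep (x n) v) <= M * hnorm v) ->
  scvg x y -> scvg x' y' -> scvg (fun n => x n * x' n) (y * y').
Proof.
move=> xM xy xy' v.
have h : M * hnorm (vn_rep (x' n - y') v) @[n --> \oo] --> (0 : R).
  by apply: cvg0Z; exact: xy'.
have k : M * hnorm (vn_rep (x' n - y') v) + hnorm (vn_rep (x n * y' - y * y') v)
    @[n --> \oo] --> (0 : R).
  exact: cvg0D h (scvgMr y' xy v).
apply: (cvg0_le _ k) => n; rewrite hnorm_ge0 /=.
have -> : x n * x' n - y * y' = x n * (x' n - y') + (x n * y' - y * y').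
  by rewrite mulrBr addrA subrK.
by rewrite (vn_repD (x n * _)) (le_trans (hnormD _ _)) // lerD2r vn_repM.
Qed.

Lemma scvg_shift (x : nat -> N) y : scvg x y -> scvg (fun n => x n.+1) y.
Proof.
move=> xy v; have := xy v.
by rewrite -(cvg_shiftS (fun n => hnorm (vn_rep (x n - y) v))).
Qed.

Lemma scvg_comm (x : nat -> N) y z : scvg x y ->
  (forall n, x n * z = z * x n) -> y * z = z * y.
Proof.
move=> xy h; apply: (@scvg_unique (fun n => x n * z)); first exact: scvgMr.
by under eq_fun do rewrite h; exact: scvgMl.
Qed.

(** The Cauchy-Schwarz inequality for the form of a, at v and a v. *)
Lemma pos_bound a (M : R) v : 0 <= M -> pos a -> nle a (M *r 1) ->
  hnorm (vn_rep a v) ^+ 2 <= M * qf a v.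
Proof.
move=> M0 pa aM; set h := hnorm _.
have := CS_pos v (vn_rep a v) pa; rewrite rdot_norm -/h.
have := nle_qf (vn_rep a v) aM; rewrite qfZ qf1 -/h => h1 h2.
have qa : 0 <= qf a v by case: pa.
have [h0|h0] := eqVneq h 0; first by rewrite h0 expr0n mulr_ge0.
have hp : 0 < h ^+ 2 by rewrite exprn_even_gt0.
rewrite -(ler_pM2r hp) -expr2 (le_trans h2) //.
by rewrite -mulrA mulrCA ler_wpM2l.
Qed.

Lemma pos_hbound a (M : R) v : 0 <= M -> pos a -> nle a (M *r 1) ->
  hnorm (vn_rep a v) <= M * hnorm v.
Proof.
move=> M0 pa aM; rewrite -ler_sqr ?nnegrE ?mulr_ge0 ?hnorm_ge0 //.
rewrite (le_trans (pos_bound v M0 pa aM)) // exprMn expr2 -mulrA ler_wpM2l //.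
by have := nle_qf v aM; rewrite qfZ qf1.
Qed.

Lemma nle_mono (x : nat -> N) : (forall n, nle (x n) (x n.+1)) ->
  forall n m, (n <= m)%N -> nle (x n) (x m).
Proof.
move=> h n m /subnK <-; elim: (m - n)%N => [|k IH]; first exact: nlexx.
exact: nle_trans IH (h _).
Qed.

(** The quadratic forms converge as bounded monotone real sequences, and
    [pos_bound] turns convergence of the forms into strong convergence. *)
Lemma monotone_limit (x : nat -> N) (M : R) : 0 <= M ->
  (forall n, nle (x n) (x n.+1)) ->
  (forall n, pos (x n)) -> (forall n, nle (x n) (M *r 1)) ->
  exists y, [/\ scvg x y, pos y, (forall n, nle (x n) y) & nle y (M *r 1)].
Proof.
move=> M0 x_mono x_pos xM; have mono := nle_mono x_mono.
have xMb n v : hnorm (vn_rep (x n) v) <= M * hnorm v by exact: pos_hbound.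
have xC v (e : R) : 0 < e -> exists n0, forall n m,
    (n0 <= n)%N -> (n0 <= m)%N -> hnorm (vn_rep (x n - x m) v) < e.
  move=> e0; pose u n := qf (x n) v.
  have u_mono : {homo u : n m / (n <= m)%N >-> n <= m}.
    by move=> n m /mono; exact: nle_qf.
  have uc : cvgn u.
    apply: nondecreasing_is_cvgn => //; exists (M * hnorm v ^+ 2) => _ [n _ <-].
    by have := nle_qf v (xM n); rewrite qfZ qf1.
  have ul := nondecreasing_cvgn_le u_mono uc.
  have d0 : 0 < e ^+ 2 / (M + 1) by rewrite divr_gt0 ?exprn_gt0 // ltr_wpDl.
  have /cvgrPdist_lt/(_ _ d0) [n0 _ hn0] := uc; exists n0.
  suff P n m : (n0 <= n)%N -> (n <= m)%N -> hnorm (vn_rep (x m - x n) v) < e.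
    move=> n m n0n n0m; have [nm|mn] := leqP n m.
      by rewrite -hnormN -repN opprB P.
    by rewrite P // ltnW.
  move=> n0n nm; rewrite -ltr_sqr ?nnegrE ?hnorm_ge0 ?ltW //.
  have pd : pos (x m - x n) by exact: mono.
  have dM : nle (x m - x n) (M *r 1).
    apply: nle_trans (xM m); rewrite /nle opprB addrC subrK; exact: x_pos.
  rewrite (le_lt_trans (pos_bound v M0 pd dM)) //.
  have := hn0 n n0n; rewrite /= ltr_norml => /andP[_] h.
  have qd : qf (x m - x n) v < e ^+ 2 / (M + 1).
    by rewrite qfB; have := ul m; rewrite /u in h *; lra.
  have qd0 : 0 <= qf (x m - x n) v by case: pd.
  rewrite ltr_pdivlMr in qd; last by rewrite ltr_wpDl.
  nra.
have [y xy _] := strong_limit xMb xC.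
have sx n : star (x n) = x n by exact: pos_sa.
have sy := scvg_sa xy sx.
exists y; split => //.
- apply/nle0; apply: (scvg_ge (n0 := 0) xy sx) => [n _|]; first by apply/nle0.
  exact: star0.
- by move=> n; apply: (scvg_ge (n0 := n) xy sx) => // m; exact: mono.
- by apply: (scvg_le (n0 := 0) xy sx) => //; rewrite !starE.
Qed.

Lemma antitone_limit (x : nat -> N) : (forall n, nle (x n.+1) (x n)) ->
  (forall n, pos (x n)) -> nle (x 0%N) 1 ->
  exists y, [/\ scvg x y, pos y & (forall n, nle y (x n))].
Proof.
move=> x_anti x_pos x1.
have xle1 n : nle (x n) 1 by elim: n => // n; apply: nle_trans.
have [|||y [xy py xley yle1]] := @monotone_limit (fun n => 1 - x n) 1 ler01.
- by move=> n; rewrite /nle opprB addrC addrA subrK; exact: x_anti.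
- exact: xle1.
- by move=> n; rewrite scale1r /nle opprB addrC subrK; exact: x_pos.
exists (1 - y); split.
- have := scvgB (scvg_cst 1) xy; under eq_fun do rewrite opprB addrC subrK.
  by [].
- by rewrite scale1r in yle1.
- by move=> n; have := xley n; rewrite /nle !opprB addrCA.
Qed.

End MonotoneLimits.

(** * Square roots, products of commuting elements, inverses *)

Section SquareRoots.
Variables (R : realType) (N : vonNeumannAlgebra R).
Local Notation H := (vn_space N).
Implicit Types (x y z a b : N) (v w : H) (r : R).

Lemma scalerr r s x : r *r (s *r x) = (r * s) *r x.
Proof. by rewrite scalerA rmorphM. Qed.

Lemma scale1rr x : 1 *r x = x.
Proof. by rewrite scale1r. Qed.

Lemma scalerDlr r s x : (r + s) *r x = r *r x + s *r x.
Proof. by rewrite rmorphD scalerDl. Qed.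

Lemma scaleNlr r x : (- r) *r x = - (r *r x).
Proof. by rewrite rmorphN scaleNr. Qed.

Lemma scalerBlr r s x : (r - s) *r x = r *r x - s *r x.
Proof. by rewrite scalerDlr scaleNlr. Qed.

Lemma half_add x : 2^-1 *r (x + x) = x.
Proof.
by rewrite scalerDr -scalerDlr (_ : 2^-1 + 2^-1 = 1) ?scale1rr //; field.
Qed.

Lemma pos_exp a n : pos a -> pos (a ^+ n).
Proof.
move=> pa; suff [] : pos (a ^+ n) /\ pos (a ^+ n.+1) by [].
elim: n => [|n [IH IHS]]; first by rewrite expr0 expr1; split => //; exact: pos1.
split=> //; rewrite exprSr exprS; apply: pos_conjsa => //; exact: pos_sa.
Qed.

(** Polynomials in b with nonnegative coefficients: unlike positive elements in
    general, they are closed under products, and they are positive if b is. *)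
Inductive cone b : N -> Prop :=
| cone0 : cone b 0
| coneS r k x : 0 <= r -> cone b x -> cone b (r *r b ^+ k + x).

Lemma coneD b x y : cone b x -> cone b y -> cone b (x + y).
Proof.
move=> cx cy; elim: cx => [|r k z r0 _ IH]; first by rewrite add0r.
by rewrite -addrA; exact: coneS.
Qed.

Lemma coneZ b r x : 0 <= r -> cone b x -> cone b (r *r x).
Proof.
move=> r0; elim=> [|s k z s0 _ IH]; first by rewrite scaler0; exact: cone0.
by rewrite scalerDr scalerr; apply: coneS => //; exact: mulr_ge0.
Qed.

Lemma coneM b x y : cone b x -> cone b y -> cone b (x * y).
Proof.
move=> cx cy; elim: cx => [|r k z r0 _ IH]; first by rewrite mul0r; exact: cone0.
rewrite mulrDl -scalerAl; apply: coneD => //; apply: coneZ => //.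
elim: cy => [|s j t s0 _ IHt]; first by rewrite mulr0; exact: cone0.
by rewrite mulrDr -scalerAr -exprD; exact: coneS.
Qed.

Lemma cone_id b : cone b b.
Proof.
rewrite -[X in cone b X]addr0 -{2}[b]expr1 -(scale1rr (b ^+ 1)).
by apply: coneS => //; exact: cone0.
Qed.

Lemma cone_pos b x : pos b -> cone b x -> pos x.
Proof.
move=> pb; elim=> [|r k z r0 _ IH]; first exact: pos0.
by apply: posD => //; apply: posZ => //; exact: pos_exp.
Qed.

Lemma pos_le1_sq y : pos y -> nle y 1 -> nle (y * y) 1.
Proof.
move=> py y1; rewrite -{1}(pos_sa py); apply/contrP => v.
have := @pos_hbound _ _ y 1 v ler01 py; rewrite mul1r; apply.
by rewrite scale1rr.
Qed.

Fixpoint root_iter b n : N :=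
  if n is n.+1 then 2^-1 *r (b + root_iter b n * root_iter b n) else 0.

Lemma root_iter_cone b n :
  cone b (root_iter b n) /\ cone b (root_iter b n.+1 - root_iter b n).
Proof.
elim: n => [|n [IH IHd]].
  split; first exact: cone0.
  rewrite subr0 /=; apply: coneZ; first by rewrite invr_ge0.
  by rewrite mulr0 addr0; exact: cone_id.
set y := root_iter b n in IH IHd *; set y' := root_iter b n.+1 in IHd *.
have cy' : cone b y' by rewrite -[y'](subrK y); exact: coneD.
split=> //; rewrite -[X in X - _]/(2^-1 *r (b + y' * y')) {2}/y' /= -/y.
rewrite -scalerBr; apply: coneZ; first by rewrite invr_ge0.
have -> : b + y' * y' - (b + y * y) =
  y * (y' - y) + (y' - y) * y + (y' - y) * (y' - y) by ncring.
by apply: coneD; [apply: coneD|]; apply: coneM.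
Qed.

(** The solution y of y = (b + y^2) / 2 gives the square root 1 - y of 1 - b;
    it is the increasing limit of polynomials in b with nonnegative
    coefficients, whence all the positivity that monotone convergence needs. *)
Lemma sqrt_le1 a : pos a -> nle a 1 ->
  exists s, [/\ pos s, s * s = a, scvg (root_iter (1 - a)) (1 - s) &
    forall z, z * a = a * z -> z * s = s * z].
Proof.
move=> pa a1; pose b := 1 - a; pose y := root_iter b.
have pb : pos b by [].
have b1 : nle b 1 by rewrite /nle opprB addrC subrK.
have py n : pos (y n) by apply: (cone_pos pb); case: (root_iter_cone b n).
have y_mono n : nle (y n) (y n.+1).
  by apply: (cone_pos pb); case: (root_iter_cone b n).
have y1 n : nle (y n) (1 *r 1).
  rewrite scale1rr; elim: n => [|n IH]; first by apply/nle0; exact: pos1.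
  have -> : (1 : N) = 2^-1 *r (1 + 1).
    by rewrite half_add.
  rewrite /nle -scalerBr; apply: posZ; first by rewrite invr_ge0.
  by apply: nleD => //; apply: pos_le1_sq.
have [l [yl pl yle l1]] := monotone_limit ler01 y_mono py y1.
have yb n v : hnorm (vn_rep (y n) v) <= 1 * hnorm v by exact: pos_hbound.
have lE : l = 2^-1 *r (b + l * l).
  apply: (scvg_unique (scvg_shift yl)).
  have := scvgMl ((2^-1)%:C%C *: 1) (scvgD (scvg_cst b) (scvgM yb yl yl)).
  by rewrite -scalerAl mul1r; under eq_fun do rewrite -scalerAl mul1r.
have ll : l + l = b + l * l.
  by rewrite {1 2}lE -scalerDr half_add.
exists (1 - l); split.
- by move: l1; rewrite scale1rr.
- have -> : (1 - l) * (1 - l) = 1 - (l + l) + l * l by ncring.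
  by rewrite ll /b; ncring.
- by rewrite (_ : 1 - (1 - l) = l) //; ncring.
- move=> z za; rewrite mulrBr mulrBl mulr1 mul1r; congr (_ - _).
  have zb : z * b = b * z by rewrite /b mulrBr mulrBl mulr1 mul1r za.
  apply/esym/(scvg_comm yl); elim=> [|n IH]; first by rewrite mul0r mulr0.
  rewrite -[y n.+1]/(2^-1 *r (b + y n * y n)) -scalerAl -scalerAr.
  congr (_ *: _); rewrite mulrDl mulrDr zb; congr (_ + _).
  by rewrite -mulrA IH mulrA IH mulrA.
Qed.

Lemma pos_le_scalar a : star a = a -> exists2 M : R, 0 < M & nle a (M *r 1).
Proof.
move=> sa; have [M M0 h] := opnorm_exists a; exists (M + 1); first lra.
apply: nleP; rewrite ?starE // => v; rewrite qfZ qf1.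
apply: le_trans (ler_norm _) _; apply: le_trans (CS_hnorm _ _) _.
rewrite expr2 mulrA ler_wpM2r ?hnorm_ge0 // (le_trans (h v)) //.
by rewrite ler_wpM2r ?hnorm_ge0 // lerDl.
Qed.

Lemma sqrt_exists a : pos a ->
  exists s, [/\ pos s, s * s = a & forall z, z * a = a * z -> z * s = s * z].
Proof.
move=> pa; have [M M0 aM] := pos_le_scalar (pos_sa pa).
have Mn : M != 0 by rewrite gt_eqF.
have MV : M * M^-1 = 1 by rewrite divff.
have pa' : pos (M^-1 *r a) by apply: posZ => //; rewrite invr_ge0 ltW.
have [|s [ps ss _ sc]] := sqrt_le1 pa'.
  rewrite /nle (_ : 1 - _ = M^-1 *r (M *r 1 - a)).
    by apply: posZ => //; rewrite invr_ge0 ltW.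
  by rewrite scalerBr scalerr mulVf // scale1rr.
exists (Num.sqrt M *r s); split.
- by apply: posZ => //; exact: sqrtr_ge0.
- rewrite -scalerAl -scalerAr scalerr -expr2 sqr_sqrtr ?ltW // ss scalerr MV.
  by rewrite scale1rr.
- move=> z za; rewrite -scalerAl -scalerAr sc // -scalerAl -scalerAr.
  by rewrite za.
Qed.

Lemma pos_vn_positive a : pos a <-> vn_positive a.
Proof.
split=> [/sqrt_exists[s [ps <- _]]|[y ->]]; last exact: pos_sq.
by exists s; rewrite (pos_sa ps).
Qed.

Lemma pos_comm_mul a b : pos a -> pos b -> a * b = b * a -> pos (a * b).
Proof.
move=> pa pb ab; have [s [ps sE sc]] := sqrt_exists pb.
by rewrite -sE mulrA (sc a ab); exact: pos_conjsa (pos_sa ps) pa.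
Qed.

(** If a <= M, the inverse is M^-1 times the sum of the Neumann series of
    b = 1 - M^-1 a. The partial sums S increase, and they are bounded because
    S <= a S = M (1 - b^n) <= M. *)
Lemma inverse_exists a : nle 1 a ->
  exists r : N, [/\ pos r, nle r 1, a * r = 1 & r * a = 1].
Proof.
move=> a1; have pa : pos a by rewrite -[a](subrK 1); apply: posD => //; exact: pos1.
have [M M0 aM] := pos_le_scalar (pos_sa pa).
have MV : M * M^-1 = 1 by rewrite divff ?gt_eqF.
have VM : M^-1 * M = 1 by rewrite mulVf ?gt_eqF.
have V0 : 0 <= M^-1 by rewrite invr_ge0 ltW.
pose b := 1 - M^-1 *r a.
have pb : pos b.
  rewrite /b -[1](scale1rr 1) -{1}VM -scalerr -scalerBr; exact: posZ.
pose S n := \sum_(i < n) b ^+ i.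
have SS n : S n.+1 = S n + b ^+ n by rewrite /S big_ord_recr.
have bS n : (1 - b) * S n = 1 - b ^+ n.
  elim: n => [|n IH]; first by rewrite /S big_ord0 mulr0 expr0 subrr.
  by rewrite SS (mulrDr (1 - b)) IH exprS; ncring.
have Sb n : b * S n = S n * b.
  elim: n => [|n IH]; first by rewrite /S big_ord0 mulr0 mul0r.
  by rewrite SS (mulrDr b) (mulrDl _ _ b) IH -exprS -exprSr.
have pS n : pos (S n).
  elim: n => [|n IH]; first by rewrite /S big_ord0; exact: pos0.
  by rewrite SS; apply: posD => //; exact: pos_exp.
have S_mono n : nle (S n) (S n.+1) by rewrite /nle SS addrC addKr; exact: pos_exp.
have cE : 1 - b = M^-1 *r a by rewrite /b opprB addrC subrK.
have SM n : nle (S n) (M *r 1).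
  apply: (@nle_trans _ _ (a * S n)).
    rewrite /nle -{2}[S n]mul1r -mulrBl; apply: pos_comm_mul => //.
    have -> : a = M *r (1 - b) by rewrite cE scalerr MV scale1rr.
    rewrite scalerBr !mulrBl !mulrBr -!scalerAl -!scalerAr Sb.
    by rewrite !mul1r !mulr1.
  have -> : a * S n = M *r (1 - b ^+ n) by rewrite -bS cE -scalerAl scalerr MV scale1rr.
  by rewrite /nle -scalerBr opprB addrC subrK; apply: posZ (ltW M0) _; exact: pos_exp.
have [l [Sl pl Sle lM]] := monotone_limit (ltW M0) S_mono pS SM.
have lE : (1 - b) * l = 1.
  have h := scvgD (scvg_cst 1) (scvgMl b Sl).
  have h2 : scvg (fun n => S n.+1) (1 + b * l).
    move: h; rewrite (_ : (fun n => 1 + b * S n) = (fun n => S n.+1)) //.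
    apply/funext => n; rewrite SS -[1](subrK (b ^+ n)) -bS; ncring.
  by rewrite mulrBl mul1r {1}(scvg_unique (scvg_shift Sl) h2) addrK.
have al : a * (M^-1 *r l) = 1 by rewrite -scalerAr scalerAl -cE.
have pr : pos (M^-1 *r l) by exact: posZ.
have la : (M^-1 *r l) * a = 1.
  by rewrite -star1 -al !starE (pos_sa pa) (pos_sa pl).
exists (M^-1 *r l); split=> //.
set r := _ *r l in al la pr *.
have -> : nle r 1 = pos (r * (a * (a - 1)) * r).
  rewrite /nle; congr pos; rewrite !mulrA la mul1r mulrBl al mul1r.
  by [].
apply: pos_conjsa; first exact: pos_sa.
by apply: pos_comm_mul => //; ncring.
Qed.

(** Expand the positive element (r - s) a (r - s), where s a s <= s b s = s. *)
Lemma inverse_anti a b (r s : N) : pos a -> a * r = 1 -> r * a = 1 ->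
  star r = r -> nle a b -> b * s = 1 -> star s = s -> nle s r.
Proof.
move=> pa ar ra sr ab bs ss; apply: nleP => // v.
have sb : s * b * s = s by rewrite -mulrA bs mulr1.
have : nle (s * a * s) s.
  have -> : nle (s * a * s) s = pos (s * (b - a) * s).
    by rewrite /nle mulrBr mulrBl sb.
  exact: pos_conjsa.
move=> /(nle_qf v) h1.
have [_ /(_ v)] : pos ((r - s) * a * (r - s)).
  by apply: pos_conjsa; rewrite ?starB ?sr ?ss.
have -> : (r - s) * a * (r - s) =
    r * a * r - (r * a) * s - s * (a * r) + s * a * s by ncring.
by rewrite ra ar !mul1r mulr1 !qfE; lra.
Qed.

End SquareRoots.

(** * Real parts of tracial states *)

(** The real part of a tracial state is a real-linear functional with these
    properties. Invariance under the adjoint is listed because it does not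
    follow from the others for a functional that is only real-linear. *)
Record rtrace (R : realType) (N : vonNeumannAlgebra R) (f : N -> R) : Prop := {
  rtD : forall x y, f (x + y) = f x + f y;
  rtZ : forall (r : R) x, f (r *r x) = r * f x;
  rt_pos : forall x, pos x -> 0 <= f x;
  rt_comm : forall x y, f (x * y) = f (y * x);
  rt_star : forall x, f (star x) = f x;
  rt1 : f 1 = 1 }.

Section Contractions.
Variables (R : realType) (N : vonNeumannAlgebra R).
Implicit Types (x y z a b : N) (r : R).

Lemma contr_star x : contr x -> contr (star x).
Proof.
move=> /contrP h; apply/contrP => v.
have [->|h0] := eqVneq (hnorm (vn_rep (star x) v)) 0; first exact: hnorm_ge0.
have hp : 0 < hnorm (vn_rep (star x) v) by rewrite lt_def h0 hnorm_ge0.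
rewrite -(ler_pM2l hp) -expr2 -rdot_norm rdot_star.
rewrite (le_trans (ler_norm _)) // (le_trans (CS_hnorm _ _)) // mulrC.
by rewrite ler_wpM2r ?hnorm_ge0.
Qed.

Lemma contrM x y : contr x -> contr y -> contr (x * y).
Proof.
move=> /contrP hx /contrP hy; apply/contrP => v; rewrite vn_repM.
exact: le_trans (hx _) (hy _).
Qed.

Lemma contr1 : contr (1 : N).
Proof. by rewrite /contr star1 mulr1; exact: nlexx. Qed.

Lemma contr_sa_le x : star x = x -> contr x -> nle x 1.
Proof.
move=> sx /contrP h; apply: nleP => //; first exact: star1.
move=> v; rewrite qf1 expr2 (le_trans (ler_norm _)) // (le_trans (CS_hnorm _ _)) //.
by rewrite ler_wpM2r ?hnorm_ge0.
Qed.

Lemma contrN x : contr x -> contr (- x).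
Proof. by rewrite /contr starN mulrNN. Qed.

Lemma le_contr x : star x = x -> nle x 1 -> nle (- x) 1 -> contr x.
Proof.
move=> sx x1 nx1; rewrite /contr sx /nle.
have -> : 1 - x * x = (1 - x) * (1 - - x) by ncring.
by apply: pos_comm_mul => //; ncring.
Qed.

Lemma pos_contr x : pos x -> nle x 1 -> contr x.
Proof.
move=> px x1; apply: le_contr => //; first exact: pos_sa.
by rewrite /nle opprK; apply: posD => //; exact: pos1.
Qed.

Lemma contr_scale x : exists2 K : R, 0 < K & contr (K^-1 *r x).
Proof.
have [M M0 xM] := sq_bound x; exists (Num.sqrt M); first by rewrite sqrtr_gt0.
rewrite /contr starZr -scalerAl -scalerAr scalerr -invfM -expr2.
rewrite sqr_sqrtr ?(ltW M0) // /nle.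
have -> : 1 - M^-1 *r (star x * x) = M^-1 *r (M *r 1 - star x * x).
  by rewrite scalerBr scalerr mulVf ?gt_eqF // scale1r.
by apply: posZ => //; rewrite invr_ge0 ltW.
Qed.

End Contractions.

Section RTrace.
Variables (R : realType) (N : vonNeumannAlgebra R) (f : N -> R).
Hypothesis ft : rtrace f.
Implicit Types (x y z a b : N) (r : R).

Definition nsq x : R := f (star x * x).
Definition ip x y : R := f (star y * x).

Lemma nsqE x : nsq x = f (star x * x). Proof. by []. Qed.

Lemma rt0 : f 0 = 0.
Proof. by have := rtD ft 0 0; rewrite addr0; lra. Qed.

Lemma rtN x : f (- x) = - f x.
Proof. by have := rtD ft x (- x); rewrite subrr rt0; lra. Qed.

Lemma rtB x y : f (x - y) = f x - f y.
Proof. by rewrite (rtD ft) rtN. Qed.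

Lemma rt_le x y : nle x y -> f x <= f y.
Proof. by move/(rt_pos ft); rewrite rtB subr_ge0. Qed.

Lemma nsq_ge0 x : 0 <= nsq x.
Proof. by apply: (rt_pos ft); exact: pos_sq. Qed.

Lemma ipC x y : ip x y = ip y x.
Proof. by rewrite /ip -(rt_star ft) !starE. Qed.

Lemma ipDl x y z : ip (x + y) z = ip x z + ip y z.
Proof. by rewrite /ip mulrDr (rtD ft). Qed.

Lemma ipNl x y : ip (- x) y = - ip x y.
Proof. by rewrite /ip mulrN rtN. Qed.

Lemma ipZl r x y : ip (r *r x) y = r * ip x y.
Proof. by rewrite /ip -scalerAr (rtZ ft). Qed.

Lemma ipDr x y z : ip z (x + y) = ip z x + ip z y.
Proof. by rewrite !(ipC z) ipDl. Qed.

Lemma ipNr x y : ip y (- x) = - ip y x.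
Proof. by rewrite !(ipC y) ipNl. Qed.

Lemma ipZr r x y : ip y (r *r x) = r * ip y x.
Proof. by rewrite !(ipC y) ipZl. Qed.

Definition ipE := (ipDl, ipNl, ipZl, ipDr, ipNr, ipZr).

Lemma ipxx x : ip x x = nsq x. Proof. by []. Qed.

Lemma nsqD x y : nsq (x + y) = nsq x + nsq y + 2 * ip x y.
Proof. by rewrite -!ipxx !ipE (ipC y x); ring. Qed.

Lemma nsqN x : nsq (- x) = nsq x.
Proof. by rewrite -!ipxx !ipE opprK. Qed.

Lemma nsqB x y : nsq (x - y) = nsq x + nsq y - 2 * ip x y.
Proof. by rewrite nsqD nsqN !ipE; ring. Qed.

Lemma nsqZ r x : nsq (r *r x) = r ^+ 2 * nsq x.
Proof. by rewrite -!ipxx !ipE; ring. Qed.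

Lemma nsq0 : nsq 0 = 0.
Proof. by rewrite /nsq mulr0 rt0. Qed.

Lemma nsq1 : nsq 1 = 1.
Proof. by rewrite /nsq star1 mulr1 (rt1 ft). Qed.

Lemma nsqC x y : nsq (x - y) = nsq (y - x).
Proof. by rewrite -opprB nsqN. Qed.

Lemma nsq_star x : nsq (star x) = nsq x.
Proof. by rewrite /nsq starK (rt_comm ft). Qed.

Lemma ip1 x : ip x 1 = f x. Proof. by rewrite /ip star1 mul1r. Qed.

Lemma CS_ip x y : ip x y ^+ 2 <= nsq x * nsq y.
Proof.
apply: discriminant_le0 => t; have := nsq_ge0 (t *r x + y).
by rewrite nsqD nsqZ !ipE; congr (_ <= _); ring.
Qed.

Lemma rt_sq_le x : f x ^+ 2 <= nsq x.
Proof. by have := CS_ip x 1; rewrite ip1 nsq1 mulr1. Qed.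

Definition fnorm x : R := Num.sqrt (nsq x).

Lemma fnormE x : fnorm x = Num.sqrt (nsq x). Proof. by []. Qed.

Lemma fnorm_ge0 x : 0 <= fnorm x. Proof. exact: sqrtr_ge0. Qed.

Lemma fnorm_sq x : fnorm x ^+ 2 = nsq x.
Proof. by rewrite sqr_sqrtr ?nsq_ge0. Qed.

Lemma fnorm1 : fnorm 1 = 1. Proof. by rewrite /fnorm nsq1 sqrtr1. Qed.

Lemma fnormN x : fnorm (- x) = fnorm x. Proof. by rewrite /fnorm nsqN. Qed.

Lemma fnormC x y : fnorm (x - y) = fnorm (y - x).
Proof. by rewrite /fnorm nsqC. Qed.

Lemma fnorm_star x : fnorm (star x) = fnorm x.
Proof. by rewrite /fnorm nsq_star. Qed.

Lemma fnormZ r x : fnorm (r *r x) = `|r| * fnorm x.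
Proof. by rewrite /fnorm nsqZ sqrtrM ?sqr_ge0 // sqrtr_sqr. Qed.

Lemma CS_fnorm x y : `|ip x y| <= fnorm x * fnorm y.
Proof.
rewrite -ler_sqr ?nnegrE ?mulr_ge0 ?fnorm_ge0 // real_normK ?num_real //.
by rewrite exprMn !fnorm_sq CS_ip.
Qed.

Lemma fnormD x y : fnorm (x + y) <= fnorm x + fnorm y.
Proof.
rewrite -ler_sqr ?nnegrE ?addr_ge0 ?fnorm_ge0 // fnorm_sq nsqD sqrrD !fnorm_sq.
have := le_trans (ler_norm _) (CS_fnorm x y); rewrite -mulr_natl; lra.
Qed.

Lemma fnormB x y : fnorm (x - y) <= fnorm x + fnorm y.
Proof. by rewrite -(fnormN y) fnormD. Qed.

Lemma fnorm_dist x y : `|fnorm x - fnorm y| <= fnorm (x - y).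
Proof.
have h1 := fnormD (x - y) y; have h2 := fnormD (y - x) x.
by rewrite !subrK in h1 h2; rewrite ler_norml; rewrite fnormC in h2; lra.
Qed.

Lemma rt_le_fnorm x : `|f x| <= fnorm x.
Proof. by have := CS_fnorm x 1; rewrite ip1 fnorm1 mulr1. Qed.

Lemma nsqMl (M : R) a x : nle (star a * a) (M *r 1) -> nsq (a * x) <= M * nsq x.
Proof.
move=> aM; rewrite /nsq -(rtZ ft) starM; apply: rt_le.
have -> : nle (star x * star a * (a * x)) (M *r (star x * x)) =
    pos (star x * (M *r 1 - star a * a) * x).
  by rewrite /nle mulrBr mulrBl -scalerAr mulr1 -scalerAl !mulrA.
exact: pos_conj.
Qed.

Lemma nsqMr (M : R) a x : nle (a * star a) (M *r 1) -> nsq (x * a) <= M * nsq x.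
Proof.
move=> aM; rewrite -nsq_star starM -(nsq_star x); apply: nsqMl.
by rewrite starK.
Qed.

Lemma fnorm_contrl a x : contr a -> fnorm (a * x) <= fnorm x.
Proof.
move=> ca; apply: ler_wsqrtr; rewrite -[leRHS]mul1r.
by apply: nsqMl; rewrite scale1r.
Qed.

Lemma fnorm_contrr a x : contr a -> fnorm (x * a) <= fnorm x.
Proof.
by move=> /contr_star ca; rewrite -fnorm_star starM -(fnorm_star x) fnorm_contrl.
Qed.

Lemma fnorm_bound a : exists2 M : R, 0 <= M &
  forall x, fnorm (a * x) <= M * fnorm x /\ fnorm (x * a) <= M * fnorm x.
Proof.
have [M1 M10 h1] := sq_bound a; have [M2 M20 h2] := sq_bound (star a).
exists (Num.sqrt M1 + Num.sqrt M2); first by rewrite addr_ge0 ?sqrtr_ge0.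
move=> x; split.
  apply: (@le_trans _ _ (Num.sqrt M1 * fnorm x)).
    by rewrite /fnorm -sqrtrM ?(ltW M10) //; apply: ler_wsqrtr; exact: nsqMl.
  by rewrite ler_wpM2r ?fnorm_ge0 // lerDl sqrtr_ge0.
apply: (@le_trans _ _ (Num.sqrt M2 * fnorm x)).
  rewrite /fnorm -sqrtrM ?(ltW M20) //; apply: ler_wsqrtr; apply: nsqMr.
  by rewrite -{1}(starK a).
by rewrite ler_wpM2r ?fnorm_ge0 // lerDr sqrtr_ge0.
Qed.

End RTrace.

(** * Completeness of the unit ball for the 2-norm *)

Section Complete.
Variables (R : realType) (N : vonNeumannAlgebra R) (tau : {scalar N}).
Hypothesis ht : faithful_normal_tracial_state tau.
Implicit Types (x y z a b : N) (r : R).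

Definition rtau x : R := complex.Re (tau x).

Lemma tau_pos x : pos x -> 0 <= tau x.
Proof. by move=> /pos_vn_positive[y ->]; exact: state_ge0 ht y. Qed.

Lemma tau_real x : star x = x -> complex.Im (tau x) = 0.
Proof.
move=> sx; have [M M0 xM] := pos_le_scalar sx.
have := tau_pos xM; rewrite linearB linearZ /= (state1 ht) mulr1 => /ger0_Im.
by case: (tau x) => u v /=; rewrite sub0r => /eqP; rewrite oppr_eq0 => /eqP.
Qed.

(** The difference x - star x is i times a self-adjoint element, which has real
    trace. *)
Lemma rtau_star x : rtau (star x) = rtau x.
Proof.
pose i : R[i] := 'i%C; pose y := (- i) *: (x - star x).
have ci : Num.conj (- i) = i by apply/eqP; rewrite eq_complex /= !opprK oppr0 !eqxx.
have sy : star y = y by rewrite /y starZ ci starB starK -opprB scalerN scaleNr.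
have xy : x - star x = i *: y.
  by rewrite /y scalerA mulrN -expr2 sqr_i opprK scale1r.
have := tau_real sy; have := congr1 (fun z => complex.Re (tau z)) xy.
rewrite linearB linearZ /= /rtau; case: (tau x) (tau (star x)) (tau y) => [a b] [c d] [e f] /=.
by move=> h ef; rewrite ef in h; lra.
Qed.

Lemma rtau_rtrace : rtrace rtau.
Proof.
split=> [x y|r x|x /tau_pos|x y|x|].
- by rewrite /rtau linearD ReD.
- by rewrite /rtau linearZ ReZ.
- by rewrite lecE => /andP[].
- by rewrite /rtau (state_trace ht).
- exact: rtau_star.
- by rewrite /rtau (state1 ht).
Qed.

Local Notation nsq := (nsq rtau).
Local Notation fnorm := (fnorm rtau).

Lemma nsq_faithful x : nsq x = 0 -> x = 0.
Proof.
move=> h; apply: (state_faithful ht); have := state_ge0 ht x.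
by move=> /ger0_Im; move: h; rewrite /nsq /rtau; case: (tau _) => a b /= -> ->.
Qed.

Lemma rtau_faithful x : pos x -> rtau x = 0 -> x = 0.
Proof.
move=> /sqrt_exists[s [ps <- _]]; rewrite -{1}(pos_sa ps) => /nsq_faithful ->.
by rewrite mulr0.
Qed.

Lemma norm2E x : norm2 tau x = fnorm x. Proof. by []. Qed.

(** The strong limit of an increasing sequence is its least upper bound, so the
    order-theoretic normality of the state applies. *)
Lemma rtau_normal (x : nat -> N) y (e : R) : (forall n, pos (x n)) ->
  (forall n, nle (x n) (x n.+1)) -> (forall n, nle (x n) y) -> pos y ->
  scvg x y -> 0 < e -> exists n, rtau y - e < rtau (x n).
Proof.
move=> px x_mono xy py xcy e0; apply: contrapT => /forallNP H.
have sx n := pos_sa (px n).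
have taur z : star z = z -> tau z = (rtau z)%:C%C.
  by move=> /tau_real; rewrite /rtau; case: (tau z) => a b /= ->.
have dir : vn_directed (range x).
  split; first by exists (x 0%N); exists 0%N.
  move=> _ _ [n _ <-] [m _ <-]; exists (x (maxn n m)); split.
  - by exists (maxn n m).
  - by apply/pos_vn_positive; apply: nle_mono => //; exact: leq_maxl.
  - by apply/pos_vn_positive; apply: nle_mono => //; exact: leq_maxr.
have lub : vn_lub (range x) y.
  split; first by move=> _ [n _ <-]; apply/pos_vn_positive; exact: xy.
  move=> t ht'; apply/pos_vn_positive.
  have tx n : nle (x n) t by apply/pos_vn_positive; apply: ht'; exists n.
  apply: (scvg_le (n0 := 0) xcy sx) => //.
  by have /pos_sa := tx 0%N; rewrite starB sx => /(congr1 (+%R^~ (x 0%N))); rewrite !subrK.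
have Dpos z : range x z -> vn_positive z by move=> [n _ <-]; apply/pos_vn_positive.
have [_ /(_ (rtau y - e)%:C%C)] := state_normal ht dir Dpos lub.
rewrite /= taur; last exact: pos_sa.
rewrite lecR => h; suff : rtau y <= rtau y - e by lra.
apply: h => _ [_ [n _ <-] <-].
by rewrite taur // lecR leNgt; apply/negP; exact: H.
Qed.

Lemma resolvent_l a i : (1 + a) * i = 1 -> a * i = 1 - i.
Proof. by rewrite mulrDl mul1r => <-; rewrite addrC addKr. Qed.

Lemma resolvent_r a i : i * (1 + a) = 1 -> i * a = 1 - i.
Proof. by rewrite mulrDr mulr1 => <-; rewrite addrC addKr. Qed.

Lemma resolvent_le a i : pos a -> pos i -> (1 + a) * i = 1 -> i * (1 + a) = 1 ->
  nle (1 - i) a.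
Proof.
move=> pa pi /resolvent_l ai /resolvent_r ia.
have -> : nle (1 - i) a = pos (a * i * a).
  by rewrite /nle -mulrA ia mulrBr ai mulr1.
by apply: pos_conjsa => //; exact: pos_sa.
Qed.

Definition psum (s : nat -> N) n k := \sum_(i < k) s (n + i)%N.

Lemma psumS s n k : psum s n k.+1 = psum s n k + s (n + k)%N.
Proof. by rewrite /psum big_ord_recr. Qed.

Lemma psumSl s n k : psum s n k.+1 = s n + psum s n.+1 k.
Proof.
rewrite /psum big_ord_recl addn0; congr (_ + _).
by apply: eq_bigr => i _; rewrite lift0 addnS addSn.
Qed.

Lemma psum_pos s n k : (forall m, pos (s m)) -> pos (psum s n k).
Proof.
move=> ps; elim: k => [|k IH]; first by rewrite /psum big_ord0; exact: pos0.
by rewrite psumS; exact: posD.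
Qed.

(** The increasing transforms 1 - (1 + S)^-1 of the partial sums S are bounded
    by 1, so they have a limit even when the partial sums are not bounded in
    norm, and normality controls its trace. The factor 5 comes from
    h <= 5 (1 - (1 + h)^-1) for 0 <= h <= 4. *)
Lemma dominating_seq (s : nat -> N) (e : nat -> R) : (forall m, pos (s m)) ->
  (forall n k, rtau (psum s n k) <= e n) ->
  exists b : nat -> N, [/\ (forall n, pos (b n)), (forall n, nle (b n) 1),
    (forall n, nle (b n.+1) (b n)), (forall n, rtau (b n) <= e n) &
    forall n k h, pos h -> nle h (4 *r 1) -> nle h (psum s n k) ->
      nle h (5 *r b n)].
Proof.
move=> ps te; have pS n k := psum_pos n k ps.
have S1 n k : nle 1 (1 + psum s n k) by rewrite /nle addrC addKr.
have /choice[r hr] (p : nat * nat) := inverse_exists (S1 p.1 p.2).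
pose B n k := 1 - r (n, k).
have anti n k a i : pos a -> pos i -> (1 + a) * i = 1 -> i * (1 + a) = 1 ->
    nle a (psum s n k) -> nle (1 - i) (B n k).
  move=> pa pi ai ia aS; have [pr _ Sr _] := hr (n, k).
  have pa1 : pos (1 + a) by apply: posD => //; exact: pos1.
  have ab : nle (1 + a) (1 + psum s n k) by rewrite /nle opprD addrACA subrr add0r.
  have := inverse_anti pa1 ai ia (pos_sa pi) ab Sr (pos_sa pr).
  by rewrite /nle (_ : B n k - (1 - i) = i - r (n, k)) // /B; ncring.
have antiB n k m j : nle (psum s n k) (psum s m j) -> nle (B n k) (B m j).
  by have [pr _ Sr rS] := hr (n, k); apply: anti.
have pB n k : pos (B n k) by have [_ r1 _ _] := hr (n, k).
have B1 n k : nle (B n k) (1 *r 1).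
  rewrite scale1r /nle opprB addrC subrK; by have [] := hr (n, k).
have B_mono n k : nle (B n k) (B n k.+1).
  by apply: antiB; rewrite psumS /nle addrC addKr.
have tB n k : rtau (B n k) <= e n.
  apply: le_trans (te n k); apply: (rt_le rtau_rtrace).
  by have [pr _ Sr rS] := hr (n, k); exact: resolvent_le.
have /choice[b hb] n := monotone_limit ler01 (B_mono n) (pB n) (B1 n).
exists b; split.
- by move=> n; have [] := hb n.
- by move=> n; have [_ _ _] := hb n; rewrite scale1r.
- move=> n; have [Bl _ _ _] := hb n.+1; have [_ pb Bb _] := hb n.
  apply: (scvg_le (n0 := 0) Bl) => [k|k _|]; [exact: pos_sa|idtac|exact: pos_sa].
  apply: nle_trans (Bb k.+1); apply: antiB.
  by rewrite psumSl /nle addrK.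
- move=> n; have [Bl pb Bb _] := hb n; apply/ler_addgt0Pr => d d0.
  have [k hk] := rtau_normal (pB n) (B_mono n) Bb pb Bl d0.
  by have := tB n k; lra.
- move=> n k h ph h4 hS; have [_ _ Bb _] := hb n.
  have [|i [pi _ hi ih]] := @inverse_exists _ _ (1 + h).
    by rewrite /nle addrC addKr.
  have h1 := nle_trans _ (anti _ _ _ _ ph pi hi ih hS) (Bb k).
  apply: (@nle_trans _ _ (5 *r (1 - i))); last first.
    by rewrite /nle -scalerBr; apply: posZ => //; exact: ler0n.
  have hie := resolvent_l hi; have ihe := resolvent_r ih.
  have -> : nle h (5 *r (1 - i)) = pos (h * i * (4 *r 1 - h)).
    rewrite /nle; congr pos; rewrite mulrBr -scalerAr mulr1 -mulrA ihe hie.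
    rewrite mulrBr mulr1 hie (_ : 5 = 4 + 1) ?scalerDlr ?scale1rr; last by ring.
    by rewrite (opprB h) !addrA.
  apply: pos_comm_mul => //; first by apply: pos_comm_mul => //; rewrite ihe hie.
  have e1 : h * i * h = h * (h * i) by rewrite -mulrA ihe hie.
  by rewrite (mulrBr (h * i)) (mulrBl (h * i)) -scalerAr -scalerAl mulr1 mul1r e1.
Qed.

(** Only rapidly convergent sequences are tested: the maximizing and minimizing
    sequences below can be chosen so, and the weighted sum of the squared
    increments then has finite trace. *)
Definition complete2 (C : set N) := forall y : nat -> N, (forall n, C (y n)) ->
  (forall n, nsq (y n.+1 - y n) <= 8^-1 ^+ n) ->
  exists2 z, C z & (fun n => fnorm (y n - z)) @ \oo --> (0 : R).


Lemma sq_triangle x y : nle (star (x + y) * (x + y))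
  (2 *r (star x * x) + 2 *r (star y * y)).
Proof.
rewrite /nle.
have -> : 2 *r (star x * x) + 2 *r (star y * y) - star (x + y) * (x + y) =
    star (x - y) * (x - y).
  by rewrite !scalerDlr !scale1r starD starB; ncring.
exact: pos_sq.
Qed.

Lemma contr_sub_sq x y : contr x -> contr y -> nle (star (x - y) * (x - y)) (4 *r 1).
Proof.
move=> cx cy; apply: nle_trans (sq_triangle x (- y)) _.
have -> : 4 *r (1 : N) = 2 *r 1 + 2 *r 1 by rewrite -scalerDlr; congr (_%:C%C *: _); ring.
rewrite starN mulrNN.
by apply: nleD; rewrite /nle -scalerBr; apply: posZ.
Qed.

(** The squares of y (n + k) - y n are bounded by the partial sums of weighted
    squares of increments, hence by elements b n that decrease to 0. This gives
    both the strong limit and the estimate of its 2-distance to y n. *)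
Lemma ball_complete : complete2 [set x | contr x].
Proof.
move=> y cy ye; pose q (n : nat) : R := 4^-1 ^+ n.
have q0 n : 0 <= q n by rewrite exprn_ge0 // invr_ge0.
have qS n : q n.+1 = 4^-1 * q n by rewrite /q exprS.
pose e n := y n.+1 - y n; pose s m := (2 ^+ m.+1) *r (star (e m) * e m).
have ps m : pos (s m) by apply: posZ; [exact: exprn_ge0|exact: pos_sq].
have ts m : rtau (s m) <= 2 * q m.
  rewrite (rtZ rtau_rtrace) (le_trans (ler_wpM2l (exprn_ge0 _ _) (ye m))) //.
  rewrite exprS -mulrA -exprMn ler_wpM2l // /q.
  by rewrite (_ : 2 / 8 = 4^-1 :> R) //; field.
have tS n k : rtau (psum s n k) <= 4 * q n.
  suff : rtau (psum s n k) <= 4 * q n - 4 * q (n + k)%N by have := q0 (n + k)%N; lra.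
  elim: k => [|k IH].
    by rewrite /psum big_ord0 addn0 subrr (rt0 rtau_rtrace).
  rewrite psumS (rtD rtau_rtrace) addnS qS.
  by have := ts (n + k)%N; have := q0 (n + k)%N; lra.
have dS k n : nle ((2 ^+ n) *r (star (y (n + k)%N - y n) * (y (n + k)%N - y n)))
    (psum s n k).
  elim: k n => [|k IH] n.
    rewrite addn0 subrr mulr0 scaler0 /psum big_ord0; exact: nlexx.
  rewrite psumSl addnS -addSn.
  have -> : y (n.+1 + k)%N - y n = e n + (y (n.+1 + k)%N - y n.+1).
    by rewrite /e [RHS]addrC addrA subrK.
  apply: (nle_trans _ _ (nleD (nlexx (s n)) (IH n.+1))).
  rewrite /s !exprSr -!scalerr -scalerDr /nle -scalerBr.
  by apply: posZ; [exact: exprn_ge0|exact: sq_triangle].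
have [b [pb b1 b_anti tb bdom]] := dominating_seq ps tS.
have dom n k : nle (star (y (n + k)%N - y n) * (y (n + k)%N - y n)) (5 *r b n).
  apply: (bdom n k); [exact: pos_sq|by apply: contr_sub_sq; exact: cy|].
  apply: nle_trans (dS k n); rewrite /nle -{2}[star _ * _]scale1r -scalerBlr.
  apply: posZ; last exact: pos_sq.
  by rewrite subr_ge0; apply: exprn_ege1; rewrite ler1n.
have [l [bl pl lb]] := antitone_limit b_anti pb (b1 0%N).
have q_cvg (c : R) : (fun n => c * q n) @ \oo --> (0 : R).
  apply: cvg0Z; apply: cvg_expr.
  by rewrite ger0_norm ?invr_ge0 // invf_lt1 // ltr1n.
(* The limit of the dominating sequence has trace zero, so it vanishes. *)
have l0 : l = 0.
  apply: rtau_faithful => //; apply/eqP; rewrite eq_le (rt_pos rtau_rtrace) // andbT.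
  have h : (fun=> rtau l) @ \oo --> rtau l by exact: cvg_cst.
  apply: (ler_cvg_to h (q_cvg 4)); apply: nearW => n.
  by rewrite (le_trans (rt_le rtau_rtrace (lb n))).
have b0 v : (fun n => qf (b n) v) @ \oo --> (0 : R).
  by rewrite -(qf0 v) -l0; exact: scvg_qf.
have yd n m v : (n <= m)%N -> hnorm (vn_rep (y m - y n) v) ^+ 2 <= 5 * qf (b n) v.
  move=> /subnKC <-; rewrite -qf_sq -qfZ; exact: nle_qf (dom n _).
have [z yz zb] : exists2 z, scvg y z & forall v, hnorm (vn_rep z v) <= 1 * hnorm v.
  apply: strong_limit; first by move=> n v; rewrite mul1r; have /contrP := cy n; apply.
  move=> v d d0; have d2 : 0 < (d / 2) ^+ 2 / 5 by rewrite divr_gt0 ?exprn_gt0 ?divr_gt0.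
  have /cvgrPdist_lt/(_ _ d2)[n0 _ /(_ n0 (leqnn _))] := b0 v.
  rewrite /= sub0r normrN ger0_norm; last by case: (pb n0).
  rewrite ltr_pdivlMr // mulrC => hb.
  have P m : (n0 <= m)%N -> hnorm (vn_rep (y m - y n0) v) < d / 2.
    move=> nm; rewrite -ltr_sqr ?nnegrE ?hnorm_ge0 //; last by rewrite ltW ?divr_gt0.
    exact: le_lt_trans (yd _ _ v nm) hb.
  exists n0 => n m nn nm; rewrite (_ : y n - y m = (y n - y n0) - (y m - y n0)).
    rewrite repB (le_lt_trans (hnormD _ _)) // hnormN.
    by have := P n nn; have := P m nm; lra.
  by rewrite opprB addrA subrK.
have cz : contr z by apply/contrP => v; rewrite -[leRHS]mul1r.
exists z => //.
have zd n : nsq (y n - z) <= 20 * q n.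
  have : nle (star (z - y n) * (z - y n)) (5 *r b n).
    apply: nleP; [by rewrite starM starK|by rewrite starZr (pos_sa (pb n))|move=> v].
    rewrite qf_sq qfZ.
    have bn0 : 0 <= 5 * qf (b n) v by rewrite mulr_ge0 //; case: (pb n).
    rewrite -(sqr_sqrtr bn0) ler_sqr ?nnegrE ?hnorm_ge0 ?sqrtr_ge0 //.
    apply/ler_addgt0Pr => d d0.
    have /cvgrPdist_lt/(_ _ d0)[n0 _ /(_ (maxn n n0) (leq_maxr _ _))] := yz v.
    rewrite /= sub0r normrN ger0_norm ?hnorm_ge0 // => h.
    rewrite (_ : z - y n = (y (maxn n n0) - y n) - (y (maxn n n0) - z)); last first.
      by rewrite opprB [RHS]addrC addrA subrK.
    rewrite repB (le_trans (hnormD _ _)) // hnormN lerD //; last exact: ltW.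
    rewrite -(ger0_norm (hnorm_ge0 _)) -sqrtr_sqr; apply: ler_wsqrtr.
    by apply: yd; exact: leq_maxl.
  move/(rt_le rtau_rtrace); rewrite (rtZ rtau_rtrace) (nsqC rtau_rtrace) => h.
  by rewrite (le_trans h) //; have := tb n; lra.
have : (fun n => Num.sqrt (20 * q n)) @ \oo --> (0 : R).
  rewrite -[X in _ --> X](@sqrtr0 R); apply: continuous_cvg; last exact: q_cvg.
  exact: sqrt_continuous.
move=> h; apply: (cvg0_le _ h) => n; rewrite sqrtr_ge0 /=.
by apply: ler_wsqrtr; exact: zd.
Qed.

End Complete.

(** * Unitaries span *)

Section Unitaries.
Variables (R : realType) (N : vonNeumannAlgebra R).
Implicit Types (x y z a b h u : N) (r : R).

Local Notation i := ('i%C : R[i]).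

Lemma conj_i : Num.conj i = - i.
Proof. by apply/eqP; rewrite eq_complex /= oppr0 !eqxx. Qed.

Lemma conj_Ni : Num.conj (- i) = i.
Proof. by apply/eqP; rewrite eq_complex /= !opprK oppr0 !eqxx. Qed.

(** A self-adjoint contraction g is the average of the unitaries
    g + i sqrt(1 - g g) and g - i sqrt(1 - g g). *)
Lemma sa_unitary_sum h : star h = h ->
  exists (M : R) (u v : N), [/\ vn_unitary u, vn_unitary v & h = M *r (u + v)].
Proof.
move=> sh; have [K K0 cg] := contr_scale h.
have [g gE] : exists g, g = K^-1 *r h by exists (K^-1 *r h).
have sg : star g = g by rewrite gE starZr sh.
have pg : pos (1 - g * g) by move: cg; rewrite -gE /contr sg.
have [s [ps ss sc]] := sqrt_exists pg.
have gs : g * s = s * g by apply: sc; ncring.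
have U (c : R[i]) : Num.conj c = - c -> c * c = -1 -> vn_unitary (g + c *: s).
  move=> cc c2; have sE : star (g + c *: s) = g - c *: s.
    by rewrite starD starZ cc sg (pos_sa ps) scaleNr.
  have e : g * g + s * s = 1 by rewrite ss addrC subrK.
  have tg : g * (c *: s) = (c *: s) * g by rewrite -scalerAl -scalerAr gs.
  have tt : (c *: s) * (c *: s) = - (s * s).
    by rewrite -scalerAl -scalerAr scalerA c2 scaleN1r.
  split; rewrite sE; move: (c *: s) tg tt => t tg tt.
    rewrite (_ : _ * _ = g * g - t * t + (g * t - t * g)); last by ncring.
    by rewrite tg tt subrr addr0 opprK.
  rewrite (_ : _ * _ = g * g - t * t - (g * t - t * g)); last by ncring.
  by rewrite tg tt subrr subr0 opprK.
exists (2^-1 * K), (g + i *: s), (g + (- i) *: s); split.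
- by apply: U; [exact: conj_i|rewrite -expr2 sqr_i].
- by apply: U; [rewrite conj_Ni opprK|rewrite mulrNN -expr2 sqr_i].
- rewrite scaleNr addrACA subrr addr0 mulrC -scalerr half_add gE scalerr.
  by rewrite mulfV ?gt_eqF // scale1r.
Qed.

Lemma sa_decomp x : exists a b, [/\ star a = a, star b = b & x = a + i *: b].
Proof.
exists (2^-1 *r (x + star x)), (2^-1 *r ((- i) *: (x - star x))); split.
- by rewrite starZr starD starK addrC.
- by rewrite starZr starZ conj_Ni starB starK -opprB scalerN scaleNr.
- rewrite !scalerA mulrAC mulrN -expr2 sqr_i opprK mul1r.
  by rewrite -scalerDr addrACA subrr addr0 half_add.
Qed.

Lemma unitary_decomp a : exists (M M' : R) (u v u' v' : N),
  [/\ vn_unitary u, vn_unitary v, vn_unitary u', vn_unitary v' &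
      a = M *r (u + v) + i *: (M' *r (u' + v'))].
Proof.
have [x [y [sx sy ->]]] := sa_decomp a.
have [M [u [v [uu uv ->]]]] := sa_unitary_sum sx.
have [M' [u' [v' [uu' uv' ->]]]] := sa_unitary_sum sy.
by exists M, M', u, v, u', v'.
Qed.

Lemma unitary_comm z : (forall u, vn_unitary u -> z * u = u * z) ->
  forall x, z * x = x * z.
Proof.
move=> h x; have [M [M' [u [v [u' [v' [uu uv uu' uv' ->]]]]]]] := unitary_decomp x.
rewrite mulrDr mulrDl -!scalerAl -!scalerAr !mulrDr !mulrDl.
by rewrite (h u) // (h v) // (h u') // (h v').
Qed.

Lemma unitary_contr u : vn_unitary u -> contr u.
Proof. by case=> uu _; rewrite /contr uu; exact: nlexx. Qed.

Lemma unitary_star u : vn_unitary u -> vn_unitary (star u).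
Proof. by case=> h k; split; rewrite starK. Qed.

End Unitaries.

(** * Two variational principles *)

Section Variational.
Variables (R : realType) (N : vonNeumannAlgebra R) (tau : {scalar N}).
Hypothesis ht : faithful_normal_tracial_state tau.
Implicit Types (x y z a b h u : N) (r : R) (C : set N).

Local Notation rt := (rtau_rtrace ht).
Local Notation nsq := (nsq (rtau tau)).
Local Notation fnorm := (fnorm (rtau tau)).

Lemma parallelogram x y : nsq (x + y) + nsq (x - y) = 2 * nsq x + 2 * nsq y.
Proof. by rewrite (nsqD rt) (nsqB rt); ring. Qed.

(** A quadratic functional on a bounded complete set need not attain its
    maximum, but subtracting small multiples of squared distances to the points
    of a maximizing sequence makes it do so; the second order condition at the
    maximum survives up to the total weight c of these perturbations. *)
Lemma quadratic_maximum C (L : N -> R) (K c : R) :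
  complete2 tau C -> C !=set0 -> (forall x, C x -> fnorm x <= 1) ->
  0 < c -> 0 <= K -> (forall x y, L (x + y) + L (x - y) = 2 * L x + 2 * L y) ->
  (forall x y, C x -> C y -> `|L x - L y| <= K * fnorm (x - y)) ->
  exists y, [/\ C y,
    (forall h, C (y + h) -> C (y - h) -> L h <= c * nsq h) &
    (forall z, C z -> L z <= L y + c * 4)].
Proof.
move=> Cc [x0 Cx0] C1 c0 K0 Lp Ll.
(* The n-th perturbation has weight w n. The n-th point maximizes up to e n,
   which is so small compared to w n that the points converge rapidly. *)
pose w (n : nat) : R := c * 2^-1 ^+ n.+1.
have w0 n : 0 < w n by rewrite mulr_gt0 // exprn_gt0 // invr_gt0.
pose e n : R := w n * 8^-1 ^+ n / 2.
have e0 n : 0 < e n by rewrite /e !mulr_gt0 ?invr_gt0 // exprn_gt0 // invr_gt0.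
have eS n : e n.+1 <= e n.
  rewrite /e ler_pM2r ?invr_gt0 // /w !exprS.
  set p := 2^-1 ^+ n; set q := 8^-1 ^+ n.
  have p0 : 0 < p by rewrite exprn_gt0 // invr_gt0.
  have q0 : 0 < q by rewrite exprn_gt0 // invr_gt0.
  have pq : 0 < c * (p * q) by rewrite !mulr_gt0.
  rewrite (_ : _ * (8^-1 * q) = (c * (p * q)) / 32); last by field.
  rewrite (_ : c * _ * q = (c * (p * q)) / 2); last by field.
  by lra.
have LB z : C z -> L z <= L x0 + K * 2.
  move=> Cz; have := le_trans (ler_norm _) (Ll _ _ Cz Cx0) => h.
  have : K * fnorm (z - x0) <= K * 2.
    rewrite ler_wpM2l // (le_trans (fnormB rt _ _)) //.
    by have := C1 _ Cz; have := C1 _ Cx0; lra.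
  by lra.
have /choice[pick pickP] (p : nat * (N -> R)) : exists y, C y /\
    ((exists M, forall z, C z -> p.2 z <= M) ->
     forall z, C z -> p.2 z <= p.2 y + e p.1).
  have [[M hM]|nb] := pselect (exists M, forall z, C z -> p.2 z <= M); last first.
    by exists x0; split.
  pose V := [set p.2 z | z in C].
  have Vs : has_sup V.
    by split; [exists (p.2 x0); exists x0|exists M => _ [z Cz <-]; exact: hM].
  have [_ [y Cy <-] hy] := sup_adherent (e0 p.1) Vs.
  exists y; split=> // _ z Cz; rewrite -lerBlDr.
  have : p.2 z <= sup V by apply: sup_upper_bound => //; exists z.
  by lra.
pose G := fix G n := if n is n.+1 then
  (fun z => G n z - w n * nsq (z - pick (n, G n))) else L.
pose y n := pick (n, G n).
have Cy n : C (y n) by have [] := pickP (n, G n).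
have GS n z : G n.+1 z = G n z - w n * nsq (z - y n) by [].
have GL n z : G n z <= L z.
  elim: n => // n IH; rewrite GS; apply: le_trans IH.
  by rewrite gerBl mulr_ge0 // ?(ltW (w0 _)) // (nsq_ge0 rt).
have Gmax n z : C z -> G n z <= G n (y n) + e n.
  have [_ h] := pickP (n, G n); apply: h.
  by exists (L x0 + K * 2) => t Ct; exact: le_trans (GL _ _) (LB _ Ct).
pose D n z := \sum_(j < n) w j * nsq (z - y j).
have GD n z : G n z = L z - D n z.
  elim: n => [|n IH]; first by rewrite /D big_ord0 subr0.
  by rewrite GS IH /D big_ord_recr /= opprD addrA.
have ycau n : nsq (y n.+1 - y n) <= 8^-1 ^+ n.
  have h1 := Gmax n.+1 _ (Cy n); have h2 := Gmax n _ (Cy n.+1).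
  rewrite !GS subrr (nsq0 rt) mulr0 subr0 in h1.
  have : w n * nsq (y n.+1 - y n) <= w n * 8^-1 ^+ n.
    have -> : w n * 8^-1 ^+ n = e n + e n by rewrite /e; field.
    by have := eS n; lra.
  by rewrite ler_pM2l.
have [z Cz yz] := Cc y Cy ycau.
pose wsum n := \sum_(j < n) w j.
have wsumE n : wsum n = c - c * 2^-1 ^+ n.
  elim: n => [|n IH]; first by rewrite /wsum big_ord0 expr0 mulr1 subrr.
  by rewrite /wsum big_ord_recr /= -/(wsum n) IH /w exprS; field.
have wsumc n : wsum n <= c.
  by rewrite wsumE gerBl mulr_ge0 ?ltW // exprn_gt0 // invr_gt0.
have C2 x t : C x -> C t -> fnorm (x - t) <= 2.
  move=> Cx Ct; rewrite (le_trans (fnormB rt _ _)) //.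
  by have := C1 _ Cx; have := C1 _ Ct; lra.
have C4 x t : C x -> C t -> nsq (x - t) <= 4.
  move=> Cx Ct; rewrite -(fnorm_sq rt).
  by have := C2 _ _ Cx Ct; have := fnorm_ge0 (rtau tau) (x - t); nra.
have Dlip n x t : C x -> C t -> `|D n x - D n t| <= c * 4 * fnorm (x - t).
  move=> Cx Ct; rewrite /D -sumrB (le_trans (ler_norm_sum _ _ _)) //.
  apply: (@le_trans _ _ (wsum n * (4 * fnorm (x - t)))).
    rewrite /wsum mulr_suml; apply: ler_sum => j _.
    rewrite -mulrBr normrM (gtr0_norm (w0 j)); apply: ler_wpM2l; first exact: ltW.
    rewrite -!(fnorm_sq rt) subr_sqr normrM [leLHS]mulrC.
    apply: ler_pM => //.
      have := C2 _ _ Cx (Cy j); have := C2 _ _ Ct (Cy j).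
      rewrite ger0_norm ?addr_ge0 ?fnorm_ge0 //; lra.
    rewrite (le_trans (fnorm_dist rt _ _)) // opprB addrA subrK //.
  by rewrite -mulrA ler_wpM2r // mulr_ge0 // fnorm_ge0.
pose d n := (K + c * 4) * fnorm (y n - z) + e n.
have dc : d @ \oo --> (0 : R).
  apply: cvg0D; first exact: cvg0Z.
  have h : (fun n => c * 16^-1 ^+ n) @ \oo --> (0 : R).
    apply: cvg0Z; apply: cvg_expr.
    by rewrite ger0_norm ?invr_ge0 // invf_lt1 // ltr1n.
  apply: (cvg0_le _ h) => n; rewrite ltW //= /e /w exprS.
  rewrite (_ : 16 = 2 * 8 :> R); last by ring.
  rewrite invfM exprMn; set p := 2^-1 ^+ n; set q := 8^-1 ^+ n.
  have pq : 0 <= c * (p * q) by rewrite !mulr_ge0 ?exprn_ge0 ?invr_ge0 ?ltW.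
  by rewrite (_ : _ / 2 = c * (p * q) / 4); [lra|field].
have zmax n x : C x -> L x - D n x <= L z - D n z + d n.
  move=> Cx; have := Gmax n _ Cx; rewrite !GD => h1.
  have := le_trans (ler_norm _) (Ll _ _ (Cy n) Cz) => h2.
  have := Dlip n _ _ (Cy n) Cz; rewrite ler_norml => /andP[h3 _].
  by rewrite /d mulrDl; lra.
have D0 n x : 0 <= D n x.
  by apply: sumr_ge0 => j _; rewrite mulr_ge0 ?(nsq_ge0 rt) // ltW.
exists z; split=> //.
- move=> h Cp Cm; apply: (le_lim dc) => n.
  have h1 := zmax n _ Cp; have h2 := zmax n _ Cm.
  have Dp : D n (z + h) + D n (z - h) = 2 * D n z + 2 * (wsum n * nsq h).
    rewrite /D /wsum -big_split /= mulr_suml !mulr_sumr -big_split /=.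
    apply: eq_bigr => j _; rewrite -mulrDr.
    rewrite (_ : z + h - y j = (z - y j) + h) 1?addrAC //.
    rewrite (_ : z - h - y j = (z - y j) - h) 1?addrAC //.
    by rewrite parallelogram; ring.
  have hw : wsum n * nsq h <= c * nsq h by rewrite ler_wpM2r ?(nsq_ge0 rt).
  by have := Lp z h; lra.
- move=> x Cx; apply: (le_lim dc) => n; have h1 := zmax n _ Cx.
  have : D n x <= c * 4.
    apply: (@le_trans _ _ (wsum n * 4)); last by rewrite ler_wpM2r.
    rewrite /D /wsum mulr_suml; apply: ler_sum => j _.
    by rewrite ler_wpM2l ?C4 // ltW.
  by have := D0 n z; lra.
Qed.

End Variational.

(** * Unitarily invariant minimization in a factor *)

Section ScalarMinimum.
Variables (R : realType) (N : vonNeumannAlgebra R) (tau : {scalar N}).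
Hypothesis ht : faithful_normal_tracial_state tau.
Hypothesis factor : vn_factor N.
Implicit Types (x y z a b h u p q : N) (r : R) (C : set N).

Local Notation rt := (rtau_rtrace ht).
Local Notation nsq := (nsq (rtau tau)).
Local Notation fnorm := (fnorm (rtau tau)).


(** The minimizer is unique, hence invariant under the unitary conjugations
    that preserve the problem, hence central. *)
Lemma scalar_minimum C (chi : N -> R) (B : R) :
  complete2 tau C -> C !=set0 -> (forall x, C x -> star x = x) ->
  (forall x y, C x -> C y -> C (2^-1 *r (x + y))) ->
  (forall u x, vn_unitary u -> C x -> C (u * x * star u)) ->
  (forall x y, chi (x + y) = chi x + chi y) ->
  (forall r x, chi (r *r x) = r * chi x) ->
  (forall u x, vn_unitary u -> chi (u * x * star u) = chi x) ->
  (forall x, C x -> chi x <= B) ->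
  (forall (y : nat -> N) z, (forall n, C (y n)) -> C z ->
    (fun n => fnorm (y n - z)) @ \oo --> (0 : R) ->
    (fun n => chi (y n)) @ \oo --> chi z) ->
  exists l : R, C (l *r 1) /\
    forall z, C z -> nsq (l *r 1) - chi (l *r 1) <= nsq z - chi z.
Proof.
move=> Cc [x0 Cx0] Csa Cmid Cu chiD chiZ chiu chiB chic.
pose J z := nsq z - chi z.
have Jmid x y : J (2^-1 *r (x + y)) = 2^-1 * J x + 2^-1 * J y - 4^-1 * nsq (x - y).
  rewrite /J chiZ chiD (nsqZ rt).
  have -> : nsq (x + y) = 2 * nsq x + 2 * nsq y - nsq (x - y).
    by rewrite -(parallelogram ht); ring.
  by field.
pose V := [set - J z | z in C].
have Vs : has_sup V.
  split; first by exists (- J x0); exists x0.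
  by exists B => _ [z Cz <-]; have := chiB z Cz; have := nsq_ge0 rt z; rewrite /J; lra.
pose m := - sup V.
have mJ z : C z -> m <= J z.
  move=> Cz; have : - J z <= sup V by apply: sup_upper_bound => //; exists z.
  by rewrite /m; lra.
pose e (n : nat) : R := 8^-1 ^+ n / 4.
have e0 n : 0 < e n by rewrite /e divr_gt0 // exprn_gt0 // invr_gt0.
have eS n : e n.+1 <= e n.
  have h : 0 <= 8^-1 ^+ n :> R by rewrite exprn_ge0 // invr_ge0.
  by rewrite /e exprS; lra.
have /choice[y yP] n : exists z, C z /\ J z <= m + e n.
  have [_ [z Cz <-] hz] := sup_adherent (e0 n) Vs.
  by exists z; split=> //; rewrite /m; lra.
have Cy n : C (y n) by case: (yP n).
have [z Cz yz] : exists2 z, C z & (fun n => fnorm (y n - z)) @ \oo --> (0 : R).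
  apply: Cc => // n; have [_ h1] := yP n; have [_ h2] := yP n.+1.
  have := mJ _ (Cmid _ _ (Cy n.+1) (Cy n)); rewrite Jmid.
  have -> : 8^-1 ^+ n = 4 * e n by rewrite /e; field.
  by have := eS n; lra.
have nsqc : (fun n => nsq (y n)) @ \oo --> nsq z.
  have nyz : (fun n => fnorm (y n)) @ \oo --> fnorm z.
    apply: cvg_dist0; apply: (cvg0_le _ yz) => n.
    by rewrite normr_ge0 (fnorm_dist rt).
  rewrite (_ : (fun n => _) = fun n => fnorm (y n) * fnorm (y n)).
    by rewrite -(fnorm_sq rt z) expr2; exact: (cvgM nyz nyz).
  by apply/funext => n; rewrite -expr2 (fnorm_sq rt).
have Jz : J z <= m.
  have hJ : (fun n => J (y n)) @ \oo --> J z by apply: cvgB => //; exact: chic.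
  have hm : (fun n => m + e n) @ \oo --> m.
    rewrite -[X in _ --> X]addr0; apply: cvgD; first exact: cvg_cst.
    rewrite -[X in _ --> X](mul0r (4^-1 : R)); apply: cvgMr_tmp; apply: cvg_expr.
    by rewrite ger0_norm ?invr_ge0 // invf_lt1 // ltr1n.
  by apply: (ler_cvg_to hJ hm); apply: nearW => n; case: (yP n).
have zmin x : C x -> J z <= J x by move=> /mJ; exact: le_trans.
have zuniq x : C x -> J x = J z -> x = z.
  move=> Cx Jx; apply/eqP; rewrite -subr_eq0; apply/eqP; apply: (nsq_faithful ht).
  have := zmin _ (Cmid _ _ Cx Cz); rewrite Jmid Jx.
  by have := nsq_ge0 rt (x - z); lra.
have zc u : vn_unitary u -> z * u = u * z.
  move=> uu; have [su us] := uu.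
  have e1 : u * z * star u = z.
    apply: zuniq; first exact: Cu.
    rewrite /J chiu //; congr (_ - _).
    rewrite !nsqE.
    have -> : star (u * z * star u) * (u * z * star u) =
        u * (star z * (star u * u) * z) * star u by rewrite !starE; ncring.
    by rewrite su mulr1 (rt_comm rt) mulrA su mul1r.
  by rewrite -{1}e1 -mulrA su mulr1.
have [c zcE] := factor (unitary_comm zc).
have zl : z = (complex.Re c) *r 1.
  have sz := Csa _ Cz; rewrite -[LHS]half_add -{2}sz zcE starZ star1 -scalerDl.
  rewrite scalerA; congr (_ *: _); case: (c) => a b.
  by apply/eqP; rewrite eq_complex /= !mul0r subr0 addr0 addrN mulr0 eqxx andbT; apply/eqP; field.
exists (complex.Re c); rewrite -zl; split => // x /zmin; exact.
Qed.

Lemma closed_kernel (T : N -> N) (M : R) (y : nat -> N) z :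
  (forall a b, T (a - b) = T a - T b) -> (forall a, fnorm (T a) <= M * fnorm a) ->
  (fun n => fnorm (y n - z)) @ \oo --> (0 : R) -> (forall n, T (y n) = 0) -> T z = 0.
Proof.
move=> TB TM yz Ty; apply: (nsq_faithful ht); rewrite -(fnorm_sq rt).
suff : fnorm (T z) <= 0 by have := fnorm_ge0 (rtau tau) (T z); nra.
apply: (le_lim (cvg0Z M yz)) => n.
by rewrite add0r (le_trans _ (TM _)) // TB Ty sub0r (fnormN rt).
Qed.

Lemma ball_complete_sub (P : set N) :
  (forall (y : nat -> N) z, (forall n, P (y n)) ->
    (fun n => fnorm (y n - z)) @ \oo --> (0 : R) -> P z) ->
  complete2 tau [set x | contr x /\ P x].
Proof.
move=> hP y Cy yc; have [|z cz yz] := ball_complete ht _ yc; first by move=> n; case: (Cy n).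
by exists z => //; split=> //; apply: hP yz => n; case: (Cy n).
Qed.

Lemma closed_sa (y : nat -> N) z : (forall n, star (y n) = y n) ->
  (fun n => fnorm (y n - z)) @ \oo --> (0 : R) -> star z = z.
Proof.
move=> sy yz; apply/eqP; rewrite -subr_eq0; apply/eqP.
apply: (@closed_kernel (fun x => star x - x) 2 y) => //.
- by move=> a b; rewrite starB; ncring.
- move=> a; rewrite (le_trans (fnormB rt _ _)) // (fnorm_star rt); lra.
- by move=> n; rewrite sy subrr.
Qed.

Lemma fnorm_contr x : contr x -> fnorm x <= 1.
Proof. by move=> cx; have := fnorm_contrl rt 1 cx; rewrite mulr1 (fnorm1 rt). Qed.

Lemma contr_mid x y : contr x -> contr y -> contr (2^-1 *r (x + y)).
Proof.
move=> /contrP hx /contrP hy; apply/contrP => v; rewrite -ler_sqr ?nnegrE ?hnorm_ge0 //.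
rewrite -!rdot_norm vn_repZ rdotZl rdotZr rdot_norm vn_repD.
have h : hnorm (vn_rep x v + vn_rep y v) <= 2 * hnorm v.
  by rewrite (le_trans (hnormD _ _)) //; have := hx v; have := hy v; lra.
by have := hnorm_ge0 (vn_rep x v + vn_rep y v); rewrite rdot_norm; nra.
Qed.

(** The two-sided annihilator condition on z is unitarily invariant, so the
    element nearest to 1 that satisfies it is a scalar; it is not 0, because
    small multiples of star q * q come closer to 1 than 0 does. *)
Lemma factor_prime p q : (forall x, p * x * q = 0) -> p = 0 \/ q = 0.
Proof.
move=> pxq; have [->|/eqP q0] := pselect (q = 0); first by right.
left; pose P := [set z : N | star z = z /\ forall x, p * x * z = 0].
have Pc : complete2 tau [set z | contr z /\ P z].
  apply: ball_complete_sub => y z Py yz; split.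
    by apply: closed_sa yz => n; case: (Py n).
  move=> x; have [M M0 hM] := fnorm_bound rt (p * x).
  apply: (@closed_kernel (fun z => p * x * z) M y) => //.
  - by move=> a b; rewrite mulrBr.
  - by move=> a; case: (hM a).
  - by move=> n; case: (Py n).
have [|||||||||l [[_ [_ lP]] lmin]] :=
    @scalar_minimum [set z | contr z /\ P z] (fun z => 2 * rtau tau z) 2 Pc.
- exists 0; split; last by split; [exact: star0|move=> x; rewrite mulr0].
  by rewrite /= /contr mulr0; apply/nle0; exact: pos1.
- by move=> x [_ []].
- move=> x y [cx [sx Px]] [cy [sy Py]]; split; first exact: contr_mid.
  split; first by rewrite starZr starD sx sy.
  by move=> t; rewrite -scalerAr mulrDr Px Py addr0 scaler0.
- move=> u x uu [cx [sx Px]]; split.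
    apply: contrM; last by apply: unitary_contr; exact: unitary_star.
    by apply: contrM => //; exact: unitary_contr.
  split; first by rewrite !starE sx mulrA.
  by move=> t; rewrite !mulrA -(mulrA p) Px mul0r.
- by move=> x y; rewrite (rtD rt); ring.
- by move=> r x; rewrite (rtZ rt); ring.
- move=> u x [uu _]. by rewrite (rt_comm rt) mulrA uu mul1r.
- move=> x [cx _]; have := fnorm_contr cx; have := rt_le_fnorm rt x.
  by have := ler_norm (rtau tau x); lra.
- move=> y z _ _ yz; apply: cvgMl_tmp; apply: cvg_dist0.
  apply: (cvg0_le _ yz) => n; rewrite normr_ge0 -(rtB rt); exact: (rt_le_fnorm rt).
have := lP 1; rewrite mulr1 -scalerAr mulr1 => lp.
have [l0|ln] := eqVneq l 0; last first.
  have := congr1 (fun x => l^-1 *r x) lp.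
  by rewrite scalerr mulVf // scale1r scaler0.
(* The competitor s * star q * q has distance to 1 less than 1. *)
exfalso; pose a := star q * q; have [M M0 aM] := pos_le_scalar (pos_sa (pos_sq q)).
have ta : 0 < rtau tau a.
  rewrite lt_def (rt_pos rt (pos_sq q)) andbT; apply/eqP => h.
  by move: q0; rewrite (nsq_faithful ht h) eqxx.
pose s := M^-1; have s0 : 0 < s by rewrite invr_gt0.
have sM : s * M = 1 by rewrite mulVf // gt_eqF.
have sa : star a = a by exact: pos_sa (pos_sq q).
have taa : rtau tau (a * a) <= M * rtau tau a.
  rewrite -(rtZ rt); apply: (rt_le rt).
  have -> : nle (a * a) (M *r a) = pos (a * (M *r 1 - a)).
    by rewrite /nle mulrBr -scalerAr mulr1.
  apply: pos_comm_mul => //; first exact: pos_sq.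
  by rewrite mulrBr mulrBl -scalerAr -scalerAl mulr1 mul1r.
have : nsq (l *r 1) - 2 * rtau tau (l *r 1) <= nsq (s *r a) - 2 * rtau tau (s *r a).
  apply: lmin; split.
    apply: pos_contr; first by apply: posZ; [exact: ltW|exact: pos_sq].
    apply: (@nle_trans _ _ ((s * M) *r 1)).
      by rewrite -scalerr /nle -scalerBr; apply: posZ; [exact: ltW|].
    rewrite /nle -{1}[1](@scale1r R[i]) -scalerBlr; apply: posZ; last exact: pos1.
    by rewrite sM subrr.
  split; first by rewrite starZr sa.
  move=> x; rewrite -scalerAr /a !mulrA -(mulrA p) pxq scaler0 //.
rewrite l0 scale0r (nsq0 rt) (rt0 rt) (nsqZ rt) (rtZ rt) nsqE sa.
have : s * rtau tau (a * a) <= rtau tau a.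
  by have := ler_wpM2l (ltW s0) taa; rewrite (mulrA s) sM mul1r.
by nra.
Qed.

End ScalarMinimum.

(** * Comparison of projections *)

Section Comparison.
Variables (R : realType) (N : vonNeumannAlgebra R) (tau : {scalar N}).
Hypothesis ht : faithful_normal_tracial_state tau.
Hypothesis factor : vn_factor N.
Implicit Types (x y z a b h u p q e : N) (r : R).

Local Notation rt := (rtau_rtrace ht).
Local Notation nsq := (nsq (rtau tau)).
Local Notation fnorm := (fnorm (rtau tau)).

Lemma proj_pos p : vn_projection p -> pos p.
Proof. by move=> [pp sp]; rewrite -pp -{1}sp; exact: pos_sq. Qed.

Lemma proj_le1 p : vn_projection p -> nle p 1.
Proof.
move=> [pp sp]; rewrite /nle (_ : 1 - p = (1 - p) * (1 - p)).
  by apply: pos_sqr; rewrite starB star1 sp.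
by rewrite mulrBr mulr1 mulrBl mul1r pp subrr subr0.
Qed.

Lemma proj_compl p : vn_projection p -> vn_projection (1 - p).
Proof.
move=> [pp sp]; split; last by rewrite starB star1 sp.
by rewrite mulrBr mulr1 mulrBl mul1r pp subrr subr0.
Qed.

(** Write D = q - y y' and E = p - y' y, where y' is the adjoint of y. As
    y' D = E y', the difference of the squares of y + h and y has the form
    E W E with W small, and E E <= E. *)
Lemma corner_perturbation p q y x : vn_projection p -> vn_projection q ->
  contr y -> q * y * p = y ->
  exists2 s : R, 0 < s &
    let h := s *r ((q - y * star y) * x * (p - star y * y)) in
    contr (y + h) /\ contr (y - h).
Proof.
move=> pr_p pr_q cy qyp; have [pp sp] := pr_p; have [qq sq] := pr_q.
have yp : y * p = y by rewrite -{1}qyp -!mulrA pp mulrA.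
have qy : q * y = y by rewrite -{1}qyp !mulrA qq.
have py : p * star y = star y by rewrite -{1}sp -starM yp.
set D := q - y * star y; set E := p - star y * y.
have sD : star D = D by rewrite /D !starE sq.
have pE : pos E.
  have -> : E = p * (1 - star y * y) * p.
    by rewrite mulrBr mulr1 mulrBl pp mulrA py -mulrA yp.
  exact: pos_conjsa.
have E1 : nle E 1.
  by apply: nle_trans (proj_le1 pr_p); rewrite /nle /E opprB addrC subrK; exact: pos_sq.
have sE := pos_sa pE.
have yD : star y * D = E * star y.
  by rewrite /D /E mulrBr mulrBl py -{1}sq -starM qy !mulrA.
have Dy : D * y = y * E by apply: (can_inj (@starK _ N)); rewrite !starM sD sE yD.
pose k := star y * x + star x * y; pose g := star x * D * D * x.
have sk : star k = k by rewrite /k !starE addrC.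
have pg : pos g by rewrite /g -mulrA -{1}sD -!mulrA mulrA -starM; exact: pos_sq.
have [M1 M10 k1] := pos_le_scalar sk.
have [M2 M20 k2] : exists2 M : R, 0 < M & nle (- k) (M *r 1).
  by apply: pos_le_scalar; rewrite starN sk.
have [M3 M30 g3] := pos_le_scalar (pos_sa pg).
pose s := (M1 + M2 + M3 + 1)^-1.
have s0 : 0 < s by rewrite invr_gt0; lra.
have sM : s * (M1 + M2 + M3 + 1) = 1 by rewrite mulVf // gt_eqF //; lra.
have s1 : s <= 1 by rewrite /s invf_le1; lra.
have W k' M' : nle k' (M' *r 1) -> M' <= M1 + M2 ->
    pos (1 - s *r k' - (s ^+ 2) *r g).
  move=> kM' MM; rewrite (_ : _ - _ = s *r (M' *r 1 - k') +
      (s ^+ 2) *r (M3 *r 1 - g) + (1 - s * M' - s ^+ 2 * M3) *r 1).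
    apply: posD; first by apply: posD; apply: posZ; rewrite ?ltW ?exprn_gt0.
    apply: posZ; last exact: pos1.
    by rewrite expr2; nra.
  rewrite !scalerBr !scalerBlr !scalerr scale1r; ncring.
pose t := D * x * E.
have yt : star y * t + star t * y = E * k * E.
  rewrite /t !starM sE sD !mulrA yD -!mulrA Dy /k; ncring.
have tt : star t * t = E * g * E by rewrite /t /g !starM sE sD; ncring.
have gen (c : R) (w u v : N) : star y * w + star w * y = u -> star w * w = v ->
    star (y + c *r w) * (y + c *r w) = star y * y + c *r u + (c ^+ 2) *r v.
  move=> <- <-; rewrite starD starZr !(mulrDl, mulrDr) -!scalerAr -!scalerAl.
  by rewrite scalerr -expr2 scalerDr !addrA.
have sqE (c : R) : star (y + c *r t) * (y + c *r t) =
    star y * y + E * (c *r k) * E + E * ((c ^+ 2) *r g) * E.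
  by rewrite (gen _ _ _ _ yt tt) -!scalerAr -!scalerAl.
have fin (c : R) : pos (1 - c *r k - (c ^+ 2) *r g) -> contr (y + c *r t).
  move=> pW; have yy : star y * y = p - E by rewrite /E opprB addrC subrK.
  rewrite /contr /nle sqE yy.
  rewrite (_ : 1 - _ = (1 - p) + E * (1 - E) +
      E * (1 - c *r k - (c ^+ 2) *r g) * E); last by ncring.
  apply: posD; last exact: pos_conjsa.
  by apply: posD; [exact: proj_le1|apply: pos_comm_mul => //; ncring].
exists s => //= ; rewrite -/t; split; first by apply: fin; apply: (W k M1) => //; lra.
rewrite -scaleNlr; apply: fin; rewrite sqrrN scaleNlr -scalerN.
by apply: (W (- k) M2) => //; lra.
Qed.

Lemma closed_corner p q : complete2 tau [set y | contr y /\ q * y * p = y].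
Proof.
apply: (ball_complete_sub ht) => y z Py yz.
have [M1 M10 h1] := fnorm_bound rt q; have [M2 M20 h2] := fnorm_bound rt p.
apply/eqP; rewrite -subr_eq0; apply/eqP.
apply: (@closed_kernel _ _ _ ht (fun z => q * z * p - z) (M2 * M1 + 1) y) => //.
- by move=> a b; rewrite mulrBr mulrBl; ncring.
- move=> a; rewrite (le_trans (fnormB rt _ _)) // mulrDl mul1r lerD2r.
  have [_ h] := h2 (q * a); apply: le_trans h _; rewrite -mulrA ler_wpM2l //.
  by case: (h1 a).
- by move=> n; rewrite Py subrr.
Qed.

(** A maximizer y of the 2-norm in the unit ball of the corner q N p cannot be
    moved in the directions of the preceding lemma, which therefore all vanish;
    in a factor this makes one of D and E zero. *)
Lemma comparison p q : vn_projection p -> vn_projection q ->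
  exists y, [/\ contr y, q * y * p = y & star y * y = p \/ y * star y = q].
Proof.
move=> pr_p pr_q.
have [||||||y [[cy qyp] hmax _]] :=
    @quadratic_maximum _ _ _ ht _ nsq 2 (2^-1) (@closed_corner p q).
- by exists 0; split; [rewrite /= /contr mulr0; apply/nle0; exact: pos1|rewrite mulr0 mul0r].
- by move=> x [cx _]; exact: (fnorm_contr ht).
- by rewrite invr_gt0.
- by [].
- exact: (parallelogram ht).
- move=> x y [cx _] [cy _]; rewrite -!(fnorm_sq rt) subr_sqr normrM mulrC.
  apply: ler_pM => //; last exact: (fnorm_dist rt).
  have := fnorm_contr ht cx; have := fnorm_contr ht cy.
  by rewrite ger0_norm ?addr_ge0 ?fnorm_ge0 //; lra.
have [pp sp] := pr_p; have [qq sq] := pr_q.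
have yp : y * p = y by rewrite -{1}qyp -!mulrA pp mulrA.
have qy : q * y = y by rewrite -{1}qyp !mulrA qq.
have : forall x, (q - y * star y) * x * (p - star y * y) = 0.
  move=> x; have [s s0 /= [c1 c2]] := corner_perturbation x pr_p pr_q cy qyp.
  set h := s *r _ in c1 c2.
  have qhp : q * h * p = h.
    rewrite /h -scalerAr -scalerAl; congr (_ *: _).
    have e1 : q * (q - y * star y) = q - y * star y by rewrite mulrBr qq mulrA qy.
    have e2 : (p - star y * y) * p = p - star y * y by rewrite mulrBl pp -mulrA yp.
    by rewrite !mulrA e1 -(mulrA _ _ p) e2.
  have hh : nsq h <= 2^-1 * nsq h.
    apply: hmax; split=> //.
      by rewrite mulrDr mulrDl qyp qhp.
    by rewrite mulrBr mulrBl qyp qhp.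
  have h0 : h = 0.
    by apply: (nsq_faithful ht); have := nsq_ge0 rt h; lra.
  have := congr1 (fun x => s^-1 *r x) h0.
  by rewrite /h scalerr mulVf ?gt_eqF // scale1r scaler0.
move=> /(factor_prime ht factor)[/eqP|/eqP]; rewrite subr_eq0 eq_sym => /eqP e.
  by exists y; split=> //; right.
by exists y; split=> //; left.
Qed.

Lemma comparison_le p q : vn_projection p -> vn_projection q ->
  rtau tau p <= rtau tau q ->
  exists y, q * y * p = y /\ star y * y = p.
Proof.
move=> pr_p pr_q pq; have [y [cy qyp [yy|yy]]] := comparison pr_p pr_q.
  by exists y.
exists y; split=> //; have [pp sp] := pr_p.
have yp : y * p = y by rewrite -{1}qyp -!mulrA pp mulrA.
have py : p * star y = star y by rewrite -{1}sp -starM yp.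
have pE : pos (p - star y * y).
  have -> : p - star y * y = p * (1 - star y * y) * p.
    by rewrite mulrBr mulr1 mulrBl pp mulrA py -mulrA yp.
  exact: pos_conjsa.
apply/eqP; rewrite eq_sym -subr_eq0; apply/eqP; apply: (rtau_faithful ht pE).
have := rt_pos rt pE; rewrite (rtB rt) (rt_comm rt) yy; lra.
Qed.

End Comparison.

(** * Spectral projections *)

Section SpectralProjection.
Variables (R : realType) (N : vonNeumannAlgebra R).
Implicit Types (x y z a b m c d e : N) (r : R).

(** The iterates y_n that define the square root of x * x stay below 1 - x and
    1 + x, because (1 - x)^2 - y_n^2 is a product of commuting positive
    elements. *)
Lemma abs_exists x : star x = x -> contr x ->
  exists m, [/\ pos m, m * m = x * x, nle x m, nle (- x) m & x * m = m * x].
Proof.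
move=> sx cx; have pxx : pos (x * x) by exact: pos_sqr.
have xx1 : nle (x * x) 1 by move: cx; rewrite /contr sx.
have [m [pm mm ym mc]] := sqrt_le1 pxx xx1.
have xm : x * m = m * x by apply: mc; rewrite mulrA.
have pb : pos (1 - x * x) by [].
pose y := root_iter (1 - x * x).
have py n : pos (y n) by apply: (cone_pos pb); case: (root_iter_cone (1 - x * x) n).
have yS n : y n.+1 = 2^-1 *r ((1 - x * x) + y n * y n) by [].
have le1 z : star z = z -> contr z -> z * z = x * x -> nle z m.
  move=> sz cz zz.
  have yz n : y n * z = z * y n.
    elim: n => [|n IH]; first by rewrite mul0r mulr0.
    rewrite yS -scalerAl -scalerAr; congr (_ *: _).
    rewrite mulrDl mulrDr -(mulrA (y n)) IH (mulrA (y n)) IH -mulrA; congr (_ + _).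
    by rewrite -zz; ncring.
  have p1z : pos (1 - z) by exact: contr_sa_le.
  have yle n : nle (y n) (1 - z).
    elim: n => [|n IH]; first by apply/nle0.
    rewrite yS /nle -[1 - z]half_add -scalerBr; apply: posZ; first by rewrite invr_ge0.
    rewrite -zz (_ : _ - _ = (1 - z - y n) * (1 - z + y n)).
      have yn := yz n; apply: pos_comm_mul => //; first exact: posD.
      by rewrite !(mulrDl, mulrDr, mulrBl, mulrBr, mul1r, mulr1, mulrN, mulNr) yn; ncring.
    rewrite (_ : (1 - z - y n) * _ = (1 - z) * (1 - z) - y n * y n + (y n * z - z * y n)).
      by rewrite yz subrr addr0; ncring.
    by ncring.
  have : nle (1 - m) (1 - z).
    apply: (scvg_le (n0 := 0) ym) => // [n|]; first exact: (pos_sa (py n)).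
    by rewrite starB star1 sz.
  by rewrite /nle (_ : 1 - z - (1 - m) = m - z) //; ncring.
exists m; split=> //; first exact: le1.
by apply: le1; rewrite ?starN ?sx ?mulrNN //; exact: contrN.
Qed.

(** The projection onto the complement of the kernel of c is the limit of the
    increasing sequence 1 - (1 - c)^n. *)
Lemma support_projection c : pos c -> nle c 1 -> exists e,
  [/\ vn_projection e, c * e = c & forall d, c * d = 0 -> e * d = 0].
Proof.
move=> pc c1; pose b := 1 - c.
have pb : pos b by [].
have bc : b * c = c * b by rewrite /b; ncring.
have [|||q [bq pq qb]] := @antitone_limit _ _ (fun n => b ^+ n).
- move=> n; rewrite /nle exprSr -{1}[b ^+ n]mulr1 -mulrBr.
  apply: pos_comm_mul; first exact: pos_exp.
    by rewrite /b opprB addrC subrK.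
  by rewrite mulrBr mulrBl mulr1 mul1r -exprSr -exprS.
- by move=> n; exact: pos_exp.
- by rewrite expr0; exact: nlexx.
have bqE : b * q = q.
  apply: (scvg_unique (scvgMl b bq)); have := scvg_shift bq.
  by under eq_fun do rewrite exprS.
have bnq n : b ^+ n * q = q.
  by elim: n => [|n IH]; [rewrite expr0 mul1r|rewrite exprSr -mulrA bqE IH].
have qq : q * q = q.
  apply: (scvg_unique (scvgMr q bq)).
  by under eq_fun do rewrite bnq; exact: scvg_cst.
have cq : c * q = 0.
  have cE : c = 1 - b by rewrite /b opprB addrC subrK.
  by rewrite cE mulrBl mul1r bqE subrr.
exists (1 - q); split.
- split; last by rewrite starB star1 (pos_sa pq).
  by rewrite mulrBr mulr1 mulrBl mul1r qq subrr subr0.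
- by rewrite mulrBr mulr1 cq subr0.
- move=> d cd; have bd : b * d = d by rewrite mulrBl mul1r cd subr0.
  have bnd n : b ^+ n * d = d.
    by elim: n => [|n IH]; [rewrite expr0 mul1r|rewrite exprSr -mulrA bd IH].
  have qd : q * d = d.
    apply: (scvg_unique (scvgMr d bq)).
    by under eq_fun do rewrite bnd; exact: scvg_cst.
  by rewrite mulrBl mul1r qd subrr.
Qed.

(** The projection e is the support of the positive part c of a - t; the trace
    bound follows from c = a e - t e >= 0. *)
Lemma spectral_projection a (t : R) : pos a -> nle a 1 -> 0 < t -> t <= 1 ->
  exists e, [/\ vn_projection e, nle a (t *r 1 + e) &
    forall f, rtrace f -> t * f e <= f a].
Proof.
move=> pa a1 t0 t1; pose x := a - t *r 1.
have sx : star x = x by rewrite starB starZr star1 (pos_sa pa).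
have tx1 : nle (t *r 1) (1 : N).
  by rewrite /nle -{1}[1]scale1rr -scalerBlr; apply: posZ; [rewrite subr_ge0|exact: pos1].
have cx : contr x.
  apply: le_contr => //.
    apply: nle_trans a1; rewrite /nle /x opprB addrC subrK.
    by apply: posZ; [exact: ltW|exact: pos1].
  apply: (nle_trans _ _ tx1); rewrite /nle /x.
  by rewrite opprK addrC subrK.
have [m [pm mm xm nxm xmc]] := abs_exists sx cx.
pose c := 2^-1 *r (m + x); pose d := 2^-1 *r (m - x).
have pc : pos c.
  apply: posZ; first by rewrite invr_ge0.
  by move: nxm; rewrite /nle opprK.
have pd : pos d by apply: posZ; rewrite ?invr_ge0.
have cd : c * d = 0.
  rewrite -scalerAl -scalerAr (_ : (m + x) * (m - x) = 0) ?scaler0 //.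
  rewrite (_ : _ * _ = m * m - x * x + (x * m - m * x)); last by ncring.
  by rewrite mm xmc !subrr addr0.
have xE : x = c - d.
  by rewrite -scalerBr (_ : m + x - (m - x) = x + x) ?half_add //; ncring.
have c1 : nle c 1.
  have m1 : nle m 1.
    apply: contr_sa_le; first exact: pos_sa.
    by rewrite /contr (pos_sa pm) mm -{1}sx.
  rewrite /nle -[1]half_add -scalerBr; apply: posZ; first by rewrite invr_ge0.
  rewrite opprD addrACA; apply: posD => //; exact: contr_sa_le.
have [e [[ee se] ce ed]] := support_projection pc c1.
have ed0 := ed d cd.
have ec : e * c = c by rewrite -{1}se -{1}(pos_sa pc) -starM ce (pos_sa pc).
have de : d * e = 0 by rewrite -(pos_sa pd) -{1}se -starM ed0 star0.
exists e; split=> //.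
- apply: (nle_trans (t *r 1 + c)).
    have cE : c = x + d by rewrite xE subrK.
    by rewrite /nle (_ : _ - a = d) // cE /x; ncring.
  apply: nleD; first exact: nlexx.
  rewrite /nle (_ : e - c = e * (1 - c) * e); first exact: pos_conjsa.
  by rewrite mulrBr mulr1 mulrBl ee ec ce.
- move=> g gt; have cae : c = a * e - t *r e.
    have : x * e = c by rewrite xE mulrBl ce de subr0.
    by rewrite /x mulrBl -scalerAl mul1r.
  have h1 := rt_pos gt pc; rewrite cae (rtB gt) (rtZ gt) in h1.
  have : 0 <= g ((1 - e) * a * (1 - e)).
    by apply: (rt_pos gt); apply: pos_conjsa; rewrite ?starB ?star1 ?se.
  rewrite (rt_comm gt) mulrA (_ : (1 - e) * (1 - e) = 1 - e); last first.
    by rewrite mulrBr mulr1 mulrBl mul1r ee subrr subr0.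
  rewrite mulrBl mul1r (rtB gt) (rt_comm gt e); lra.
Qed.

End SpectralProjection.

(** * Uniqueness of the tracial state *)

Section UniqueTrace.
Variables (R : realType) (N : vonNeumannAlgebra R) (tau : {scalar N}).
Hypothesis ht : faithful_normal_tracial_state tau.
Hypothesis factor : vn_factor N.
Variable f : N -> R.
Hypothesis ft : rtrace f.
Implicit Types (x y z a b h u p q e : N) (r : R).

Local Notation rt := (rtau_rtrace ht).
Local Notation nsq := (nsq (rtau tau)).
Local Notation fnorm := (fnorm (rtau tau)).

(** As long as the trace leaves room, comparison yields one more copy of e below
    the complement of the projection built so far. *)
Lemma projection_copies e k : vn_projection e -> k%:R * rtau tau e <= 1 ->
  exists p, [/\ vn_projection p, rtau tau p = k%:R * rtau tau e &
    f p = k%:R * f e].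
Proof.
move=> pr_e; elim: k => [|k IH] ke.
  exists 0; rewrite (rt0 rt) (rt0 ft) !mul0r; split=> //.
  by split; [rewrite mulr0|exact: star0].
have te := rt_pos rt (proj_pos pr_e).
have [|p [pr_p tp fp]] := IH.
  by apply: le_trans ke; rewrite ler_wpM2r // ler_nat.
have pr_q := proj_compl pr_p; have [pp sp] := pr_p; have [ee se] := pr_e.
have [|y [qye yy]] := comparison_le ht factor pr_e pr_q.
  by rewrite (rtB rt) (rt1 rt) tp; move: ke; rewrite -natr1; lra.
have py : p * y = 0.
  by rewrite -qye !mulrA mulrBr mulr1 pp subrr !mul0r.
have ye : y * e = y by rewrite -{1}qye -mulrA ee qye.
have yp : star y * p = 0 by rewrite -sp -starM py star0.
exists (p + y * star y); split.
- split; last by rewrite !starE sp.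
  rewrite mulrDl !mulrDr pp mulrA py mul0r addr0 -(mulrA y) yp mulr0 add0r.
  by rewrite -(mulrA y) (mulrA (star y)) yy mulrA ye.
- by rewrite (rtD rt) tp (rt_comm rt) yy -natr1; ring.
- by rewrite (rtD ft) fp (rt_comm ft) yy -natr1; ring.
Qed.

Lemma projection_small e k : vn_projection e -> k%:R * rtau tau e <= 1 ->
  k%:R * f e <= 1.
Proof.
move=> pr_e ke; have [p [pr_p _ <-]] := projection_copies pr_e ke.
by rewrite -(rt1 ft); apply: (rt_le ft); exact: proj_le1.
Qed.

(** Any tracial state is small on elements of small trace: such an element is
    dominated by a small constant plus a projection that has many orthogonal
    equivalent copies. *)
Lemma trace_abs_cont (d : R) : 0 < d -> exists2 s : R, 0 < s &
  forall a, pos a -> nle a 1 -> rtau tau a <= s -> f a <= d.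
Proof.
move=> d0; pose t := Num.min (d / 2) 1.
have t0 : 0 < t by rewrite lt_min ltr01 divr_gt0.
have t1 : t <= 1 by rewrite ge_min lexx orbT.
have td : t <= d / 2 by rewrite ge_min lexx.
have [k kd] : exists k : nat, 2 / d < k.+1%:R.
  exists (Num.trunc (2 / d)); exact: truncnS_gt.
have k0 : 0 < k.+1%:R :> R by rewrite ltr0n.
exists (t / k.+1%:R); first by rewrite divr_gt0.
move=> a pa a1; rewrite ler_pdivlMr // => ta.
have [e [pr_e ae he]] := spectral_projection pa a1 t0 t1.
have te := he _ rt.
have ke : k.+1%:R * rtau tau e <= 1.
  rewrite -(ler_pM2l t0) mulr1; apply: le_trans ta.
  by rewrite mulrCA mulrC ler_wpM2r // ltW.
have fe := projection_small pr_e ke.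
have := rt_le ft ae; rewrite (rtD ft) (rtZ ft) (rt1 ft) mulr1.
have : f e <= d / 2.
  rewrite -(ler_pM2l k0) (le_trans fe) //.
  by move: kd; rewrite ltr_pdivrMr // => kd; nra.
lra.
Qed.

Lemma trace_continuous (y : nat -> N) z : (forall n, contr (y n)) -> contr z ->
  (fun n => fnorm (y n - z)) @ \oo --> (0 : R) ->
  (fun n => f (y n)) @ \oo --> f z.
Proof.
move=> cy cz yz; apply/cvgrPdist_lt => d d0.
have d2 : 0 < (d / 4) ^+ 2 by rewrite exprn_gt0 // divr_gt0.
have [s s0 hs] := trace_abs_cont d2.
have ss : 0 < Num.sqrt s by rewrite sqrtr_gt0.
have /cvgrPdist_lt/(_ _ ss) := yz; apply: filterS => n.
rewrite sub0r normrN ger0_norm ?fnorm_ge0 // => hn.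
set x := y n - z in hn *.
have h : f (4^-1 *r (star x * x)) <= (d / 4) ^+ 2.
  apply: hs.
  - by apply: posZ; [rewrite invr_ge0|exact: pos_sq].
  - have := contr_sub_sq (cy n) cz; rewrite -/x /nle => hx.
    rewrite (_ : 1 - _ = 4^-1 *r (4 *r 1 - star x * x)).
      by apply: posZ => //; rewrite invr_ge0.
    by rewrite scalerBr scalerr mulVf // scale1r.
  - rewrite (rtZ rt) -[rtau tau _]/(nsq x) -(fnorm_sq rt).
    rewrite -(sqr_sqrtr (ltW s0)).
    have : fnorm x ^+ 2 <= Num.sqrt s ^+ 2.
      by rewrite ler_sqr ?nnegrE ?fnorm_ge0 ?ltW.
    by have := nsq_ge0 rt x; rewrite -(fnorm_sq rt); lra.
rewrite (rtZ ft) in h; have := rt_sq_le ft x; rewrite nsqE => h2.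
rewrite -normrN opprB -(rtB ft) -/x -ltr_sqr ?nnegrE ?normr_ge0 ?(ltW d0) //.
rewrite real_normK ?num_real //.
have : (d / 4) ^+ 2 = d ^+ 2 / 16 by field.
have : 0 < d ^+ 2 by rewrite exprn_gt0.
lra.
Qed.

(** The minimizer of nsq z - f z on the self-adjoint unit ball is a scalar, so it
    is 1/2, and the first order condition there says that f is the trace. *)
Lemma unique_trace x : f x = rtau tau x.
Proof.
pose C : set N := [set z | contr z /\ star z = z].
have Cc : complete2 tau C by apply: (ball_complete_sub ht) => y z; exact: (closed_sa ht).
have [|||||||||l [Cl lmin]] := @scalar_minimum _ _ _ ht factor C f 1 Cc.
- by exists 0; split; [rewrite /= /contr mulr0; apply/nle0; exact: pos1|exact: star0].
- by move=> z [].
- move=> a b [ca sa] [cb sb]; split; first exact: contr_mid.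
  by rewrite starZr starD sa sb.
- move=> u a uu [ca sa]; split; last by rewrite !starE sa mulrA.
  apply: contrM; last by apply: unitary_contr; exact: unitary_star.
  by apply: contrM => //; exact: unitary_contr.
- exact: (rtD ft).
- exact: (rtZ ft).
- by move=> u a [uu _]; rewrite (rt_comm ft) mulrA uu mul1r.
- move=> a [ca sa]; rewrite -(rt1 ft); apply: (rt_le ft); exact: contr_sa_le.
- by move=> y z Cy [cz _]; apply: trace_continuous => // n; case: (Cy n).
have halfC (t : R) h : star h = h -> contr h -> `|t| <= 2^-1 -> C (2^-1 *r 1 + t *r h).
  move=> sh ch t2; split; last by rewrite starD !starZr star1 sh.
  apply/contrP => v; move/contrP/(_ v): ch => hv.
  rewrite vn_repD (le_trans (hnormD _ _)) //.
  have hZ (r : R) w : hnorm (r *r w : vn_space N) = `|r| * hnorm w.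
    apply: complexI; rewrite -normE normrZ normE rmorphM /=; congr (_ * _).
    by rewrite normc_def /= expr0n addr0 sqrtr_sqr.
  rewrite !vn_repZ vn_rep1 !hZ (ger0_norm (_ : 0 <= 2^-1)) ?invr_ge0 //.
  have := hnorm_ge0 v; have := hnorm_ge0 (vn_rep h v); have := normr_ge0 t.
  nra.
have half t h := halfC t h.
have l2 : l = 2^-1.
  have h0 : C (2^-1 *r 1 + 0 *r 1).
    by apply: half; rewrite ?star1 ?normr0 ?invr_ge0 //; exact: contr1.
  have := lmin _ h0; rewrite scale0r addr0 !(nsqZ rt) !(rtZ ft) (rt1 ft) (nsq1 rt).
  rewrite !mulr1 => h; apply/eqP; rewrite -subr_eq0 -sqrf_eq0 eq_le sqr_ge0 andbT.
  have -> : (l - 2^-1) ^+ 2 = (l ^+ 2 - l) - ((2^-1) ^+ 2 - 2^-1) by field.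
  by rewrite subr_le0.
have sa_case h : star h = h -> contr h -> f h = rtau tau h.
  move=> sh ch; pose D := rtau tau h - f h.
  have nh : nsq h <= 1.
    by rewrite -(fnorm_sq rt); have := fnorm_contr ht ch;
      have := fnorm_ge0 (rtau tau) h; nra.
  have ineq t : `|t| <= 2^-1 -> 0 <= t * D + t ^+ 2 * nsq h.
    move=> t2; have := lmin _ (half t h sh ch t2); rewrite l2.
    rewrite (nsqD rt) (rtD ft) !(rtZ ft) !(nsqZ rt) (rt1 ft) (nsq1 rt).
    rewrite (ipC rt) !(ipE rt) ip1 /D; lra.
  have D2 : `|D| <= 2.
    have h1 := rt_le_fnorm rt h; have h2 := fnorm_contr ht ch.
    have h3 : `|f h| <= 1.
      rewrite ler_norml; apply/andP; split.
        rewrite -(rt1 ft) lerNl -(rtN ft); apply: (rt_le ft).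
        by apply: contr_sa_le; [rewrite starN sh|exact: contrN].
      by rewrite -(rt1 ft); apply: (rt_le ft); exact: contr_sa_le.
    by rewrite (le_trans (ler_normB _ _)) //; lra.
  have := ineq (- (D / 4)); rewrite normrN normrM (ger0_norm (_ : 0 <= 4^-1)) ?invr_ge0 //.
  have dd : `|D| / 4 <= 2^-1 by lra.
  move=> /(_ dd) h1; have D0 : D ^+ 2 <= 0 by have := nsq_ge0 rt h; nra.
  have : D = 0 by apply/eqP; rewrite -sqrf_eq0 eq_le D0 sqr_ge0.
  by rewrite /D; lra.
have sa2 h : star h = h -> f h = rtau tau h.
  move=> sh; have [K K0 ch] := contr_scale h.
  have := sa_case (K^-1 *r h); rewrite starZr sh => /(_ erefl ch).
  rewrite (rtZ ft) (rtZ rt) => /(congr1 ( *%R K)).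
  by rewrite !mulrA mulfV ?gt_eqF // !mul1r.
have := sa2 (2^-1 *r (x + star x)); rewrite starZr starD starK addrC => /(_ erefl).
rewrite (rtZ ft) (rtZ rt) (rtD ft) (rtD rt) (rt_star ft) (rt_star rt); lra.
Qed.

End UniqueTrace.

(** * Almost central vectors along an ultrafilter *)

Section UltraLimits.
Variables (R : realType) (N : vonNeumannAlgebra R) (tau : {scalar N}).
Hypothesis ht : faithful_normal_tracial_state tau.
Hypothesis factor : vn_factor N.
Variables (I : Type) (U : set_system I).
Hypothesis uU : UltraFilter U.
Let pU : ProperFilter U := @ultra_proper _ _ uU.
Local Existing Instance pU.
Implicit Types (a b : N) (r : R).

Local Notation rt := (rtau_rtrace ht).
Local Notation nsq := (nsq (rtau tau)).
Local Notation fnorm := (fnorm (rtau tau)).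

Lemma bounded_ultra_cvg (phi : I -> R) (M : R) : (forall j, `|phi j| <= M) ->
  exists l : R, phi @ U --> l.
Proof.
move=> hM; have phiM : U [set j | `[- M, M]%classic (phi j)].
  by apply: (filterS _ (@filterT _ U _)) => j _ /=; rewrite in_itv /= -ler_norml.
have [l [_ lP]] := @segment_compact R (- M) M (phi @ U) _ phiM.
exists l => V Vl; have [//|nV] := in_ultra_setVsetC (phi @^-1` V) uU.
by have [t [nt Vt]] := lP (~` V) V nV Vl.
Qed.

Lemma rtau_mul_le a b : `|rtau tau (a * b)| <= fnorm a * fnorm b.
Proof.
have -> : rtau tau (a * b) = ip (rtau tau) b (star a) by rewrite /ip starK.
by rewrite (le_trans (CS_fnorm rt _ _)) // (fnorm_star rt) mulrC.
Qed.

Variable x : I -> N.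
Hypothesis x_sa : forall j, star (x j) = x j.
Hypothesis x_nsq : forall j, nsq (x j) = 1.
Hypothesis x_central : forall a, fnorm (x j * a - a * x j) @[j --> U] --> (0 : R).

Lemma x_fnorm j : fnorm (x j) = 1.
Proof. by rewrite fnormE x_nsq sqrtr1. Qed.

(** The vector states of x j become tracial in the limit, hence converge to the
    unique tracial state. *)
Lemma central_trace_cvg a : rtau tau (x j * a * x j) @[j --> U] --> rtau tau a.
Proof.
have bnd b : exists M : R, forall j, `|rtau tau (x j * b * x j)| <= M.
  have [M M0 hM] := fnorm_bound rt b; exists M => j.
  rewrite -mulrA (le_trans (rtau_mul_le _ _)) // x_fnorm mul1r.
  by have [] := hM (x j); rewrite x_fnorm mulr1.
have ex b : exists l : R, rtau tau (x j * b * x j) @[j --> U] --> l.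
  by have [M hM] := bnd b; exact: bounded_ultra_cvg hM.
have /choice[f hf] := ex.
suff ft : rtrace f by rewrite -(unique_trace ht factor ft); exact: hf.
split.
- move=> b c; apply: (rcvg_unique (hf (b + c))).
  apply: (cvg_ext _ (cvgD (hf b) (hf c))) => j.
  by rewrite mulrDr mulrDl (rtD rt).
- move=> r b; apply: (rcvg_unique (hf (r *r b))).
  apply: (cvg_ext _ (cvgMl_tmp (a := r) (hf b))) => j.
  by rewrite -scalerAr -scalerAl (rtZ rt).
- move=> b pb; have c0 : (fun=> 0 : R) @ U --> (0 : R) by exact: cvg_cst.
  apply: (rcvg_le c0 (hf b)) => j.
  by apply: (rt_pos rt); exact: pos_conjsa.
- move=> b c; apply/eqP; rewrite -subr_eq0; apply/eqP.
  have hd : rtau tau (x j * (b * c) * x j) - rtau tau (x j * (c * b) * x j)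
    @[j --> U] --> f (b * c) - f (c * b) by exact: (cvgB (hf _) (hf _)).
  apply: (rcvg_unique hd); apply: norm_cvg0.
  have [Mb Mb0 hb] := fnorm_bound rt b; have [Mc Mc0 hc] := fnorm_bound rt c.
  have k : Mb * fnorm (x j * c - c * x j) + Mc * fnorm (x j * b - b * x j)
     @[j --> U] --> (0 : R).
    by apply: cvg0D; apply: cvg0Z.
  apply: (cvg0_le _ k) => j; rewrite normr_ge0 /=.
  have -> : x j * (b * c) * x j = (x j * b) * (c * x j) by rewrite !mulrA.
  have -> : x j * (c * b) * x j = (x j * c) * (b * x j) by rewrite !mulrA.
  rewrite (rt_comm rt (x j * b)).
  have -> : rtau tau (c * x j * (x j * b)) - rtau tau (x j * c * (b * x j)) =
      rtau tau ((c * x j - x j * c) * (x j * b)) +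
      rtau tau ((x j * c) * (x j * b - b * x j)).
    by rewrite mulrBl mulrBr !(rtB rt); ring.
  rewrite (le_trans (ler_normD _ _)) // lerD // (le_trans (rtau_mul_le _ _)) //.
    rewrite (fnormC rt) mulrC ler_wpM2r ?fnorm_ge0 //.
    by have [_] := hb (x j); rewrite x_fnorm mulr1.
  rewrite ler_wpM2r ?fnorm_ge0 //.
  by have [_] := hc (x j); rewrite x_fnorm mulr1.
- move=> b; apply: (rcvg_unique (hf (star b))).
  apply: (cvg_ext _ (hf b)) => j.
  by rewrite -(rt_star rt) !starE x_sa mulrA.
- apply: (rcvg_unique (hf 1)); apply: (@cvg_ext _ _ _ (fun=> 1)) => [j|].
    by rewrite mulr1 -(x_nsq j) nsqE x_sa.
  exact: cvg_cst.
Qed.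

Lemma central_fnorm_cvg b : fnorm (b * x j) @[j --> U] --> fnorm b.
Proof.
have h := @central_trace_cvg (star b * b).
apply: continuous_cvg; first exact: sqrt_continuous.
by apply: (cvg_ext _ h) => j; rewrite nsqE starM x_sa !mulrA.
Qed.

(** If y behaves like b x, then its 2-norm converges to the 2-norm of b. *)
Lemma central_fnorm_near b (y : I -> N) :
  fnorm (y j - b * x j) @[j --> U] --> (0 : R) -> fnorm (y j) @[j --> U] --> fnorm b.
Proof.
move=> h; apply: cvg_dist0.
have k : fnorm (y j - b * x j) + `|fnorm (b * x j) - fnorm b| @[j --> U] --> (0 : R).
  apply: cvg0D => //; exact: (dist0_cvg (@central_fnorm_cvg b)).
apply: (cvg0_le _ k) => j; rewrite normr_ge0 /=.
rewrite (le_trans (ler_distD (fnorm (b * x j)) _ _)) // lerD2r.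
exact: (fnorm_dist rt).
Qed.

(** Since x almost commutes with everything, conjugating it by g amounts to
    multiplying it by g g. *)
Lemma central_conj g : fnorm (g * x j * g - g * g * x j) @[j --> U] --> (0 : R).
Proof.
have [M M0 hM] := fnorm_bound rt g.
have k : M * fnorm (x j * g - g * x j) @[j --> U] --> (0 : R).
  exact: cvg0Z.
apply: (cvg0_le _ k) => j; rewrite fnorm_ge0 /= -!mulrA -mulrBr.
by have [] := hM (x j * g - g * x j).
Qed.

Lemma central_conj_comm a g :
  fnorm (a * (g * x j * g) - g * x j * g * a) @[j --> U] -->
  fnorm (a * (g * g) - g * g * a).
Proof.
apply: central_fnorm_near.
have [M M0 hM] := fnorm_bound rt (a * g); have [K K0 hK] := fnorm_bound rt g.
have k : M * fnorm (x j * g - g * x j) + K * fnorm (x j * (g * a) - (g * a) * x j)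
    @[j --> U] --> (0 : R).
  by apply: cvg0D; apply: cvg0Z.
apply: (cvg0_le _ k) => j; rewrite fnorm_ge0 /=.
have -> : a * (g * x j * g) - g * x j * g * a - (a * (g * g) - g * g * a) * x j =
  a * g * (x j * g - g * x j) - g * (x j * (g * a) - (g * a) * x j).
  by rewrite !mulrBr !mulrBl !mulrA; ncring.
rewrite (le_trans (fnormB rt _ _)) // lerD //.
  by case: (hM (x j * g - g * x j)).
by case: (hK (x j * (g * a) - g * a * x j)).
Qed.

Lemma central_conj_morph (s : {lrmorphism N -> N}) g :
  fnorm (s (x j) - x j) @[j --> U] --> (0 : R) ->
  fnorm (s (g * x j * g) - g * x j * g) @[j --> U] --> fnorm (s (g * g) - g * g).
Proof.
move=> hs; apply: central_fnorm_near.
have [M M0 hM] := fnorm_bound rt (s g); have [K K0 hK] := fnorm_bound rt g.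
have k : M * (M * fnorm (s (x j) - x j)) + M * fnorm (x j * s g - s g * x j) +
    K * fnorm (x j * g - g * x j) @[j --> U] --> (0 : R).
  by apply: cvg0D; [apply: cvg0D|]; do !apply: cvg0Z.
apply: (cvg0_le _ k) => j; rewrite fnorm_ge0 /=.
have -> : s (g * x j * g) - g * x j * g - (s (g * g) - g * g) * x j =
    s g * ((s (x j) - x j) * s g) + s g * (x j * s g - s g * x j) -
    g * (x j * g - g * x j).
  by rewrite !rmorphM; ncring.
rewrite (le_trans (fnormB rt _ _)) // lerD //; last first.
  by case: (hK (x j * g - g * x j)).
rewrite (le_trans (fnormD rt _ _)) // lerD //; last first.
  by case: (hM (x j * s g - s g * x j)).
have [h1 _] := hM ((s (x j) - x j) * s g); apply: le_trans h1 _.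
by rewrite ler_wpM2l //; case: (hM (s (x j) - x j)).
Qed.

End UltraLimits.

(** * The action and the nets *)

Section Action.
Variables (R : realType) (N : vonNeumannAlgebra R) (tau : {scalar N}).
Variables (Gamma : groupType) (sigma : Gamma -> {lrmorphism N -> N}).
Hypothesis ht : faithful_normal_tracial_state tau.
Hypothesis factor : vn_factor N.
Hypothesis act : vn_action sigma.
Implicit Types (x y z a b u v h : N) (g : Gamma) (r : R).

Local Notation rt := (rtau_rtrace ht).
Local Notation nsq := (nsq (rtau tau)).
Local Notation fnorm := (fnorm (rtau tau)).
Local Notation i := ('i%C : R[i]).

Lemma action_pos g x : pos x -> pos (sigma g x).
Proof.
move=> /pos_vn_positive[y ->]; rewrite rmorphM /= (action_star act); exact: pos_sq.
Qed.

Lemma action_trace g x : rtau tau (sigma g x) = rtau tau x.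
Proof.
apply: (unique_trace ht factor (f := fun x => rtau tau (sigma g x))); split.
- by move=> y z; rewrite linearD (rtD rt).
- by move=> r y; rewrite linearZ (rtZ rt).
- by move=> y py; apply: (rt_pos rt); exact: action_pos.
- by move=> y z; rewrite !rmorphM (rt_comm rt).
- by move=> y; rewrite (action_star act) (rt_star rt).
- by rewrite rmorph1 (rt1 rt).
Qed.

Lemma action_fnorm g x : fnorm (sigma g x) = fnorm x.
Proof. by rewrite !fnormE !nsqE -(action_star act) -rmorphM action_trace. Qed.

Lemma action_contr g x : contr x -> contr (sigma g x).
Proof.
rewrite /contr /nle => cx; rewrite -(action_star act) -rmorphM -(rmorph1 (sigma g)).
by rewrite -rmorphB; exact: action_pos.
Qed.

(** Finite subsets of the algebra and of the group, and a precision. *)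
Definition idx := (seq N * seq Gamma * nat)%type.

Definition idx_le (j k : idx) :=
  [/\ {subset j.1.1 <= k.1.1}, {subset j.1.2 <= k.1.2} & (j.2 <= k.2)%N].

Lemma idx_directed : directed_preorder idx_le.
Proof.
split.
- by constructor; exact: ([::], [::], 0%N).
- by move=> j; split.
- move=> j k l [h1 h2 h3] [k1 k2 k3]; split; last exact: leq_trans k3.
    by move=> a /h1 /k1.
  by move=> a /h2 /k2.
- move=> j k; exists (j.1.1 ++ k.1.1, j.1.2 ++ k.1.2, maxn j.2 k.2).
  split; split=> /=; rewrite ?leq_maxl ?leq_maxr //.
  + by move=> a aj; rewrite mem_cat aj.
  + by move=> a aj; rewrite mem_cat aj.
  + by move=> a aj; rewrite mem_cat aj orbT.
  + by move=> a aj; rewrite mem_cat aj orbT.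
Qed.

Lemma inv_small (e : R) : 0 < e -> exists n : nat, n.+1%:R^-1 < e.
Proof.
move=> e0; exists (Num.trunc e^-1); rewrite -[ltRHS]invrK ltf_pV2 ?posrE ?invr_gt0 ?ltr0n //.
exact: truncnS_gt.
Qed.

(** Otherwise counterexamples, indexed by the finite data that they satisfy,
    form a net that contradicts the hypothesis. *)
Lemma bounded_gap (e : R) :
  (forall (I : Type) (le : I -> I -> Prop) (x : I -> N),
    directed_preorder le -> (exists M : R, forall j, opnorm_le (x j) M) ->
    (forall a, norm2 tau (x j * a - a * x j) @[j --> net_filter le] --> (0 : R)) ->
    (forall g, norm2 tau (sigma g (x j) - x j) @[j --> net_filter le] --> (0 : R)) ->
    norm2 tau (x j - (tau (x j))%:A) @[j --> net_filter le] --> (0 : R)) ->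
  0 < e -> exists (F : seq N) (G : seq Gamma) (d : R), 0 < d /\
    forall y, contr y -> (forall a, a \in F -> fnorm (a * y - y * a) <= d) ->
      (forall g, g \in G -> fnorm (sigma g y - y) <= d) ->
      fnorm (y - (tau y)%:A) <= e.
Proof.
move=> full e0; apply: contrapT => H.
have /choice[y yP] (j : idx) : exists y, [/\ contr y,
    (forall a, a \in j.1.1 -> fnorm (a * y - y * a) <= j.2.+1%:R^-1),
    (forall g, g \in j.1.2 -> fnorm (sigma g y - y) <= j.2.+1%:R^-1) &
    e < fnorm (y - (tau y)%:A)].
  apply: contrapT => K; apply: H; exists j.1.1, j.1.2, j.2.+1%:R^-1.
  split; first by rewrite invr_gt0 ltr0n.
  move=> y cy ya yg; rewrite leNgt; apply/negP => ey; apply: K.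
  by exists y; split.
have : norm2 tau (y j - (tau (y j))%:A) @[j --> net_filter idx_le] --> (0 : R).
  apply: full; first exact: idx_directed.
  - exists 1 => j w; rewrite !normE -rmorphM lecR mul1r.
    by have [/contrP h _ _ _] := yP j; exact: h.
  - move=> a; apply/net_cvg0P => d /inv_small[n nd].
    exists ([:: a], [::], n) => j [ja _ jn].
    have [_ h _ _] := yP j; rewrite norm2E ger0_norm ?fnorm_ge0 // (fnormC rt).
    apply: le_lt_trans (h a _) _; first by apply: ja; rewrite mem_head.
    by apply: le_lt_trans nd; rewrite lef_pV2 ?posrE ?ltr0n // ler_nat.
  - move=> g; apply/net_cvg0P => d /inv_small[n nd].
    exists ([::], [:: g], n) => j [_ jg jn].
    have [_ _ h _] := yP j; rewrite norm2E ger0_norm ?fnorm_ge0 //.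
    apply: le_lt_trans (h g _) _; first by apply: jg; rewrite mem_head.
    by apply: le_lt_trans nd; rewrite lef_pV2 ?posrE ?ltr0n // ler_nat.
move=> /net_cvg0P/(_ _ e0)[j0 /(_ j0)].
have [_ h2 _ _] := idx_directed; move=> /(_ (h2 j0)).
have [_ _ _ ey] := yP j0; rewrite norm2E ger0_norm ?fnorm_ge0 //.
by move=> /(lt_trans ey); rewrite ltxx.
Qed.

Lemma sum_term_le (T : eqType) (s : seq T) (phi : T -> R) t :
  (forall t, 0 <= phi t) -> t \in s -> phi t <= \sum_(k <- s) phi k.
Proof.
move=> p0; elim: s => // k s IH; rewrite inE big_cons => /orP[/eqP->|/IH h].
  by rewrite lerDl sumr_ge0.
by rewrite (le_trans h) // lerDr.
Qed.

Lemma nsq_i x : nsq (i *: x) = nsq x.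
Proof.
by rewrite !nsqE starZ conj_i -scalerAl -scalerAr scalerA mulNr -expr2 sqr_i opprK scale1r.
Qed.

Lemma fnorm_i x : fnorm (i *: x) = fnorm x.
Proof. by rewrite !fnormE nsq_i. Qed.

Lemma nsq_sa_decomp a b : star a = a -> star b = b ->
  nsq (a + i *: b) = nsq a + nsq b.
Proof.
move=> sa sb; rewrite (nsqD rt) nsq_i.
suff : ip (rtau tau) a (i *: b) = 0 by move=> ->; rewrite mulr0 addr0.
have h1 : ip (rtau tau) a (i *: b) = - rtau tau (i *: (b * a)).
  by rewrite /ip starZ conj_i sb -scalerAl scaleNr (rtN rt).
have h2 : ip (rtau tau) a (i *: b) = rtau tau (i *: (b * a)).
  rewrite (ipC rt) /ip sa -scalerAr /rtau !linearZ /= (state_trace ht a b) //.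
by lra.
Qed.

Lemma comm_star_fnorm u x :
  fnorm (u * star x - star x * u) = fnorm (star u * x - x * star u).
Proof.
by rewrite -(fnorm_star rt) starB !starM !starK (fnormC rt).
Qed.

(** Up to the factor i, the elements 2 a and 2 b are the sum and the difference
    of z and star z. *)
Lemma gap_sa_part z (T : N -> N) (B : R) a b : star a = a -> star b = b ->
  z = a + i *: b -> (forall x y, T (x + y) = T x + T y) ->
  (forall (c : R[i]) x, T (c *: x) = c *: T x) ->
  fnorm (T z) <= B -> fnorm (T (star z)) <= B -> fnorm (T a) <= B /\ fnorm (T b) <= B.
Proof.
move=> sa sb zE TD TZ h1 h2.
have szE : star z = a - i *: b by rewrite zE starD starZ conj_i sa sb scaleNr.
have TN x : T (- x) = - T x by rewrite -scaleN1r TZ scaleN1r.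
have B2 : fnorm (T z) + fnorm (T (star z)) <= 2 * B by lra.
split.
  have : fnorm (T z + T (star z)) <= 2 * B by exact: le_trans (fnormD rt _ _) B2.
  rewrite -TD szE zE addrACA subrr addr0 TD -(scale1rr (T a)) -scalerDlr.
  by rewrite (fnormZ rt) ger0_norm ?addr_ge0 ?ler01 // scale1r; lra.
have : fnorm (T z - T (star z)) <= 2 * B by exact: le_trans (fnormB rt _ _) B2.
rewrite -TN -TD szE zE.
rewrite (_ : a + i *: b - (a - i *: b) = i *: b + i *: b); last by ncring.
rewrite -scalerDr TZ fnorm_i TD.
by rewrite -(scale1rr (T b)) -scalerDlr (fnormZ rt) ger0_norm ?addr_ge0 ?ler01 //
  scale1r; lra.
Qed.

(** The spectral gap inequality fails for the given finite data with constant
    2 (n + 1). The real or the imaginary part of the centered counterexample has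
    at least half of its squared 2-norm, so normalizing that part costs a factor
    at most 2. *)
Lemma no_gap_vector :
  ~ (exists (S : {fset N}) (K : {fset Gamma}) (kappa : R),
    [/\ forall u : N, u \in S -> vn_unitary u,
        0 < kappa &
        forall x : N,
          norm2 tau (x - (tau x)%:A) <=
            kappa * (\sum_(u <- S) norm2 tau (u * x - x * u) +
                     \sum_(g <- K) norm2 tau (sigma g x - x))]) ->
  forall j : idx, exists x, [/\ star x = x, rtau tau x = 0, nsq x = 1,
    (forall u, u \in j.1.1 -> vn_unitary u -> fnorm (x * u - u * x) <= j.2.+1%:R^-1) &
    (forall g, g \in j.1.2 -> fnorm (sigma g x - x) <= j.2.+1%:R^-1)].
Proof.
move=> nogap j.
pose S := [fset u in [seq u <- j.1.1 ++ map (@star _ N) j.1.1 | `[< vn_unitary u >]]]%fset.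
pose K := [fset g in j.1.2]%fset.
pose k : R := 2 * j.2.+1%:R; have k0 : 0 < k by rewrite mulr_gt0 // ltr0n.
have SU u : u \in S -> vn_unitary u.
  by rewrite !inE /= mem_filter => /andP[/asboolP].
have [x hx] : exists x, k * (\sum_(u <- S) fnorm (u * x - x * u) +
    \sum_(g <- K) fnorm (sigma g x - x)) < fnorm (x - (tau x)%:A).
  apply: contrapT => /forallNP h; apply: nogap; exists S, K, k; split=> // x.
  by rewrite leNgt; apply/negP; exact: h.
set z := x - (tau x)%:A in hx; set B := (_ + _) in hx.
have B10 : 0 <= \sum_(u <- S) fnorm (u * x - x * u).
  by apply: sumr_ge0 => u _; exact: fnorm_ge0.
have B20 : 0 <= \sum_(g <- K) fnorm (sigma g x - x).
  by apply: sumr_ge0 => g _; exact: fnorm_ge0.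
have zu u : u * z - z * u = u * x - x * u.
  rewrite /z mulrBr mulrBl -scalerAr -scalerAl mulr1 mul1r; ncring.
have zg g : sigma g z - z = sigma g x - x.
  by rewrite /z rmorphB /= rmorph_alg; ncring.
have hSB u : u \in S -> fnorm (u * z - z * u) <= B.
  move=> uS; rewrite zu /B -[leLHS]addr0 lerD //.
  by apply: (@sum_term_le _ S (fun u => fnorm (u * x - x * u))) => // t; exact: fnorm_ge0.
have hKB g : g \in K -> fnorm (sigma g z - z) <= B.
  move=> gK; rewrite zg /B -[leLHS]add0r lerD //.
  by apply: (@sum_term_le _ K (fun g => fnorm (sigma g x - x))) => // t; exact: fnorm_ge0.
have tz : tau z = 0 by rewrite /z linearB linearZ /= (state1 ht) mulr1 subrr.
have [a [b [sa sb zE]]] := sa_decomp z.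
have [ta tb] : rtau tau a = 0 /\ rtau tau b = 0.
  have := tz; rewrite zE linearD linearZ /= /rtau.
  have := tau_real ht sa; have := tau_real ht sb.
  case: (tau a) (tau b) => [a1 a2] [b1 b2] /= -> -> /eqP.
  rewrite eq_complex /= => /andP[/eqP h1 /eqP h2]; split; lra.
have ab := nsq_sa_decomp sa sb; rewrite -zE in ab.
have starS u : u \in j.1.1 -> vn_unitary u -> u \in S /\ star u \in S.
  move=> uj uu; rewrite !inE /= !mem_filter !mem_cat uj map_f //=.
  by rewrite orbT !andbT; split; apply/asboolP => //; exact: unitary_star.
have comT u : u \in j.1.1 -> vn_unitary u ->
    fnorm (a * u - u * a) <= B /\ fnorm (b * u - u * b) <= B.
  move=> uj uu; have [uS suS] := starS u uj uu.
  apply: (gap_sa_part (T := fun x => x * u - u * x) sa sb zE).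
  - by move=> p q; rewrite mulrDl mulrDr; ncring.
  - by move=> c p; rewrite -scalerAl -scalerAr scalerBr.
  - by rewrite (fnormC rt); exact: hSB.
  - by rewrite (fnormC rt) comm_star_fnorm; exact: hSB.
have actT g : g \in j.1.2 -> fnorm (sigma g a - a) <= B /\ fnorm (sigma g b - b) <= B.
  move=> gj; have gK : g \in K by rewrite !inE.
  apply: (gap_sa_part (T := fun x => sigma g x - x) sa sb zE).
  - by move=> p q; rewrite linearD; ncring.
  - by move=> c p; rewrite linearZ scalerBr.
  - exact: hKB.
  - by rewrite (action_star act) -starB (fnorm_star rt); exact: hKB.
have fin w : star w = w -> rtau tau w = 0 -> nsq z <= 2 * nsq w ->
    (forall u, u \in j.1.1 -> vn_unitary u -> fnorm (w * u - u * w) <= B) ->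
    (forall g, g \in j.1.2 -> fnorm (sigma g w - w) <= B) ->
    exists x, [/\ star x = x, rtau tau x = 0, nsq x = 1,
    (forall u, u \in j.1.1 -> vn_unitary u -> fnorm (x * u - u * x) <= j.2.+1%:R^-1) &
    (forall g, g \in j.1.2 -> fnorm (sigma g x - x) <= j.2.+1%:R^-1)].
  move=> sw tw zw wu wg.
  have B0 : 0 <= B by exact: addr_ge0.
  have z0 : 0 < fnorm z by apply: le_lt_trans hx; rewrite mulr_ge0 // ltW.
  have fw : fnorm z <= 2 * fnorm w.
    rewrite -ler_sqr ?nnegrE ?mulr_ge0 ?fnorm_ge0 // exprMn !(fnorm_sq rt).
    by have := nsq_ge0 rt w; lra.
  have w0 : 0 < fnorm w by lra.
  have wV : 0 <= (fnorm w)^-1 by rewrite invr_ge0 ltW.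
  have j0 : 0 < j.2.+1%:R :> R by rewrite ltr0n.
  have key : (fnorm w)^-1 * B <= j.2.+1%:R^-1.
    rewrite mulrC ler_pdivrMr // mulrC ler_pdivlMr //.
    by move: hx; rewrite /k; nra.
  exists ((fnorm w)^-1 *r w); split.
  - by rewrite starZr sw.
  - by rewrite (rtZ rt) tw mulr0.
  - by rewrite (nsqZ rt) -(fnorm_sq rt) -exprMn mulVf ?expr1n // gt_eqF.
  - move=> u uj uu; rewrite -scalerAl -scalerAr -scalerBr (fnormZ rt) ger0_norm //.
    by apply: le_trans key; rewrite ler_wpM2l // wu.
  - move=> g gj; rewrite linearZ /= -scalerBr (fnormZ rt) ger0_norm //.
    by apply: le_trans key; rewrite ler_wpM2l // wg.
have [h|h] := leP (nsq b) (nsq a).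
  apply: (fin a) => //; first lra.
    by move=> u uj uu; case: (comT u uj uu).
  by move=> g /actT[].
apply: (fin b) => //; first lra.
  by move=> u uj uu; case: (comT u uj uu).
by move=> g /actT[].
Qed.

End Action.

(** * Energies *)

Section Energy.
Variables (R : realType) (N : vonNeumannAlgebra R) (tau : {scalar N}).
Hypothesis ht : faithful_normal_tracial_state tau.
Implicit Types (x y z a b u v h g : N) (r : R).

Local Notation rt := (rtau_rtrace ht).
Local Notation nsq := (nsq (rtau tau)).
Local Notation fnorm := (fnorm (rtau tau)).

Definition additive_bounded (T : N -> N) :=
  (forall x y, T (x + y) = T x + T y) /\
  exists2 M : R, 0 <= M & forall x, fnorm (T x) <= M * fnorm x.

Definition energy (A : Type) (s : seq A) (T : A -> N -> N) x : R :=
  \sum_(a <- s) nsq (T a x).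

Lemma additiveN T : additive_bounded T -> forall x, T (- x) = - T x.
Proof.
move=> [TD _] x; apply: (addrI (T x)); rewrite -TD !subrr.
by apply: (addrI (T 0)); rewrite -TD !addr0.
Qed.

Lemma energy_par A (s : seq A) T x y : (forall k, additive_bounded (T k)) ->
  energy s T (x + y) + energy s T (x - y) = 2 * energy s T x + 2 * energy s T y.
Proof.
move=> hT; rewrite /energy -big_split /= !mulr_sumr -big_split /=.
apply: eq_bigr => a _; have [TD _] := hT a.
by rewrite !TD (additiveN (hT a)) (parallelogram ht).
Qed.

Lemma energy_lipschitz A (s : seq A) T : (forall k, additive_bounded (T k)) ->
  exists2 K : R, 0 <= K & forall x y, fnorm x <= 1 -> fnorm y <= 1 ->
    `|energy s T x - energy s T y| <= K * fnorm (x - y).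
Proof.
move=> hT; elim: s => [|a s [K K0 IH]].
  exists 0 => // x y _ _; rewrite /energy !big_nil subrr normr0 mul0r //.
have [TD [M M0 TM]] := hT a.
exists (M * (2 * M) + K); first by rewrite addr_ge0 // !mulr_ge0.
move=> x y x1 y1; rewrite /energy !big_cons -/(energy s T x) -/(energy s T y).
rewrite opprD addrACA (le_trans (ler_normD _ _)) // mulrDl lerD ?IH //.
rewrite -!(fnorm_sq rt) subr_sqr normrM mulrAC; apply: ler_pM => //.
  rewrite (le_trans (fnorm_dist rt _ _)) // -(additiveN (hT a)) -TD; exact: TM.
rewrite ger0_norm ?addr_ge0 ?fnorm_ge0 //.
have h1 : M * fnorm x <= M by rewrite -[leRHS]mulr1 ler_wpM2l.
have h2 : M * fnorm y <= M by rewrite -[leRHS]mulr1 ler_wpM2l.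
have := TM x; have := TM y; lra.
Qed.

Lemma energy_ge0 A (s : seq A) T x : 0 <= energy s T x.
Proof. by apply: sumr_ge0 => a _; exact: (nsq_ge0 rt). Qed.

Lemma energy_term (A : eqType) (s : seq A) T x (a : A) : a \in s ->
  nsq (T a x) <= energy s T x.
Proof.
move=> aS; apply: (@sum_term_le _ _ s (fun k : A => nsq (T k x))) => // k.
exact: (nsq_ge0 rt).
Qed.

Lemma energyZ A (s : seq A) T r x : (forall k, T k (r *r x) = r *r T k x) ->
  energy s T (r *r x) = r ^+ 2 * energy s T x.
Proof.
move=> TZ; rewrite /energy mulr_sumr; apply: eq_bigr => a _.
by rewrite TZ (nsqZ rt).
Qed.

Lemma energy_le A (s : seq A) T x y (c : R) : 0 <= c ->
  (forall k, fnorm (T k x) <= c * fnorm (T k y)) ->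
  energy s T x <= c ^+ 2 * energy s T y.
Proof.
move=> c0 h; rewrite /energy mulr_sumr; apply: ler_sum => a _.
by rewrite -!(fnorm_sq rt) -exprMn ler_sqr ?nnegrE ?mulr_ge0 ?fnorm_ge0.
Qed.

Lemma nsq_cvg (I : Type) (U : set_system I) {fU : Filter U} (y : I -> N) z :
  fnorm (y j) @[j --> U] --> fnorm z -> nsq (y j) @[j --> U] --> nsq z.
Proof.
move=> h; rewrite -(fnorm_sq rt z) expr2.
by apply: (cvg_ext _ (cvgM h h)) => j; rewrite -(fnorm_sq rt) expr2.
Qed.

Lemma energy_cvg (I : Type) (U : set_system I) {fU : Filter U} A (s : seq A) T
    (y : I -> N) z :
  (forall k, fnorm (T k (y j)) @[j --> U] --> fnorm (T k z)) ->
  energy s T (y j) @[j --> U] --> energy s T z.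
Proof.
move=> h; elim: s => [|a s IH].
  by rewrite /energy big_nil; apply: (@cvg_ext _ _ _ (fun=> 0)) => [j|];
    [rewrite big_nil|exact: cvg_cst].
rewrite /energy big_cons.
by apply: (cvg_ext _ (cvgD (nsq_cvg (h a)) IH)) => j; rewrite big_cons.
Qed.

Lemma comm_additive_bounded a : additive_bounded (fun x => a * x - x * a).
Proof.
split=> [x y|]; first by rewrite mulrDl mulrDr; ncring.
have [M M0 hM] := fnorm_bound rt a; exists (2 * M); first by rewrite mulr_ge0.
move=> x; rewrite (le_trans (fnormB rt _ _)) //.
by have [] := hM x; lra.
Qed.

Lemma comm_sq_le a z : contr z ->
  fnorm (a * (z * z) - z * z * a) <= 2 * fnorm (a * z - z * a).
Proof.
move=> cz; have -> : a * (z * z) - z * z * a =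
  (a * z - z * a) * z + z * (a * z - z * a) by ncring.
rewrite (le_trans (fnormD rt _ _)) //.
have := fnorm_contrl rt (a * z - z * a) cz.
by have := fnorm_contrr rt (a * z - z * a) cz; lra.
Qed.

Lemma morph_sq_le (s : {lrmorphism N -> N}) z : contr z -> contr (s z) ->
  fnorm (s (z * z) - z * z) <= 2 * fnorm (s z - z).
Proof.
move=> cz csz; have -> : s (z * z) - z * z = (s z - z) * s z + z * (s z - z).
  by rewrite rmorphM /=; ncring.
rewrite (le_trans (fnormD rt _ _)) //.
have := fnorm_contrl rt (s z - z) cz.
by have := fnorm_contrr rt (s z - z) csz; lra.
Qed.

End Energy.

(** * Admissible directions in the unit ball *)

Section Directions.
Variables (R : realType) (N : vonNeumannAlgebra R).
Implicit Types (x y g : N).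

(** Both 1 - y and g = 1 - y y = (1 - y) (1 + y) commute, so 1 - y dominates
    multiples of g g. *)
Lemma direction_le y x (s M K : R) : star y = y -> contr y -> star x = x ->
  nle x (M *r 1) -> nle ((1 - y) * (1 + y) * (1 + y)) (K *r 1) ->
  0 <= s -> 0 <= M -> s * M * K <= 1 ->
  nle (y + s *r ((1 - y * y) * x * (1 - y * y))) 1.
Proof.
move=> sy cy sx xM yK s0 M0 sMK; set g := 1 - y * y.
have sg : star g = g by rewrite /g !starE sy.
have p1 : pos (1 - y) by exact: contr_sa_le.
have p2 : pos (1 + y).
  rewrite -[y]opprK; apply: contr_sa_le; first by rewrite starN sy.
  exact: contrN.
have gg : (1 - y) * ((1 - y) * (1 + y) * (1 + y)) = g * g by rewrite /g; ncring.
have eA : (1 - y) * (1 - (s * M) *r ((1 - y) * (1 + y) * (1 + y))) =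
    1 - y - (s * M) *r (g * g).
  by rewrite (mulrBr (1 - y)) mulr1 -scalerAr gg.
have eB : s *r (g * (M *r 1 - x) * g) = (s * M) *r (g * g) - s *r (g * x * g).
  by rewrite (mulrBr g) -scalerAr mulr1 (mulrBl g) -scalerAl scalerBr scalerr.
have -> : nle (y + s *r (g * x * g)) 1 =
    pos ((1 - y) * (1 - (s * M) *r ((1 - y) * (1 + y) * (1 + y))) +
      s *r (g * (M *r 1 - x) * g)).
  by rewrite eA eB addrA subrK /nle opprD addrA.
apply: posD; last by apply: posZ => //; exact: pos_conjsa.
apply: pos_comm_mul => //.
  have : pos ((s * M) *r (K *r 1 - (1 - y) * (1 + y) * (1 + y)) + (1 - s * M * K) *r 1).
    apply: posD; apply: posZ => //; [exact: mulr_ge0|by rewrite subr_ge0|exact: pos1].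
  rewrite scalerBr scalerBlr scalerr scale1r.
  by rewrite (_ : _ + _ = 1 - (s * M) *r ((1 - y) * (1 + y) * (1 + y))) //; ncring.
have cm : (1 - y) * ((1 - y) * (1 + y) * (1 + y)) =
    (1 - y) * (1 + y) * (1 + y) * (1 - y) by ncring.
by rewrite (mulrBr (1 - y)) (mulrBl (1 - y) 1) mulr1 mul1r -scalerAr -scalerAl cm.
Qed.

Lemma direction_exists y x : star y = y -> contr y -> star x = x ->
  exists2 s : R, 0 < s &
    let h := s *r ((1 - y * y) * x * (1 - y * y)) in contr (y + h) /\ contr (y - h).
Proof.
move=> sy cy sx.
have syN : star (- y) = - y by rewrite starN sy.
have sxN : star (- x) = - x by rewrite starN sx.
have cyN := contrN cy.
have bnd (a : N) : star a = a -> exists2 M : R, 0 < M & nle a (M *r 1) by exact: pos_le_scalar.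
have [M1 M10 h1] := bnd _ sx; have [M2 M20 h2] := bnd _ sxN.
have sk (z : N) : star z = z -> star ((1 - z) * (1 + z) * (1 + z)) = (1 - z) * (1 + z) * (1 + z).
  by move=> sz; rewrite !starE sz; ncring.
have [K1 K10 k1] := bnd _ (sk _ sy); have [K2 K20 k2] := bnd _ (sk _ syN).
have up (a : N) (M M' : R) : nle a (M *r 1) -> M <= M' -> nle a (M' *r 1).
  move=> aM MM; apply: nle_trans aM _; rewrite /nle -scalerBlr; apply: posZ; last exact: pos1.
  by rewrite subr_ge0.
pose M := M1 + M2; pose K := K1 + K2.
have M0 : 0 < M by rewrite addr_gt0.
have K0 : 0 < K by rewrite addr_gt0.
have x1 : nle x (M *r 1) by apply: up h1 _; rewrite lerDl ltW.
have x2 : nle (- x) (M *r 1) by apply: up h2 _; rewrite lerDr ltW.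
have y1 : nle ((1 - y) * (1 + y) * (1 + y)) (K *r 1) by apply: up k1 _; rewrite lerDl ltW.
have y2 : nle ((1 - - y) * (1 + - y) * (1 + - y)) (K *r 1) by apply: up k2 _; rewrite lerDr ltW.
pose s := (M * K)^-1; have s0 : 0 < s by rewrite invr_gt0 mulr_gt0.
have sMK : s * M * K <= 1 by rewrite -mulrA mulVf // gt_eqF // mulr_gt0.
exists s => //=; set g := 1 - y * y; set h := s *r (g * x * g).
have sh : star h = h by rewrite /h starZr /g !starE sx sy mulrA.
have D := fun (a b : N) sa ca sb => @direction_le a b s M K sa ca sb.
have e1 := D _ _ sy cy sx x1 y1 (ltW s0) (ltW M0) sMK.
have e2 := D _ _ sy cy sxN x2 y1 (ltW s0) (ltW M0) sMK.
have e3 := D _ _ syN cyN sx x1 y2 (ltW s0) (ltW M0) sMK.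
have e4 := D _ _ syN cyN sxN x2 y2 (ltW s0) (ltW M0) sMK.
rewrite mulrNN in e3 e4; rewrite mulrN mulNr scalerN in e2 e4.
rewrite -/g -/h in e1 e2 e3 e4.
split; apply: le_contr; rewrite ?starD ?starN ?sy ?sh //.
  by rewrite opprD.
by rewrite opprB addrC.
Qed.

End Directions.

(** * The spectral gap *)

Section NoGap.
Variables (R : realType) (N : vonNeumannAlgebra R) (tau : {scalar N}).
Variables (Gamma : groupType) (sigma : Gamma -> {lrmorphism N -> N}).
Hypothesis ht : faithful_normal_tracial_state tau.
Hypothesis factor : vn_factor N.
Hypothesis act : vn_action sigma.
Implicit Types (x y z a b u v h : N) (g : Gamma) (r : R).

Local Notation rt := (rtau_rtrace ht).
Local Notation nsq := (nsq (rtau tau)).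
Local Notation fnorm := (fnorm (rtau tau)).

Definition comm_map a x := a * x - x * a.
Definition act_map g x := sigma g x - x.

Definition total_energy (F : seq N) (G : seq Gamma) z :=
  energy tau F comm_map z + energy tau G act_map z.

Lemma act_additive_bounded g : additive_bounded tau (act_map g).
Proof.
split=> [x y|]; first by rewrite /act_map linearD; ncring.
exists 2 => // x; rewrite (le_trans (fnormB rt _ _)) //.
by rewrite (action_fnorm ht factor act); lra.
Qed.

Lemma sa_trace0_complete :
  complete2 tau [set y | contr y /\ (star y = y /\ rtau tau y = 0)].
Proof.
apply: (ball_complete_sub ht) => y z Py yz; split.
  by apply: (closed_sa ht) yz => n; case: (Py n).
have h : (fun n => rtau tau (y n)) @ \oo --> rtau tau z.
  apply: cvg_dist0; apply: (cvg0_le _ yz) => n.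
  by rewrite normr_ge0 -(rtB rt); exact: (rt_le_fnorm rt).
apply/esym/(rcvg_unique _ h); apply: (@cvg_ext _ _ _ (fun=> 0)) => [n|].
  by case: (Py n).
exact: cvg_cst.
Qed.

Variables (U : set_system (idx N Gamma)) (x : idx N Gamma -> N).
Hypothesis uU : UltraFilter U.
Hypothesis netU : net_filter (@idx_le _ N Gamma) `<=` U.
Hypothesis x_sa : forall j, star (x j) = x j.
Hypothesis x_tr : forall j, rtau tau (x j) = 0.
Hypothesis x_nsq : forall j, nsq (x j) = 1.
Hypothesis x_comm : forall (j : idx N Gamma) u, u \in j.1.1 -> vn_unitary u ->
  fnorm (x j * u - u * x j) <= j.2.+1%:R^-1.
Hypothesis x_act : forall (j : idx N Gamma) g, g \in j.1.2 ->
  fnorm (sigma g (x j) - x j) <= j.2.+1%:R^-1.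
Let pU : ProperFilter U := @ultra_proper _ _ uU.
Local Existing Instance pU.

Lemma x_unitary_cvg u : vn_unitary u ->
  fnorm (x j * u - u * x j) @[j --> U] --> (0 : R).
Proof.
move=> uu; apply/cvgrPdist_lt => e /(inv_small)[n ne]; apply: netU.
exists ([:: u], [::], n) => // j [ju _ jn].
rewrite /= sub0r normrN ger0_norm ?fnorm_ge0 //.
apply: le_lt_trans (x_comm _ uu) _; first by apply: ju; rewrite mem_head.
by apply: le_lt_trans ne; rewrite lef_pV2 ?posrE ?ltr0n // ler_nat.
Qed.

Lemma x_act_cvg g : fnorm (sigma g (x j) - x j) @[j --> U] --> (0 : R).
Proof.
apply/cvgrPdist_lt => e /(inv_small)[n ne]; apply: netU.
exists ([::], [:: g], n) => // j [_ jg jn].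
rewrite /= sub0r normrN ger0_norm ?fnorm_ge0 //.
apply: le_lt_trans (x_act _) _; first by apply: jg; rewrite mem_head.
by apply: le_lt_trans ne; rewrite lef_pV2 ?posrE ?ltr0n // ler_nat.
Qed.

Lemma x_central_cvg a : fnorm (x j * a - a * x j) @[j --> U] --> (0 : R).
Proof.
have [M [M' [u [v [u' [v' [uu uv uu' uv' ->]]]]]]] := unitary_decomp a.
pose c w j := fnorm (x j * w - w * x j).
have k : `|M| * (c u j + c v j) + `|M'| * (c u' j + c v' j) @[j --> U] --> (0 : R).
  by apply: cvg0D; apply: cvg0Z; apply: cvg0D; exact: x_unitary_cvg.
apply: (cvg0_le _ k) => j; rewrite fnorm_ge0 /=.
have -> : x j * (M *r (u + v) + 'i%C *: (M' *r (u' + v'))) -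
    (M *r (u + v) + 'i%C *: (M' *r (u' + v'))) * x j =
  M *r ((x j * u - u * x j) + (x j * v - v * x j)) +
  'i%C *: (M' *r ((x j * u' - u' * x j) + (x j * v' - v' * x j))).
  have e p q : (x j * p - p * x j) + (x j * q - q * x j) =
      x j * (p + q) - (p + q) * x j by ncring.
  rewrite !e mulrDr mulrDl -!scalerAl -!scalerAr !scalerBr.
  by rewrite opprD addrACA.
rewrite (le_trans (fnormD rt _ _)) // fnorm_i !(fnormZ rt) lerD //.
  by rewrite ler_wpM2l //; exact: (fnormD rt).
by rewrite ler_wpM2l //; exact: (fnormD rt).
Qed.

(** Correcting x j by a scalar makes the trace of g x g vanish without
    affecting any of the asymptotic properties. *)
Lemma centered_vector k : star k = k -> 0 < nsq k ->
  exists x' : idx N Gamma -> N, [/\ (forall j, star (x' j) = x' j),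
    (forall j, nsq (x' j) = 1), (forall j, rtau tau (k * x' j * k) = 0),
    (forall a, fnorm (x' j * a - a * x' j) @[j --> U] --> (0 : R)) &
    (forall g, fnorm (sigma g (x' j) - x' j) @[j --> U] --> (0 : R))].
Proof.
move=> sk k0; pose t j := rtau tau (k * x j * k) / nsq k.
pose w j := x j - (t j) *r 1; pose c j := (fnorm (w j))^-1.
have nw j : nsq (w j) = 1 + t j ^+ 2.
  by rewrite (nsqB rt) x_nsq (nsqZ rt) (nsq1 rt) (ipZr rt) ip1 x_tr; ring.
have w1 j : 1 <= fnorm (w j).
  by rewrite -[leLHS](@sqrtr1 R); apply: ler_wsqrtr; rewrite nw lerDl sqr_ge0.
have c01 j : 0 <= c j <= 1.
  by rewrite invr_ge0 fnorm_ge0 /= invf_le1 // (lt_le_trans ltr01).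
have cle j z : fnorm (c j *r z) <= fnorm z.
  by have /andP[h1 h2] := c01 j; rewrite (fnormZ rt) ger0_norm // ler_piMl ?fnorm_ge0.
exists (fun j => c j *r w j); split.
- by move=> j; rewrite starZr /w starB starZr star1 x_sa.
- move=> j; rewrite (nsqZ rt) -(fnorm_sq rt) -exprMn mulVf ?expr1n // gt_eqF //.
  exact: lt_le_trans ltr01 (w1 j).
- move=> j; rewrite -scalerAr -scalerAl (rtZ rt) /w mulrBr mulrBl -scalerAr.
  rewrite -scalerAl mulr1 (rtB rt) (rtZ rt).
  have -> : rtau tau (k * k) = nsq k by rewrite nsqE sk.
  by rewrite /t divfK ?subrr ?mulr0 // gt_eqF.
- move=> a; apply: (cvg0_le _ (@x_central_cvg a)) => j; rewrite fnorm_ge0 /=.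
  have -> : (c j *r w j) * a - a * (c j *r w j) = c j *r (x j * a - a * x j).
    rewrite -scalerAl -scalerAr -scalerBr /w; congr (_ *: _).
    by rewrite mulrBl mulrBr -scalerAl -scalerAr mul1r mulr1; ncring.
  exact: cle.
- move=> g; apply: (cvg0_le _ (@x_act_cvg g)) => j; rewrite fnorm_ge0 /=.
  have -> : sigma g (c j *r w j) - c j *r w j = c j *r (sigma g (x j) - x j).
    rewrite linearZ /= -scalerBr /w; congr (_ *: _).
    by rewrite rmorphB /= rmorph_alg; ncring.
  exact: cle.
Qed.

(** At a maximizer y of nsq - A * energy the second variation in the admissible
    directions k x k, with k = 1 - y y, is nonpositive; asymptotically
    it only sees the element k k of the algebra. *)
Lemma second_variation (F : seq N) (G : seq Gamma) (A c : R) y k :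
  k = 1 - y * y -> contr y -> star y = y -> rtau tau y = 0 -> 0 < nsq k ->
  (forall h, contr (y + h) -> contr (y - h) -> star h = h -> rtau tau h = 0 ->
    nsq h - A * total_energy F G h <= c * nsq h) ->
  (1 - c) * nsq (k * k) <= A * total_energy F G (k * k).
Proof.
move=> kE cy sy ty k0 hmax; pose En := total_energy F G; rewrite -/En in hmax *.
have sk : star k = k by rewrite kE !starE sy.
have [x' [x'_sa x'_nsq x'_tr x'_comm x'_act]] := centered_vector sk k0.
have TZ (r : R) z : En (r *r z) = r ^+ 2 * En z.
  rewrite /En /total_energy mulrDr; congr (_ + _); apply: (energyZ ht) => b.
    by rewrite /comm_map -scalerAl -scalerAr scalerBr.
  by rewrite /act_map linearZ /= scalerBr.
have ineq j : (1 - c) * nsq (k * x' j * k) <= A * En (k * x' j * k).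
  have [s s0 /= [h1 h2]] := direction_exists sy cy (x'_sa j).
  have := hmax _ h1 h2; rewrite -kE starZr !starM sk x'_sa mulrA => /(_ erefl).
  rewrite (rtZ rt) x'_tr mulr0 => /(_ erefl).
  rewrite (nsqZ rt) TZ => h.
  have s2 : 0 < s ^+ 2 by rewrite exprn_gt0.
  by rewrite -(ler_pM2l s2); lra.
have cn : fnorm (k * x' j * k) @[j --> U] --> fnorm (k * k).
  apply: (central_fnorm_near ht factor uU x'_sa x'_nsq x'_comm).
  exact: (central_conj ht uU x'_comm).
have cE : En (k * x' j * k) @[j --> U] --> En (k * k).
  apply: cvgD; apply: (energy_cvg ht) => b.
    exact: (central_conj_comm ht factor uU x'_sa x'_nsq x'_comm).
  exact: (central_conj_morph ht factor uU x'_sa x'_nsq x'_comm).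
have c1 : (1 - c) * nsq (k * x' j * k) @[j --> U] --> (1 - c) * nsq (k * k).
  by apply: cvgMl_tmp; exact: (nsq_cvg ht cn).
have c2 : A * En (k * x' j * k) @[j --> U] --> A * En (k * k).
  by apply: cvgMl_tmp.
exact: (rcvg_le c1 c2 ineq).
Qed.

End NoGap.

Theorem theorem3p1 (R : realType) (N : vonNeumannAlgebra R)
    (tau : {scalar N}) (Gamma : groupType)
    (sigma : Gamma -> {lrmorphism N -> N}) :
  vn_factor N -> vn_type_II1 N -> faithful_normal_tracial_state tau ->
  vn_action sigma ->
  (forall (I : Type) (le : I -> I -> Prop) (x : I -> N),
    directed_preorder le ->
    (exists M : R, forall i, opnorm_le (x i) M) ->
    (forall a : N,
      norm2 tau (x i * a - a * x i) @[i --> net_filter le] --> (0 : R)) ->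
    (forall g : Gamma,
      norm2 tau (sigma g (x i) - x i) @[i --> net_filter le] --> (0 : R)) ->
    norm2 tau (x i - (tau (x i))%:A) @[i --> net_filter le] --> (0 : R)) ->
  exists (S : {fset N}) (K : {fset Gamma}) (kappa : R),
    [/\ forall u : N, u \in S -> vn_unitary u,
        0 < kappa &
        forall x : N,
          norm2 tau (x - (tau x)%:A) <=
            kappa * (\sum_(u <- S) norm2 tau (u * x - x * u) +
                     \sum_(g <- K) norm2 tau (sigma g x - x))].
Proof.
move=> factor _ ht act full; apply: contrapT => nogap.
have rt := rtau_rtrace ht.
have e0 : (0 : R) < 10^-1 by rewrite invr_gt0.
have [F [G [d [d0 gap]]]] := bounded_gap ht full e0.
pose En z := total_energy tau sigma F G z.
(* With this weight, L y close to nonnegative forces the energy of y below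
   d ^+ 2. *)
pose A := 2 / d ^+ 2; have A0 : 0 < A by rewrite divr_gt0 // exprn_gt0.
have Ad : A * d ^+ 2 = 2 by rewrite /A divfK // gt_eqF // exprn_gt0.
pose L z := nsq (rtau tau) z - A * En z.
have bF a : additive_bounded tau (@comm_map R N a) by exact: (comm_additive_bounded ht).
have bG g : additive_bounded tau (act_map sigma g) by exact: (act_additive_bounded ht factor act).
have [KF KF0 lF] := energy_lipschitz ht F bF.
have [KG KG0 lG] := energy_lipschitz ht G bG.
pose c : R := 100^-1; have c0 : 0 < c by rewrite /c; lra.
have [||||||y [[cy [sy ty]] hmax hL]] :=
    @quadratic_maximum _ _ _ ht _ L (2 + A * (KF + KG)) c (sa_trace0_complete ht).
- exists 0; split; first by rewrite /= /contr mulr0; apply/nle0; exact: pos1.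
  by split; [exact: star0|exact: (rt0 rt)].
- by move=> z [cz _]; exact: (fnorm_contr ht).
- by [].
- by rewrite addr_ge0 // mulr_ge0 ?addr_ge0 // ltW.
- move=> z w; have hE : En (z + w) + En (z - w) = 2 * En z + 2 * En w.
    have h1 := energy_par ht F z w bF; have h2 := energy_par ht G z w bG.
    by rewrite /En /total_energy; lra.
  have hA : A * En (z + w) + A * En (z - w) = 2 * (A * En z) + 2 * (A * En w).
    by rewrite -mulrDr hE; ring.
  by have h3 := parallelogram ht z w; rewrite /L; lra.
- move=> z w [cz _] [cw _].
  have z1 := fnorm_contr ht cz; have w1 := fnorm_contr ht cw.
  have h1 := lF _ _ z1 w1; have h2 := lG _ _ z1 w1.
  have h3 : `|nsq (rtau tau) z - nsq (rtau tau) w| <= 2 * fnorm (rtau tau) (z - w).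
    rewrite -!(fnorm_sq rt) subr_sqr normrM mulrC; apply: ler_pM => //; last exact: (fnorm_dist rt).
    by rewrite ger0_norm ?addr_ge0 ?fnorm_ge0 //; lra.
  have -> : L z - L w = (nsq (rtau tau) z - nsq (rtau tau) w) - A * (En z - En w).
    by rewrite /L; ring.
  rewrite (le_trans (ler_normB _ _)) // [leRHS]mulrDl lerD // normrM (gtr0_norm A0).
  rewrite -(mulrA A); apply: ler_wpM2l; first exact: ltW.
  by rewrite /En /total_energy opprD addrACA mulrDl (le_trans (ler_normD _ _)) // lerD.
have [xj hx] := choice (no_gap_vector ht act nogap).
have fP : ProperFilter (net_filter (@idx_le _ N Gamma)).
  by apply: net_filter_proper; exact: idx_directed.
have [U [uU netU]] := ultraFilterLemma fP.
have ns1 : nsq (rtau tau) y <= 1.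
  by rewrite -(fnorm_sq rt) expr_le1 ?fnorm_ge0 // (fnorm_contr ht).
have LE : A * En y <= nsq (rtau tau) y + 4 / 100.
  have En00 : En 0 = 0.
    have := energy_par ht F 0 0 bF; have := energy_par ht G 0 0 bG.
    by rewrite /En /total_energy subr0 addr0; lra.
  have := hL 0; rewrite /L (nsq0 rt) En00 mulr0 subr0 => h.
  suff : 0 <= nsq (rtau tau) y - A * En y + c * 4 by rewrite /c; lra.
  apply: h; split; first by rewrite /= /contr mulr0; apply/nle0; exact: pos1.
  by split; [exact: star0|exact: (rt0 rt)].
have ny : fnorm (rtau tau) y <= 10^-1.
  have Ed : En y <= d ^+ 2 by rewrite -(ler_pM2l A0) Ad; lra.
  have tz : tau y = 0.
    by have := tau_real ht sy; move: ty; rewrite /rtau; case: (tau y) => p q /= -> ->.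
  have := gap y cy; rewrite tz scale0r subr0; apply.
    move=> a aF; rewrite -ler_sqr ?nnegrE ?fnorm_ge0 ?(ltW d0) // (fnorm_sq rt).
    apply: le_trans Ed; apply: le_trans (energy_term ht (@comm_map R N) y aF) _.
    by rewrite lerDl (energy_ge0 ht).
  move=> g gG; rewrite -ler_sqr ?nnegrE ?fnorm_ge0 ?(ltW d0) // (fnorm_sq rt).
  apply: le_trans Ed; apply: le_trans (energy_term ht (act_map sigma) y gG) _.
  by rewrite lerDr (energy_ge0 ht).
have ns2 : nsq (rtau tau) y <= 100^-1.
  rewrite -(fnorm_sq rt) (_ : 100^-1 = 10^-1 ^+ 2); last by field.
  by rewrite ler_sqr ?nnegrE ?fnorm_ge0 // ltW.
pose k : N := 1 - y * y.
have pk : pos k by move: cy; rewrite /= /contr sy.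
have sk := pos_sa pk.
have ck : contr k.
  by apply: pos_contr => //; rewrite /nle /k opprB addrC subrK; exact: pos_sqr.
have tk : rtau tau k = 1 - nsq (rtau tau) y by rewrite (rtB rt) (rt1 rt) nsqE sy.
have sq_le (p q : R) : 0 <= q -> q <= p -> q ^+ 2 <= p ^+ 2.
  by move=> q0 qp; rewrite ler_sqr ?nnegrE // (le_trans q0).
(* The contradiction is 99/100 95/100 <= 16 (1/100 + 4/100), where 4/100 is the
   loss 4 c in the comparison of L y with L 0. *)
have nk : 98 / 100 <= nsq (rtau tau) k.
  apply: le_trans (rt_sq_le rt k); apply: (@le_trans _ _ ((99 / 100) ^+ 2)); first lra.
  by apply: sq_le; lra.
have nkk : 95 / 100 <= nsq (rtau tau) (k * k).
  apply: le_trans (rt_sq_le rt (k * k)).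
  have -> : rtau tau (k * k) = nsq (rtau tau) k by rewrite nsqE sk.
  by apply: (@le_trans _ _ ((98 / 100) ^+ 2)); [lra|apply: sq_le => //; lra].
have sv : (1 - c) * nsq (rtau tau) (k * k) <= A * En (k * k).
  apply: (@second_variation _ _ _ _ _ ht factor U xj uU netU _ _ _ _ _ F G A c y k) => //.
  - by move=> j; case: (hx j).
  - by move=> j; case: (hx j).
  - by move=> j; case: (hx j).
  - by move=> j u; case: (hx j) => _ _ _ h _; exact: h.
  - by move=> j g; case: (hx j) => _ _ _ _; exact.
  - lra.
  - move=> h c1 c2 sh th; apply: hmax; split=> //; split.
    + by rewrite starD sy sh.
    + by rewrite (rtD rt) ty th addr0.
    + by rewrite starB sy sh.
    + by rewrite (rtB rt) ty th subr0.
have Ekk : En (k * k) <= 4 ^+ 2 * En y.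
  rewrite /En /total_energy (mulrDr (4 ^+ 2)); apply: lerD; apply: (energy_le ht) => //.
    move=> a; apply: le_trans (comm_sq_le ht a ck) _.
    have -> : a * k - k * a = - (a * (y * y) - y * y * a) by rewrite /k; ncring.
    by rewrite (fnormN rt); have := comm_sq_le ht a cy; rewrite /comm_map; lra.
  move=> g; apply: le_trans (morph_sq_le ht ck (action_contr act g ck)) _.
  have -> : sigma g k - k = - (sigma g (y * y) - y * y).
    by rewrite /k rmorphB rmorph1; ncring.
  rewrite (fnormN rt); have := morph_sq_le ht cy (action_contr act g cy).
  by rewrite /act_map; lra.
have : A * En (k * k) <= 16 * (A * En y).
  by rewrite mulrCA; apply: ler_wpM2l; [exact: ltW|move: Ekk; lra].
by move: sv; rewrite /c; lra.
Qed.
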